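(* For every fixed integer $k \ge 1$, the problem $k$-MaxATSP is randomized $\tfrac{1}{2}$-approximable. That is, there is a randomized algorithm that, on input an $\mathbb{N}^k$-labeled complete directed graph $G=(V,E,w)$, runs in time polynomial in the encoding length of $G$ and outputs a set $\mathcal{S}$ of Hamiltonian cycles of $G$ such that, with probability at least $\tfrac12$, for every Hamiltonian cycle $T$ of $G$ there is some $T' \in \mathcal{S}$ with $w_i(T') \ge \tfrac12 w_i(T)$ for all $i \in \{1,\dots,k\}$.
   Context: An $\mathbb{N}^k$-labeled complete directed graph is a tuple $G=(V,E,w)$ with $V$ a finite vertex set, $E = \{(u,v) \in V\times V : u \ne v\}$, and $w\colon E \to \mathbb{N}^k$ a weight function (weights encoded in binary) with components $w_1,\dots,w_k$; $w$ is extended to edge sets by summation. A Hamiltonian cycle is a directed cycle visiting every vertex exactly once, viewed as its set of edges. $k$-MaxATSP: given such a graph, the solutions are the Hamiltonian cycles $C$ and the (vector) weight of $C$ is $w(C)$, to be maximized. An $\alpha$-approximation algorithm runs in polynomial time and outputs a set of solutions such that every solution $s$ is $\alpha$-approximated by some output solution $s'$, i.e., $w_i(s') \ge \alpha w_i(s)$ for all $i$; it is randomized if it may fail to do so with probability at most $\tfrac12$. *)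

(* Defs.v *)
From mathcomp Require Import all_boot.
Set Implicit Arguments. Unset Strict Implicit. Unset Printing Implicit Defensive.

(* An instance: vertex set V = {0,...,n-1} (as nats) and weights
   w u v : 'I_k -> nat; only the values on edges (u,v), u <> v, u,v < n,
   are ever used (they form the weight function w : E -> N^k). *)

Definition ham_order (n : nat) (s : seq nat) : bool :=
  [&& 2 <= n, size s == n, uniq s & all (fun v => v < n) s].

Definition cyc_edges (s : seq nat) : seq (nat * nat) :=
  [seq (nth 0 s i, nth 0 s (i.+1 %% size s)) | i <- iota 0 (size s)].

Definition is_ham_cycle (n : nat) (C : seq (nat * nat)) : Prop :=
  exists2 s, ham_order n s & perm_eq C (cyc_edges s).

Definition cweight k (w : nat -> nat -> 'I_k -> nat) (C : seq (nat * nat)) (i : 'I_k) : nat :=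
  \sum_(e <- C) w e.1 e.2 i.

Definition half_approx_set k (n : nat) (w : nat -> nat -> 'I_k -> nat)
    (S : seq (seq nat)) : Prop :=
  forall C, is_ham_cycle n C ->
    exists2 s, s \in S & forall i : 'I_k, cweight w C i <= 2 * cweight w (cyc_edges s) i.

Fixpoint bitsF (fuel m : nat) : seq bool :=
  match fuel with
  | 0 => [::]
  | f.+1 => if m == 0 then [::] else odd m :: bitsF f m./2
  end.
Definition bits (m : nat) : seq bool := bitsF m m.

Definition encL T (f : T -> seq bool) (xs : seq T) : seq bool :=
  flatten [seq true :: f x | x <- xs] ++ [:: false].

Definition encN (m : nat) : seq bool := encL (fun b => [:: b]) (bits m).

Definition edges_of (n : nat) : seq (nat * nat) :=
  [seq e <- [seq (u, v) | u <- iota 0 n, v <- iota 0 n] | e.1 != e.2].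

Definition encG k (n : nat) (w : nat -> nat -> 'I_k -> nat) : seq bool :=
  encN n ++ encL encN (flatten [seq [seq w e.1 e.2 i | i <- enum 'I_k] | e <- edges_of n]).

Definition encS (S : seq (seq nat)) : seq bool := encL (encL encN) S.

Definition sym := option bool.  (* None = blank *)
Inductive move := MLeft | MRight | MStay.

Record TM := {
  tm_Q : nat;   (* states are 'I_(tm_Q.+1); start state is ord0 *)
  tm_delta : 'I_tm_Q.+1 -> sym -> option ('I_tm_Q.+1 * sym * move)  (* None = halt *)
}.

Record config (M : TM) := Config {
  c_state : 'I_(tm_Q M).+1;
  c_left : seq sym;   (* cells left of the head, nearest first *)
  c_head : sym;
  c_right : seq sym   (* cells right of the head, nearest first *)
}.

Definition do_move (l : seq sym) (a : sym) (r : seq sym) (m : move)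
  : seq sym * sym * seq sym :=
  match m with
  | MStay => (l, a, r)
  | MLeft => (behead l, head None l, a :: r)
  | MRight => (a :: l, head None r, behead r)
  end.

Fixpoint run (M : TM) (t : nat) (c : config M) : option (config M) :=
  match tm_delta (c_state c) (c_head c) with
  | None => Some c
  | Some (q, a, m) =>
      match t with
      | 0 => None
      | t'.+1 => let: (l, h, r) := do_move (c_left c) a (c_right c) m in
                 run t' (Config q l h r)
      end
  end.

(* initial configuration: tape holds the input x, a blank, then the coins r *)
Definition init (M : TM) (x r : seq bool) : config M :=
  let inp := map Some x ++ None :: map Some r in
  Config (ord0 : 'I_(tm_Q M).+1) [::] (head None inp) (behead inp).

Fixpoint take_bits (s : seq sym) : seq bool :=
  match s with
  | Some b :: s' => b :: take_bits s'
  | _ => [::]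
  end.

Definition output (M : TM) (c : config M) : seq bool := take_bits (c_head c :: c_right c).

Definition runs_to (M : TM) (t : nat) (x r y : seq bool) : Prop :=
  exists2 c, run t (init M x r) = Some c & output c = y.

(* Main.v *)
Require Import Defs.
From mathcomp Require Import all_boot.
From mathcomp Require Import all_order all_algebra perm zify ring lra.
From Stdlib Require Import FunctionalExtensionality.
Set Implicit Arguments. Unset Strict Implicit. Unset Printing Implicit Defensive.
Import Order.TTheory GRing.Theory Num.Theory.

(* Fix a tour T and, for each of the k weights, mark the 4k + 2 edges of T whose weight
   has the longest binary expansion; let s_i be the length of the shortest expansion
   among them. The marked edges cut T into paths, with constantly many edges in total,
   so that the path system and the s_i can be guessed exhaustively. Contracting the
   paths turns the rest of T into a cycle cover of a smaller graph, all of whose edges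
   satisfy w_i < 2^(s_i). Weights rounded down to multiples of 2^(s_i - t), where 2^t
   exceeds the input size, take polynomially many values, so a cycle cover with the same
   rounded weights can be found as in Mulmuley, Vazirani and Vazirani: random edge
   weights make a minimum cover with the prescribed sums unique, and the parities of
   the coefficients of a determinant over F_2[X], computed without divisions by Bird's
   algorithm, reveal it edge by edge.

   Opening each cycle of the cover yields a tour. Every cycle has two distinct edges to
   open it at, and a vector balancing argument (Beck and Fiala) chooses among them so that,
   for every i, at most half of the weight of the cover plus k 2^(s_i) is lost; a
   subset-sum table finds such a choice. The path system, which is kept entirely, weighs
   at least (4k + 2) 2^(s_i - 1), and this compensates for the error terms. *)

(** The constant 4k + 2 is what the bookkeeping demands. For weight i let I be the part of T inside
    the path system, R the rest, and V what the opened cover keeps. At most n < 2^t edges lose less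
    than 2^(s_i - t) each to rounding, and balancing loses half of the cover plus k 2^(s_i);
    together 2 V >= R - (2k + 1) 2^(s_i). Hence I >= (2k + 1) 2^(s_i) gives 2 (I + V) >= I + R.

    Rounding is forced by the algebra: weights occur as exponents in the determinant and as indices
    of the table, so they must be polynomially bounded.

    The balanced opening is never computed. It only has to exist: the table stores one opening for
    each total code of the lost edges, and equal codes mean equal rounded losses in all k
    coordinates.

    Over F_2 signs disappear, so a determinant counts permutations modulo 2. In a code the random
    weight is the top digit and the rounded weights are the lower ones. The coins are good if
    isolation succeeds at once for every path system, threshold vector and vector of rounded sums;
    trying every exponent W then needs no knowledge of T. *)

(** * Structured tape programs *)

(* Positions grow to the left: [MLeft] is [+1]. *)
Definition tape := int -> sym.
Definition upd (f : tape) (x : int) (a : sym) : tape := fun y => if y == x then a else f y.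
Definition dir (m : move) : int := match m with MLeft => 1 | MRight => -1 | MStay => 0 end.

Lemma upd_same (f : tape) x : upd f x (f x) = f.
Proof. by apply: functional_extensionality => y; rewrite /upd; case: eqP => [->|]. Qed.

Inductive prog :=
| Act of (sym -> sym * move)
| PSeq of prog & prog
| PIf of pred sym & prog & prog
| PWhile of pred sym & prog.

(** Big-step semantics with exact step counts. Every test costs one step because compiled
    conditionals and loops have a separate test state. *)
Inductive px : prog -> tape * int -> tape * int -> nat -> Prop :=
| px_act g f x : px (Act g) (f, x) (upd f x (g (f x)).1, (x + dir (g (f x)).2)%R) 1
| px_seq p q s s1 s2 n1 n2 : px p s s1 n1 -> px q s1 s2 n2 -> px (PSeq p q) s s2 (n1 + n2)
| px_ift (t : pred sym) p q f x s n :
    t (f x) -> px p (f, x) s n -> px (PIf t p q) (f, x) s n.+1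
| px_iff (t : pred sym) p q f x s n :
    ~~ t (f x) -> px q (f, x) s n -> px (PIf t p q) (f, x) s n.+1
| px_whilef (t : pred sym) p f x : ~~ t (f x) -> px (PWhile t p) (f, x) (f, x) 1
| px_whilet (t : pred sym) p f x s1 s2 n1 n2 :
    t (f x) -> px p (f, x) s1 n1 -> px (PWhile t p) s1 s2 n2 ->
    px (PWhile t p) (f, x) s2 (n1 + n2).+1.

(** A machine with a single exit: a transition to [None] still writes and moves, then leaves the
    fragment. Arbitrary finite types as state sets let fragments be combined by sums, without
    renumbering. *)
Record frag := Frag {
  fQ : finType; fq0 : fQ; fdelta : fQ -> sym -> option fQ * sym * move }.

Definition fstep F (q : fQ F) (s : tape * int) : option (fQ F) * (tape * int) :=
  let: (q', a, m) := fdelta q (s.1 s.2) in (q', (upd s.1 s.2 a, (s.2 + dir m)%R)).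

Inductive fexit F : fQ F -> tape * int -> tape * int -> nat -> Prop :=
| fx_last q s s' : fstep q s = (None, s') -> fexit q s s' 1
| fx_step q s q1 s1 s' n :
    fstep q s = (Some q1, s1) -> fexit q1 s1 s' n -> fexit q s s' n.+1.

Fixpoint compile (p : prog) : frag :=
  match p with
  | Act g => @Frag unit tt (fun _ a => (None, (g a).1, (g a).2))
  | PSeq p q =>
      let F := compile p in let G := compile q in
      @Frag (fQ F + fQ G)%type (inl (fq0 F)) (fun s a =>
        match s with
        | inl u => let: (u', b, m) := fdelta u a in
                   (Some (if u' is Some v then inl v else inr (fq0 G)), b, m)
        | inr u => let: (u', b, m) := fdelta u a in (omap inr u', b, m)
        end)
  | PIf t p q =>
      let F := compile p in let G := compile q in
      @Frag (option (fQ F + fQ G)%type) None (fun s a =>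
        match s with
        | None => (Some (Some (if t a then inl (fq0 F) else inr (fq0 G))), a, MStay)
        | Some (inl u) => let: (u', b, m) := fdelta u a in (omap (Some \o inl) u', b, m)
        | Some (inr u) => let: (u', b, m) := fdelta u a in (omap (Some \o inr) u', b, m)
        end)
  | PWhile t p =>
      let F := compile p in
      @Frag (option (fQ F)) None (fun s a =>
        match s with
        | None => (if t a then Some (Some (fq0 F)) else None, a, MStay)
        | Some u => let: (u', b, m) := fdelta u a in (Some u', b, m)
        end)
  end.

Lemma stay f x : (upd f x (f x), (x + dir MStay)%R) = (f, x).
Proof. by rewrite upd_same addr0. Qed.

(** The one simulation argument behind all cases of [compileP]: [F] sits inside [G] through [h],
    with its exit redirected to [e], which is either the exit of [G] or a state where the run goes
    on. *)
Lemma fexit_cont F G (h : fQ F -> fQ G) (e : option (fQ G)) :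
  (forall u a, fdelta (h u) a =
     let: (u', b, m) := fdelta u a in (if u' is Some v then Some (h v) else e, b, m)) ->
  forall u s s1 n, fexit u s s1 n ->
  match e with
  | None => fexit (h u) s s1 n
  | Some w => forall s2 n2, fexit w s1 s2 n2 -> fexit (h u) s s2 (n + n2)
  end.
Proof.
move=> Hd u s s1 n; elim=> {u s s1 n} [u s s' Hs|u s u1 s1 s' n Hs Hx IH].
  have Hs' : fstep (h u) s = (e, s').
    by move: Hs; rewrite /fstep Hd; case: (fdelta _ _) => [[[v|] b] m] [] // ->.
  case: e Hs' {Hd} => [w|] Hs'; last exact: fx_last.
  by move=> s2 n2 Hw; rewrite add1n; exact: fx_step Hs' Hw.
have Hs' : fstep (h u) s = (Some (h u1), s1).
  by move: Hs; rewrite /fstep Hd; case: (fdelta _ _) => [[[v|] b] m] [] // -> ->.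
case: e IH {Hd} => [w|] IH.
  by move=> s2 n2 Hw; rewrite addSn; apply: fx_step Hs' _; exact: IH.
exact: fx_step Hs' IH.
Qed.

Lemma compileP p s s' n : px p s s' n -> fexit (fq0 (compile p)) s s' n.
Proof.
elim=> {p s s' n}.
- by move=> g f x; apply: fx_last.
- move=> p q s s1 s2 n1 n2 _ IH1 _ IH2.
  apply: (@fexit_cont _ (compile (PSeq p q)) inl (Some (inr (fq0 (compile q)))) _ _ _ _ _ IH1) => [u a /=|].
    by case: (fdelta u a) => [[[]]].
  apply: (@fexit_cont _ (compile (PSeq p q)) inr None _ _ _ _ _ IH2) => u a /=.
  by case: (fdelta u a) => [[[]]].
- move=> t p q f x s n Ht _ IH.
  apply: (@fx_step (compile (PIf t p q)) _ _ (Some (inl (fq0 (compile p)))) (f, x)).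
    by rewrite /fstep /= Ht stay.
  apply: (@fexit_cont _ (compile (PIf t p q)) (Some \o inl) None _ _ _ _ _ IH) => u a /=.
  by case: (fdelta u a) => [[[]]].
- move=> t p q f x s n Ht _ IH.
  apply: (@fx_step (compile (PIf t p q)) _ _ (Some (inr (fq0 (compile q)))) (f, x)).
    by rewrite /fstep /= (negbTE Ht) stay.
  apply: (@fexit_cont _ (compile (PIf t p q)) (Some \o inr) None _ _ _ _ _ IH) => u a /=.
  by case: (fdelta u a) => [[[]]].
- by move=> t p f x Ht; apply: fx_last; rewrite /fstep /= (negbTE Ht) stay.
- move=> t p f x s1 s2 n1 n2 Ht _ IH1 _ IH2.
  apply: (@fx_step (compile (PWhile t p)) _ _ (Some (fq0 (compile p))) (f, x)).
    by rewrite /fstep /= Ht stay.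
  apply: (@fexit_cont _ (compile (PWhile t p)) Some (Some None) _ _ _ _ _ IH1) => // u a /=.
  by case: (fdelta u a) => [[[]]].
Qed.

(* State 0 is an alias of the start state; the other states enumerate [option Q],
   where [None] is the halting state. *)
Definition tm_dec (F : frag) (q : 'I_(#|{: option (fQ F)}|).+1) : option (fQ F) :=
  if unlift ord0 q is Some j then enum_val j else Some (fq0 F).
Definition tm_enc (F : frag) (q : option (fQ F)) : 'I_(#|{: option (fQ F)}|).+1 :=
  lift ord0 (enum_rank q).

Lemma tm_encK F q : tm_dec (@tm_enc F q) = q.
Proof. by rewrite /tm_dec /tm_enc liftK enum_rankK. Qed.

Definition tm_of (F : frag) : TM :=
  @Build_TM #|{: option (fQ F)}| (fun q a =>
    if tm_dec q is Some u then let: (u', b, m) := fdelta u a in Some (tm_enc u', b, m)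
    else None).

Definition tape_rep (M : TM) (c : config M) (s : tape * int) : Prop :=
  [/\ c_head c = s.1 s.2,
      forall i : nat, nth None (c_left c) i = s.1 (s.2 + 1 + i%:Z)%R
    & forall i : nat, nth None (c_right c) i = s.1 (s.2 - 1 - i%:Z)%R].

Lemma tape_rep_move (M : TM) (c : config M) s q a m : tape_rep c s ->
  tape_rep (let: (l, h, r) := do_move (c_left c) a (c_right c) m in @Config M q l h r)
    (upd s.1 s.2 a, (s.2 + dir m)%R).
Proof.
case: s => f x [/= Hh Hl Hr]; case: m => /=; split=> /=.
- by rewrite -nth0 Hl /upd ifF; [congr f|apply/eqP]; lia.
- by move=> i; rewrite nth_behead Hl /upd ifF; [congr f|apply/eqP]; lia.
- case=> [|i] /=; first by rewrite /upd ifT //; apply/eqP; lia.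
  by rewrite Hr /upd ifF; [congr f|apply/eqP]; lia.
- by rewrite -nth0 Hr /upd ifF; [congr f|apply/eqP]; lia.
- case=> [|i] /=; first by rewrite /upd ifT //; apply/eqP; lia.
  by rewrite Hl /upd ifF; [congr f|apply/eqP]; lia.
- by move=> i; rewrite nth_behead Hr /upd ifF; [congr f|apply/eqP]; lia.
- by rewrite /upd ifT //; apply/eqP; lia.
- by move=> i; rewrite Hl /upd ifF; [congr f|apply/eqP]; lia.
- by move=> i; rewrite Hr /upd ifF; [congr f|apply/eqP]; lia.
Qed.

Lemma run_tm_of F u s s' n : fexit u s s' n ->
  forall (c : config (tm_of F)) t, tm_dec (c_state c) = Some u -> tape_rep c s -> n <= t ->
  exists2 c', run t c = Some c' & tape_rep c' s'.
Proof.
elim=> {u s s' n} [u s s' Hs|u s u1 s1 s' n Hs Hx IH] c [//|t] Hq Hr Ht.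
  move: Hs; rewrite /fstep; have [Hh _ _] := Hr; rewrite -Hh.
  case Ed: (fdelta u (c_head c)) => [[u' b] m] [Eu Es].
  have := tape_rep_move (tm_enc None : 'I_(tm_Q (tm_of F)).+1) b m Hr.
  rewrite /run -/run /= Hq Ed Eu.
  case: (do_move _ _ _ _) => [[l h] r] Hr'.
  exists (@Config (tm_of F) (tm_enc None) l h r); last by rewrite -Es.
  by case: t {Ht} => [|t] /=; rewrite tm_encK.
move: Hs; rewrite /fstep; have [Hh _ _] := Hr; rewrite -Hh.
case Ed: (fdelta u (c_head c)) => [[u' b] m] [Eu Es].
have := tape_rep_move (tm_enc (Some u1) : 'I_(tm_Q (tm_of F)).+1) b m Hr.
rewrite /run -/run /= Hq Ed Eu.
case: (do_move _ _ _ _) => [[l h] r] Hr'.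
by apply: IH => //=; rewrite ?tm_encK // -Es.
Qed.

(** Input cell [i] is position [Negz i], so the head starts at -1 and the positions from 0 on are
    blank and free for the stacks. *)
Lemma tm_of_prog p s' n x (r : seq bool) :
  px p ((fun z => if z is Negz i then nth None (map Some x ++ None :: map Some r) i else None),
        (-1)%R) s' n ->
  forall t, n <= t ->
  exists2 c', run t (init (tm_of (compile p)) x r) = Some c' & tape_rep c' s'.
Proof.
move=> Hp t Ht; apply: run_tm_of (compileP Hp) _ _ _ _ Ht => //=.
  by rewrite /tm_dec unlift_none.
split=> [|i|i] /=.
- by rewrite -nth0.
- by rewrite nth_nil; case: i.
- rewrite nth_behead.
  by have -> : (-1 - 1 - i%:Z)%R = Negz i.+1 by lia.
Qed.

(** * A while language over three bit stacks and an input stream *)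

Inductive reg := RM | RA | RB.
Record store := St { sm : seq bool; sa : seq bool; sb : seq bool; sin : seq bool }.
Definition get r st := match r with RM => sm st | RA => sa st | RB => sb st end.
Definition set r v st :=
  match r with
  | RM => St v (sa st) (sb st) (sin st)
  | RA => St (sm st) v (sb st) (sin st)
  | RB => St (sm st) (sa st) v (sin st)
  end.

Inductive cmd :=
| Nop
| Push of reg & bool
| Pop of reg
| Read of reg
| Then of cmd & cmd
| CIf of pred (option bool) & reg & cmd & cmd
| CWhile of pred (option bool) & reg & cmd.

Inductive ex : cmd -> store -> store -> nat -> Prop :=
| ex_nop st : ex Nop st st 1
| ex_push r b st : ex (Push r b) st (set r (b :: get r st) st) 1
| ex_pop r st : ex (Pop r) st (set r (behead (get r st)) st) 1
| ex_read r b m sa sb i :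
    ex (Read r) (St m sa sb (b :: i)) (set r (b :: get r (St m sa sb i)) (St m sa sb i)) 1
| ex_then c d s s1 s2 n1 n2 : ex c s s1 n1 -> ex d s1 s2 n2 -> ex (Then c d) s s2 (n1 + n2)
| ex_ift (t : pred (option bool)) r c d s s1 n :
    t (ohead (get r s)) -> ex c s s1 n -> ex (CIf t r c d) s s1 n.+1
| ex_iff (t : pred (option bool)) r c d s s1 n :
    ~~ t (ohead (get r s)) -> ex d s s1 n -> ex (CIf t r c d) s s1 n.+1
| ex_whilef (t : pred (option bool)) r c s :
    ~~ t (ohead (get r s)) -> ex (CWhile t r c) s s 1
| ex_whilet (t : pred (option bool)) r c s s1 s2 n1 n2 :
    t (ohead (get r s)) -> ex c s s1 n1 -> ex (CWhile t r c) s1 s2 n2 ->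
    ex (CWhile t r c) s s2 (n1 + n2).+1.

Definition isNone (a : sym) := ~~ isSome a.
Definition stop : prog := Act (fun a => (a, MStay)).
Definition goL := Act (fun a => (a, MLeft)).
Definition goR := Act (fun a => (a, MRight)).
Definition wr (a : sym) := Act (fun _ => (a, MStay)).
Definition goLs j := iter j (PSeq goL) stop.
Definition goRs j := iter j (PSeq goR) stop.

(* Cell [i] of the stack of [r], counted from the bottom, is at position
   [4 * i + trk r]; the positions [4 * i] are blank except for a mark at [0];
   the unread input occupies the negative positions. *)
Definition trk r := match r with RM => 1 | RA => 2 | RB => 3 end.
(** From a cell of track [r] this drops to the blank positions [4 * i] and follows them down to the
    mark at 0. *)
Definition home r := PSeq (goRs (trk r)) (PWhile isNone (goRs 4)).
(** Ends on the top cell of the stack, or on the blank bottom cell if the stack is empty, so that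
    the scanned symbol is the [ohead] of the stack. *)
Definition peek r :=
  PSeq (goLs (trk r)) (PIf isSome (PSeq (PWhile isSome (goLs 4)) (goRs 4)) stop).
Definition push r b :=
  PSeq (goLs (trk r)) (PSeq (PWhile isSome (goLs 4)) (PSeq (wr (Some b)) (home r))).
Definition pop r := PSeq (peek r) (PSeq (wr None) (home r)).
(** Erasing a bit once it is read makes the first non-blank negative cell the next unread bit; the
    same scan jumps over the blank between input and coins. The bit itself is remembered in the
    control, by having one copy of this code for each value. *)
Definition fetched r b :=
  PSeq (Act (fun _ => (None, MLeft))) (PSeq (PWhile isNone goL) (push r b)).
Definition readbit r :=
  PSeq goR (PSeq (PWhile isNone goR)
    (PIf (fun a => a == Some true) (fetched r true) (fetched r false))).

Fixpoint tr (c : cmd) : prog :=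
  match c with
  | Nop => stop
  | Push r b => push r b
  | Pop r => pop r
  | Read r => readbit r
  | Then c d => PSeq (tr c) (tr d)
  | CIf t r c d =>
      PSeq (peek r) (PIf t (PSeq (home r) (tr c)) (PSeq (home r) (tr d)))
  | CWhile t r c =>
      PSeq (peek r) (PSeq (PWhile t (PSeq (home r) (PSeq (tr c) (peek r)))) (home r))
  end.

Lemma px_eq p s s' s'' n n' : px p s s' n -> s' = s'' -> n = n' -> px p s s'' n'.
Proof. by move=> H <- <-. Qed.

Lemma px_seq_inv p q s s' n : px (PSeq p q) s s' n ->
  exists s1 n1 n2, [/\ n = n1 + n2, px p s s1 n1 & px q s1 s' n2].
Proof. by move=> H; inversion H; subst; do 3 eexists; split; eauto. Qed.

Lemma px_seqA p q r s s' n : px (PSeq (PSeq p q) r) s s' n -> px (PSeq p (PSeq q r)) s s' n.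
Proof.
move=> /px_seq_inv [s1 [n1 [n2 [-> /px_seq_inv [s3 [n3 [n4 [-> H3 H4]]]] H2]]]].
by rewrite -addnA; apply: px_seq H3 (px_seq H4 H2).
Qed.

Lemma px_stop f x : px stop (f, x) (f, x) 1.
Proof. by apply: px_eq (px_act _ _ _) _ _ => //=; rewrite upd_same addr0. Qed.
Lemma px_goL f x : px goL (f, x) (f, (x + 1)%R) 1.
Proof. by apply: px_eq (px_act _ _ _) _ _ => //=; rewrite upd_same. Qed.
Lemma px_goR f x : px goR (f, x) (f, (x - 1)%R) 1.
Proof. by apply: px_eq (px_act _ _ _) _ _ => //=; rewrite upd_same. Qed.
Lemma px_wr a f x : px (wr a) (f, x) (upd f x a, x) 1.
Proof. by apply: px_eq (px_act _ _ _) _ _ => //=; rewrite addr0. Qed.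
Lemma px_goLs j f x : px (goLs j) (f, x) (f, (x + j%:Z)%R) j.+1.
Proof.
elim: j x => [|j IH] x; first by apply: px_eq (px_stop _ _) _ _; rewrite ?addr0.
by apply: px_eq (px_seq (px_goL _ _) (IH _)) _ _ => //; congr pair; lia.
Qed.
Lemma px_goRs j f x : px (goRs j) (f, x) (f, (x - j%:Z)%R) j.+1.
Proof.
elim: j x => [|j IH] x; first by apply: px_eq (px_stop _ _) _ _; rewrite ?subr0.
by apply: px_eq (px_seq (px_goR _ _) (IH _)) _ _ => //; congr pair; lia.
Qed.

Lemma px_scan (t : pred sym) p d c f :
  (forall x, px p (f, x) (f, (x + d)%R) c) ->
  forall h x, (forall i : nat, i < h -> t (f (x + d * i%:Z)%R)) -> ~~ t (f (x + d * h%:Z)%R) ->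
  px (PWhile t p) (f, x) (f, (x + d * h%:Z)%R) (h * c.+1 + 1).
Proof.
move=> Hp; elim=> [|h IH] x H1 H2.
  by apply: px_eq (px_whilef _ _) _ _; move: H2; rewrite mulr0 addr0.
apply: px_eq (px_whilet _ (Hp x) (IH _ _ _)) _ _.
- by have := H1 0 isT; rewrite mulr0 addr0.
- by move=> i Hi; have := H1 i.+1 Hi; congr (is_true (t (f _))); lia.
- by move: H2; congr (is_true (~~ t (f _))); lia.
- by congr pair; lia.
- lia.
Qed.

Definition cell r (i : nat) : int := Posz (4 * i + trk r).

Record rep0 (f : tape) (st : store) : Prop := Rep0 {
  rep_mark : forall i : nat, f (Posz (4 * i)) = if i == 0 then Some true else None;
  rep_stk : forall r i, f (cell r i) = nth None (map Some (rev (get r st))) i }.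

(** [N] is the length of the input area, [g] the number of its cells already erased next to the
    origin. The successor in the bound on [size rest] pays for the blank separating input and coins;
    the bound guarantees room for the output later. *)
Record rep (N : nat) (f : tape) (st : store) : Prop := Rep {
  rep_rep0 :> rep0 f st;
  rep_in : exists g rest,
    [/\ g + size rest = N, size rest <= (size (sin st)).+1, pmap id rest = sin st
      & forall i, f (Negz i) = nth None (nseq g None ++ rest) i] }.

Lemma px_home f st r i : rep0 f st -> px (home r) (f, cell r i) (f, 0%R) (i * 6 + trk r + 2).
Proof.
move=> [Hm _]; have H4 x : px (goRs 4) (f, x) (f, (x + (-4)%R)%R) 5 := px_goRs 4 f x.
apply: px_eq (px_seq (px_goRs _ _ _) (px_scan H4 (h := i) _ _)) _ _.
- move=> j Hj; have -> : (cell r i - (trk r)%:Z + -4 * j%:Z)%R = Posz (4 * (i - j)).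
    by rewrite /cell; lia.
  by rewrite Hm ifF //; apply/eqP; lia.
- have -> : (cell r i - (trk r)%:Z + -4 * i%:Z)%R = Posz (4 * 0) by rewrite /cell; lia.
  by rewrite Hm.
- by congr pair; rewrite /cell; lia.
- lia.
Qed.

Lemma px_enter f r : px (goLs (trk r)) (f, 0%R) (f, cell r 0) (trk r).+1.
Proof. by apply: px_eq (px_goLs _ _ _) _ _ => //; congr pair; rewrite /cell; lia. Qed.

Lemma px_top f st r : rep0 f st ->
  px (PWhile isSome (goLs 4)) (f, cell r 0) (f, cell r (size (get r st)))
     (size (get r st) * 6 + 1).
Proof.
move=> [_ Hs]; have H4 x : px (goLs 4) (f, x) (f, (x + 4)%R) 5 := px_goLs 4 f x.
apply: px_eq (px_scan H4 (h := size (get r st)) _ _) _ _ => //.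
- move=> j Hj; have -> : (cell r 0 + 4 * j%:Z)%R = cell r j by rewrite /cell; lia.
  by rewrite Hs (nth_map true) ?size_rev.
- have -> : (cell r 0 + 4 * (size (get r st))%:Z)%R = cell r (size (get r st)).
    by rewrite /cell; lia.
  by rewrite Hs nth_default // size_map size_rev.
- by congr pair; rewrite /cell; lia.
Qed.

Lemma px_peek f st r : rep0 f st -> exists2 n,
  px (peek r) (f, 0%R) (f, cell r (size (get r st)).-1) n & n <= size (get r st) * 6 + 13.
Proof.
move=> Hrep; have [_ Hs] := Hrep; case Er: (get r st) => [|b s] /=.
  exists ((trk r).+1 + 2); last by case: (r).
  apply: px_eq (px_seq (px_enter _ _) (px_iff _ _ (px_stop _ _))) _ _ => //.
  by rewrite Hs Er.
have := px_top r Hrep; rewrite Er /= => Ht.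
exists ((trk r).+1 + ((size s).+1 * 6 + 1 + 5).+1); last by case: (r) => /=; lia.
apply: px_eq (px_seq (px_enter _ _) (px_ift _ _ (px_seq Ht (px_goRs 4 _ _)))) _ _ => //.
  by rewrite Hs Er rev_cons map_rcons; case: (rev s).
by congr pair; rewrite /cell; lia.
Qed.

Lemma rep_top f st r : rep0 f st ->
  f (cell r (size (get r st)).-1) = ohead (get r st).
Proof.
move=> [_ Hs]; rewrite Hs; case: (get r st) => [|b s] //=.
by rewrite rev_cons map_rcons nth_rcons size_map size_rev ltnn eqxx.
Qed.

Lemma get_set r r' v st : get r' (set r v st) = if trk r' == trk r then v else get r' st.
Proof. by case: r; case: r'. Qed.
Lemma sin_set r v st : sin (set r v st) = sin st.
Proof. by case: r. Qed.

Lemma rep0_push f st r b : rep0 f st ->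
  rep0 (upd f (cell r (size (get r st))) (Some b)) (set r (b :: get r st) st).
Proof.
move=> [Hm Hs]; split=> [i|r' i].
- by rewrite /upd ifF ?Hm //; apply/eqP; rewrite /cell; case: (r) => /=; lia.
- rewrite /upd get_set; case: eqP => [|Hne].
    rewrite /cell => Ec; have [-> ->] : i = size (get r st) /\ trk r' = trk r.
      by move: Ec; case: (r); case: (r') => /=; lia.
    by rewrite eqxx rev_cons map_rcons nth_rcons size_map size_rev ltnn eqxx.
  rewrite Hs; case: eqP => // Et.
  have -> : r' = r by case: (r) Et; case: (r').
  have Hi' : i <> size (get r st) by move=> Ei; apply: Hne; rewrite /cell Et Ei.
  rewrite rev_cons map_rcons nth_rcons size_map size_rev.
  case: ltngtP => // Hlt.
  by rewrite nth_default // size_map size_rev ltnW.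
Qed.

Lemma rep0_pop f st r : rep0 f st ->
  rep0 (upd f (cell r (size (get r st)).-1) None) (set r (behead (get r st)) st).
Proof.
move=> [Hm Hs]; split=> [i|r' i].
- by rewrite /upd ifF ?Hm //; apply/eqP; rewrite /cell; case: (r) => /=; lia.
- rewrite /upd get_set; case: eqP => [|Hne].
    rewrite /cell => Ec; have [-> ->] : i = (size (get r st)).-1 /\ trk r' = trk r.
      by move: Ec; case: (r); case: (r') => /=; lia.
    by rewrite eqxx nth_default // size_map size_rev size_behead.
  rewrite Hs; case: eqP => // Et.
  have -> : r' = r by case: (r) Et; case: (r').
  have Hi' : i <> (size (get r st)).-1 by move=> Ei; apply: Hne; rewrite /cell Et Ei.
  case: (get r st) Hi' => [|b s] //= Hi'.
  rewrite rev_cons map_rcons nth_rcons size_map size_rev.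
  by case: ltngtP => // Hlt; rewrite nth_default // size_map size_rev ltnW.
Qed.

Lemma rep_upd N f st r h a v : rep N f st -> rep0 (upd f (cell r h) a) (set r v st) ->
  rep N (upd f (cell r h) a) (set r v st).
Proof.
move=> [_ [g [rest [H1 H2 H3 H4]]]] H0; split=> //.
by exists g, rest; split; rewrite ?sin_set.
Qed.

Lemma px_push N f st r b : rep N f st -> exists n, exists2 f',
  px (push r b) (f, 0%R) (f', 0%R) n &
  rep N f' (set r (b :: get r st) st) /\ n <= size (get r st) * 12 + 20.
Proof.
move=> Hrep; have Hrep' := rep_upd Hrep (rep0_push r b Hrep).
do 2 eexists.
  exact: px_seq (px_enter _ _) (px_seq (px_top r Hrep) (px_seq (px_wr _ _ _) (px_home r _ Hrep'))).
by split=> //; case: (r) => /=; lia.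
Qed.

Lemma px_pop N f st r : rep N f st -> exists n, exists2 f',
  px (pop r) (f, 0%R) (f', 0%R) n &
  rep N f' (set r (behead (get r st)) st) /\ n <= size (get r st) * 12 + 25.
Proof.
move=> Hrep; have Hrep' := rep_upd Hrep (rep0_pop r Hrep); have [n Hp Hn] := px_peek r Hrep.
do 2 eexists.
  exact: px_seq Hp (px_seq (px_wr _ _ _) (px_home r _ Hrep')).
by split=> //; move: Hn; case: (r) => /=; lia.
Qed.

Lemma pmap_id_cons (l : seq sym) b i : pmap id l = b :: i ->
  exists a l', l = nseq a None ++ Some b :: l' /\ pmap id l' = i.
Proof.
elim: l => [|[c|] l IH] //=; first by case=> <- <-; exists 0, l.
by move=> /IH [a [l' [-> <-]]]; exists a.+1, l'.
Qed.

Lemma px_read N f st r b i : sin st = b :: i -> rep N f st -> exists n, exists2 f',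
  px (readbit r) (f, 0%R) (f', 0%R) n &
  rep N f' (let st' := St (sm st) (sa st) (sb st) i in set r (b :: get r st) st') /\
  n <= size (get r st) * 12 + (N - size i) * 4 + 40.
Proof.
move=> Ei [[Hm Hs] [g [rest []]]]; rewrite Ei => HN Hrest Hp Hf.
have [a [rest' [Er Hp']]] := pmap_id_cons Hp.
have Hsz : size i <= size rest' by rewrite -Hp' size_pmap count_size.
pose h := g + a.
have Hf1 j : f (Negz j) = nth None (nseq h None ++ Some b :: rest') j.
  by rewrite Hf Er catA /h nseqD.
pose f1 := upd f (Negz h) None; pose st' := St (sm st) (sa st) (sb st) i.
have Hrep1 : rep N f1 st'.
  split; first split=> [j|r' j].
  - by rewrite /f1 /upd; case: eqP => [|_]; [lia|exact: Hm].
  - by rewrite /f1 /upd; case: eqP => [|_]; [rewrite /cell; lia|rewrite Hs; case: (r')].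
  - exists h.+1, rest'; split=> //.
    + by rewrite -HN Er /h size_cat size_nseq /=; lia.
    + by move: Hrest; rewrite Er size_cat size_nseq /=; lia.
    + move=> j; rewrite /f1 /upd; case: eqP => [[->]|Hne].
        by rewrite nth_cat size_nseq ltnSn nth_nseq ltnSn.
      rewrite Hf1 !nth_cat !size_nseq !nth_nseq.
      case: (ltngtP j h) => [Hj|Hj|Ej]; last by rewrite Ej in Hne.
        by rewrite ltnS ltnW.
      by rewrite ltnS leqNgt Hj /= -[j - h]prednK ?subn_gt0 //= subnS.
have Hgo : px (PSeq goR (PWhile isNone goR)) (f, 0%R) (f, Negz h) (h * 2 + 2).
  have H1 x : px goR (f, x) (f, (x + -1)%R) 1 := px_goR f x.
  apply: px_eq (px_seq (H1 _) (px_scan H1 (h := h) _ _)) _ _.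
  - move=> j Hj; have -> : (0 + -1 + -1 * j%:Z)%R = Negz j by lia.
    by rewrite Hf1 nth_cat size_nseq Hj nth_nseq Hj.
  - have -> : (0 + -1 + -1 * h%:Z)%R = Negz h by lia.
    by rewrite Hf1 nth_cat size_nseq ltnn subnn.
  - by congr pair; lia.
  - lia.
have [n [f' Hpush [Hrep' Hn]]] := px_push r b Hrep1.
have Hback : px (PSeq (Act (fun=> (None, MLeft))) (PWhile isNone goL))
    (f, Negz h) (f1, 0%R) (h * 2 + 2).
  have H1 x : px goL (f1, x) (f1, (x + 1)%R) 1 := px_goL f1 x.
  have Ha : px (Act (fun=> (None, MLeft))) (f, Negz h) (f1, (Negz h + 1)%R) 1.
    by apply: px_eq (px_act _ _ _) _ _.
  apply: px_eq (px_seq Ha (px_scan H1 (h := h) _ _)) _ _.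
  - move=> j Hj; have -> : (Negz h + 1 + 1 * j%:Z)%R = Negz (h - j.+1) by lia.
    rewrite /f1 /upd ifF; last by apply/eqP; lia.
    by rewrite Hf1 nth_cat size_nseq nth_nseq; case: ltnP => //; lia.
  - have -> : (Negz h + 1 + 1 * h%:Z)%R = Posz (4 * 0) by lia.
    by rewrite /f1 /upd /= Hm.
  - by congr pair; lia.
  - lia.
have Hfetch : px (fetched r b) (f, Negz h) (f', 0%R) (h * 2 + 2 + n).
  exact: px_seqA (px_seq Hback Hpush).
have Hif : px (PIf (fun a => a == Some true) (fetched r true) (fetched r false))
    (f, Negz h) (f', 0%R) (h * 2 + 2 + n).+1.
  have E : f (Negz h) = Some b by rewrite Hf1 nth_cat size_nseq ltnn subnn.
  by case: (b) E Hfetch => E Hfetch; [apply: px_ift|apply: px_iff]; rewrite ?E.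
exists (h * 2 + 2 + (h * 2 + 2 + n).+1), f'.
  exact: px_seqA (px_seq Hgo Hif).
split; first by case: (r) Hrep'.
have -> : size (get r st) = size (get r st') by case: (r).
have : h + size rest' + 1 = N by rewrite -HN Er /h size_cat size_nseq /=; lia.
lia.
Qed.

(** Stack heights plus erased input cells: up to constants, the distance the head walks for one
    command. *)
Definition load N st := size (sm st) + size (sa st) + size (sb st) + (N - size (sin st)).

Lemma ex_load N c st st' n : ex c st st' n -> load N st' <= load N st + 2 * n.
Proof.
elim=> {c st st' n}; rewrite /load //=; try lia.
- by move=> r b st; case: r => /=; lia.
- by move=> r st; case: r => /=; rewrite size_behead; lia.
- by move=> r b m sa sb i; case: r => /=; lia.
Qed.

Lemma get_load N r st : size (get r st) <= load N st.
Proof. by rewrite /load; case: r => /=; lia. Qed.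

Lemma ex_gt0 c st st' n : ex c st st' n -> 0 < n.
Proof. by elim=> // *; rewrite addn_gt0; apply/orP; left. Qed.

(** One command costs time linear in the load, and the load grows by at most 2 per command; this
    accounts for the quadratic overhead. *)
Lemma trP N c st st' n : ex c st st' n -> forall f, rep N f st -> exists t, exists2 f',
  px (tr c) (f, 0%R) (f', 0%R) t & rep N f' st' /\ t <= 60 * n * (load N st + 2 * n + 1).
Proof.
elim=> {c st st' n}.
- move=> st f Hr; exists 1, f; first exact: px_stop.
  by split=> //; lia.
- move=> r b st f Hr; have [t [f' H1 [H2 H3]]] := px_push r b Hr.
  by exists t, f'; [|split=> //; have := get_load N r st; lia].
- move=> r st f Hr; have [t [f' H1 [H2 H3]]] := px_pop r Hr.
  by exists t, f'; [|split=> //; have := get_load N r st; lia].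
- move=> r b m sa sb i f Hr; have [//|t [f' H1 [H2 H3]]] := px_read (i := i) (b := b) r _ Hr.
  exists t, f' => //; split; first by case: (r) H2.
  have := get_load N r (St m sa sb (b :: i)); rewrite /load /= in H3 *; lia.
- move=> c d s s1 s2 n1 n2 E1 IH1 E2 IH2 f Hr.
  have [t1 [f1 H1 [R1 T1]]] := IH1 _ Hr; have [t2 [f2 H2 [R2 T2]]] := IH2 _ R1.
  exists (t1 + t2), f2; first exact: px_seq H1 H2.
  by split=> //; have := ex_load N E1; nia.
- move=> t r c d s s1 n Ht E IH f Hr; have [n0 Hp Hn0] := px_peek r Hr.
  have [t1 [f1 H1 [R1 T1]]] := IH _ Hr.
  do 2 eexists; last split; [|eassumption|].
    apply: px_seq Hp (px_ift _ _ (px_seq (px_home r _ Hr) H1)).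
    by rewrite (rep_top r Hr).
  by have := get_load N r s; have : trk r <= 3 by [case: (r)]; nia.
- move=> t r c d s s1 n Ht E IH f Hr; have [n0 Hp Hn0] := px_peek r Hr.
  have [t1 [f1 H1 [R1 T1]]] := IH _ Hr.
  do 2 eexists; last split; [|eassumption|].
    apply: px_seq Hp (px_iff _ _ (px_seq (px_home r _ Hr) H1)).
    by rewrite (rep_top r Hr).
  by have := get_load N r s; have : trk r <= 3 by [case: (r)]; nia.
- move=> t r c s Ht f Hr; have [n0 Hp Hn0] := px_peek r Hr.
  do 2 eexists; last split; [|eassumption|].
    apply: px_seq Hp (px_seq (px_whilef _ _) (px_home r _ Hr)).
    by rewrite (rep_top r Hr).
  by have := get_load N r s; have : trk r <= 3 by [case: (r)]; nia.
- move=> t r c s s1 s2 n1 n2 Ht E1 IH1 E2 IH2 f Hr; have [n0 Hp Hn0] := px_peek r Hr.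
  have [t1 [f1 H1 [R1 T1]]] := IH1 _ Hr; have [t2 [f2 H2 [R2 T2]]] := IH2 _ R1.
  have [s3 [m1 [m2 [E3 P1 P2]]]] := px_seq_inv H2.
  have [s4 [m3 [m4 [E4 P3 P4]]]] := px_seq_inv P2.
  do 2 eexists; last split; [|exact: R2|].
    apply: px_seq Hp (px_seq (px_whilet _ (px_seq (px_home r _ Hr) (px_seq H1 P1)) P3) P4).
    by rewrite (rep_top r Hr).
  have := get_load N r s; have := ex_load N E1; have : trk r <= 3 by [case: (r)].
  have := ex_gt0 E1; have := ex_gt0 E2; nia.
Qed.

(** Takes the top of the main stack and appends it to the output, which starts at position -2 and
    grows to the right. *)
Definition emit b :=
  PSeq (wr None) (PSeq (home RM) (PSeq (goRs 2) (PSeq (PWhile isSome goR)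
    (PSeq (wr (Some b)) (PSeq (PWhile isSome goL) (PSeq goL (peek RM))))))).
(* The cell at [-1] stays blank, so that the way back to the mark can be found. *)
Definition flush :=
  PSeq (peek RM) (PSeq (PWhile isSome (PIf (fun a => a == Some true) (emit true) (emit false)))
    (PSeq (home RM) (goRs 2))).

(** Since [nth] defaults to a blank, the last clause also reserves blank cells behind the output
    [o]: one for each bit still on the stack and one to terminate the output. *)
Definition wrep (f : tape) (m o : seq bool) :=
  [/\ rep0 f (St m [::] [::] [::]), f (Negz 0) = None
    & forall i, i <= size o + size m -> f (Negz i.+1) = nth None (map Some o) i].

Lemma px_emit f b m o : wrep f (b :: m) o ->
  exists n, exists2 f', px (emit b) (f, cell RM (size m)) (f', cell RM (size m).-1) n &
    wrep f' m (rcons o b) /\ n <= 20 * (size m + size o + 3).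
Proof.
case=> Hr0 Hgap Ho; have /= Hr1 := rep0_pop RM Hr0.
set f1 := upd f _ _ in Hr1.
have Hf1 j : f1 (Negz j) = f (Negz j) by [].
have HR x : px goR (f1, x) (f1, (x + -1)%R) 1 := px_goR f1 x.
have P1 : px (PSeq (goRs 2) (PWhile isSome goR)) (f1, 0%R) (f1, Negz (size o).+1)
    (size o * 2 + 4).
  apply: px_eq (px_seq (px_goRs 2 _ _) (px_scan HR (h := size o) _ _)) _ _.
  - move=> j Hj; have -> : (0 - 2 + -1 * j%:Z)%R = Negz j.+1 by lia.
    by rewrite Hf1 Ho ?(nth_map true) //; lia.
  - have -> : (0 - 2 + -1 * (size o)%:Z)%R = Negz (size o).+1 by lia.
    by rewrite Hf1 Ho ?leq_addr // nth_default ?size_map.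
  - by congr pair; lia.
  - lia.
pose f2 := upd f1 (Negz (size o).+1) (Some b).
have Hf2 j : f2 (Negz j) = if j == (size o).+1 then Some b else f (Negz j).
  by rewrite -Hf1 /f2 /upd.
have Hr2 : rep0 f2 (St m [::] [::] [::]).
  by case: Hr1 => Hm Hs; split=> [i|r i]; rewrite /f2 /upd; [exact: Hm|exact: Hs].
have HL x : px goL (f2, x) (f2, (x + 1)%R) 1 := px_goL f2 x.
have P2 : px (PSeq (PWhile isSome goL) goL) (f2, Negz (size o).+1) (f2, 0%R)
    ((size o).+1 * 2 + 2).
  apply: px_eq (px_seq (px_scan HL (h := (size o).+1) _ _) (px_goL _ _)) _ _.
  - move=> j Hj; have -> : (Negz (size o).+1 + 1 * j%:Z)%R = Negz (size o - j).+1 by lia.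
    rewrite Hf2; case: eqP => // Hne; rewrite Ho; last by lia.
    by rewrite (nth_map true) //; lia.
  - have -> : (Negz (size o).+1 + 1 * (size o).+1%:Z)%R = Negz 0 by lia.
    by rewrite Hf2 Hgap.
  - by congr pair; lia.
  - lia.
have [n Hp Hn] := px_peek RM Hr2.
do 2 eexists; last split.
- apply: px_seq (px_wr _ _ _) (px_seq (px_home RM _ Hr1) _).
  exact: px_seqA (px_seq P1 (px_seq (px_wr _ _ _) (px_seqA (px_seq P2 Hp)))).
- split=> // i.
  rewrite size_rcons Hf2 eqSS map_rcons nth_rcons size_map => Hi.
  case: ltngtP => Hlt //; (rewrite Ho; last by move=> /=; lia) => //.
  by rewrite nth_default // size_map ltnW.
- move: Hn => /=; lia.
Qed.

Lemma px_emits m : forall f o, wrep f m o ->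
  exists n, exists2 f',
    px (PWhile isSome (PIf (fun a => a == Some true) (emit true) (emit false)))
       (f, cell RM (size m).-1) (f', cell RM 0) n &
    wrep f' [::] (o ++ m) /\ n <= size m * (20 * (size m + size o + 4)) + 1.
Proof.
elim: m => [|b m IH] f o Hw; have [Hr _ _] := Hw; have /= Ht := rep_top RM Hr.
  by exists 1, f; [apply: px_whilef; rewrite Ht|rewrite cats0].
have [n1 [f1 P1 [W1 N1]]] := px_emit Hw; have [n2 [f2 P2 [W2 N2]]] := IH _ _ W1.
do 2 eexists; last split.
- apply: px_whilet P2; first by rewrite Ht.
  have HP : px (PIf (fun a => a == Some true) (emit true) (emit false))
      (f, cell RM (size m)) (f1, cell RM (size m).-1) n1.+1.
    by case: (b) Ht P1 => Ht P1; [apply: px_ift|apply: px_iff]; rewrite ?Ht.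
  exact: HP.
- by rewrite -cat_rcons.
- move: N2; rewrite size_rcons /=; nia.
Qed.

Lemma px_flush f m : wrep f m [::] ->
  exists n, exists2 f', px flush (f, 0%R) (f', Negz 1) n &
    wrep f' [::] m /\ n <= 30 * (size m + 2) ^ 2 + 30.
Proof.
move=> Hw; have [Hr _ _] := Hw; have [n1 P1 N1] := px_peek RM Hr.
have [n2 [f2 P2 [W2 N2]]] := px_emits Hw; have [Hr2 _ _] := W2.
do 2 eexists; last split; [|exact: W2|].
  apply: px_seq P1 (px_seq P2 (px_eq (px_seq (px_home RM _ Hr2) (px_goRs 2 _ _)) _ erefl)).
  by congr pair.
by move: N1 N2 => /=; rewrite -mulnn; nia.
Qed.

Lemma take_bitsP (s : seq sym) y :
  (forall i, i <= size y -> nth None s i = nth None (map Some y) i) -> take_bits s = y.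
Proof.
elim: y s => [|b y IH] [|a s] H //; try by have := H 0 isT.
  by have /= -> := H 0 isT.
by have /= -> := H 0 isT; rewrite IH // => i Hi; exact: (H i.+1).
Qed.

Definition machine (c : cmd) : TM :=
  tm_of (compile (PSeq goL (PSeq (wr (Some true)) (PSeq (tr c) flush)))).

(** The inequality says that enough input has been erased to hold the gap at -1, the output and a
    final blank: of the [|x| + |r| + 1] cells of the input area at most [|i| + 1] are still in
    use. *)
Lemma machineP c x r y i n :
  ex c (St [::] [::] [::] (x ++ r)) (St y [::] [::] i) n ->
  size y + size i + 2 <= size x + size r ->
  forall t, 1000 * (n + 1) ^ 2 <= t -> runs_to (machine c) t x r y.
Proof.
move=> He Hi t Ht.
pose l := map Some x ++ None :: map Some r.
pose f0 : tape := fun z => if z is Negz i then nth None l i else None.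
pose N := size l; pose f1 := upd f0 0%R (Some true).
have EN : N = size x + size r + 1 by rewrite /N size_cat /= !size_map; lia.
have Hr1 : rep N f1 (St [::] [::] [::] (x ++ r)).
  split; first split=> [j|r' j].
  - by rewrite /f1 /upd; case: eqP => H1; case: eqP => // H2; exfalso; lia.
  - by rewrite /f1 /upd; case: r' => /=; rewrite nth_nil; case: eqP => // H1; exfalso; move: H1; rewrite /cell /=; lia.
  exists 0, l; split=> //; first by rewrite -/N EN /= size_cat; lia.
  by rewrite pmap_cat /= !map_pK.
have [n1 [f2 P1 [R2 N1]]] := trP He Hr1.
have HL := ex_load N He.
have Ey : size y <= 1 + 2 * n.
  move: HL; rewrite /load /= EN size_cat; lia.
have Hw : wrep f2 y [::].
  have [R0 [g [rest [H1 H2 H3 H4]]]] := R2; move: H2 => /= H2.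
  have Hg : size y + 2 <= g by lia.
  split.
  - by case: R0 => Hm Hs; split=> // r' j; rewrite Hs; case: r'.
  - by rewrite H4 nth_cat size_nseq nth_nseq; case: ltnP => //; lia.
  - by move=> j /= Hj; rewrite H4 nth_cat size_nseq nth_nseq nth_nil; case: ltnP => //; lia.
have [n2 [f3 P2 [[_ _ W3] N2]]] := px_flush Hw.
have HP : px (PSeq goL (PSeq (wr (Some true)) (PSeq (tr c) flush)))
    (f0, (-1)%R) (f3, Negz 1) (1 + (1 + (n1 + n2))).
  have P0 : px goL (f0, (-1)%R) (f0, 0%R) 1 := px_goL f0 (-1)%R.
  exact: px_seq P0 (px_seq (px_wr _ _ _) (px_seq P1 P2)).
have [|c' Hc' [Ch Cl Cr]] := tm_of_prog HP (t := t).
  apply: leq_trans Ht; move: N1; rewrite /load /= EN size_cat.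
  have -> : size x + size r + 1 - (size x + size r) = 1 by lia.
  by move: N2; rewrite -!mulnn; nia.
exists c' => //; apply: take_bitsP => -[|j] Hj /=.
  by rewrite Ch /= W3.
rewrite Cr /=; have -> : (Negz 1 - 1 - j%:Z)%R = Negz j.+2 by lia.
by rewrite W3 //= ?addn0.
Qed.

(** * Polynomial-time functions between encoded types *)

Lemma ex_eq c s s' s'' n n' : ex c s s' n -> s' = s'' -> n = n' -> ex c s s'' n'.
Proof. by move=> H <- <-. Qed.

Lemma ex_popM b m a b' i : ex (Pop RM) (St (b :: m) a b' i) (St m a b' i) 1.
Proof. by apply: ex_eq (ex_pop _ _) _ _. Qed.

Definition is1 (o : option bool) := o == Some true.

(* Values are copied bit by bit from a source (the main stack or the input)
   onto an auxiliary stack, where they arrive reversed. *)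
Definition tgt (t : bool) := if t then RA else RB.
Definition mk (src t : bool) (x y : seq bool) (z : seq bool * seq bool) : store :=
  match src, t with
  | true, true => St x y z.1 z.2
  | true, false => St x z.1 y z.2
  | false, true => St z.1 y z.2 x
  | false, false => St z.1 z.2 y x
  end.
Definition fetch (src t : bool) : cmd :=
  if src then CIf is1 RM (Then (Pop RM) (Push (tgt t) true)) (Then (Pop RM) (Push (tgt t) false))
  else Read (tgt t).

Lemma fetchP src t b s y z : exists2 n,
  ex (fetch src t) (mk src t (b :: s) y z) (mk src t s (b :: y) z) n & n <= 3.
Proof.
case: src => /=; last first.
  by exists 1 => //; case: t z => -[z1 z2]; apply: ex_eq (ex_read _ _ _ _ _ _) _ _.
exists 3 => //; case: b.
  by apply: ex_ift; [case: t|apply: ex_eq (ex_then (ex_pop _ _) (ex_push _ _ _)) _ _; case: t].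
by apply: ex_iff; [case: t|apply: ex_eq (ex_then (ex_pop _ _) (ex_push _ _ _)) _ _; case: t].
Qed.

Lemma get_mk src t x y z : get (tgt t) (mk src t x y z) = y.
Proof. by case: src; case: t. Qed.

(** Encodings are self-delimiting, and [mvc] exploits this: it moves exactly one encoded value off
    its source, whatever lies behind it, in time linear in that value. *)
Class encodable (T : Type) := Enc {
  encode : T -> seq bool;
  mvc : bool -> bool -> cmd;
  mvk : nat;
  mvP : forall src t a s y z, exists2 n,
    ex (mvc src t) (mk src t (encode a ++ s) y z) (mk src t s (rev (encode a) ++ y) z) n
    & n <= mvk * (size (encode a)).+1 }.

#[global] Instance enc_unit : encodable unit.
Proof.
refine (@Enc _ (fun _ => [::]) (fun _ _ => Nop) 1 _).
by move=> src t [] s y z; exists 1 => //; exact: ex_nop.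
Defined.

#[global] Instance enc_bool : encodable bool.
Proof.
refine (@Enc _ (fun b => [:: b]) fetch 3 _).
move=> src t a s y z; have [n H Hn] := fetchP src t a s y z.
by exists n => //=; apply: leq_trans Hn _.
Defined.

#[global] Instance enc_prod A B {EA : encodable A} {EB : encodable B} : encodable (A * B).
Proof.
refine (@Enc _ (fun p => encode p.1 ++ encode p.2)
  (fun src t => Then (mvc (T := A) src t) (mvc (T := B) src t)) (mvk (T := A) + mvk (T := B)) _).
move=> src t [a b] s y z /=.
have [n1 H1 N1] := mvP src t a (encode b ++ s) y z.
have [n2 H2 N2] := mvP src t b s (rev (encode a) ++ y) z.
exists (n1 + n2); first by rewrite -catA; apply: ex_eq (ex_then H1 H2) _ _; rewrite // rev_cat catA.
by rewrite size_cat; nia.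
Defined.

Lemma encL_cons T (f : T -> seq bool) x xs : encL f (x :: xs) = true :: f x ++ encL f xs.
Proof. by rewrite /encL /= catA. Qed.

(** The tag bit moved last lies on top of the target stack, and the loop tests it there. *)
#[global] Instance enc_seq A {EA : encodable A} : encodable (seq A).
Proof.
refine (@Enc _ (encL encode)
  (fun src t => Then (fetch src t) (CWhile is1 (tgt t) (Then (mvc (T := A) src t) (fetch src t))))
  (mvk (T := A) + 8) _).
move=> src t l s y z.
have [n Hx Hn] : exists2 n, ex (CWhile is1 (tgt t) (Then (mvc (T := A) src t) (fetch src t)))
    (mk src t (behead (encL encode l) ++ s) (head false (encL encode l) :: y) z)
    (mk src t s (rev (encL encode l) ++ y) z) n & n <= (mvk (T := A) + 5) * size (encL encode l); last first.
  have [b [w Ew]] : exists b w, encL encode l = b :: w.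
    by case: (l) => [|a l']; rewrite ?encL_cons; do 2 eexists.
  have [n1 H1 N1] := fetchP src t b (w ++ s) y z.
  exists (n1 + n); last by move: N1 Hn; rewrite Ew /=; nia.
  by move: Hx; rewrite Ew => Hx; exact: ex_then H1 Hx.
elim: l y => [|a l IH] y.
  by exists 1 => //=; [apply: ex_whilef; rewrite get_mk|rewrite muln1; lia].
rewrite encL_cons /= -catA.
have [n1 H1 N1] := mvP src t a (encL encode l ++ s) (true :: y) z.
have [b [w Ew]] : exists b w, encL encode l = b :: w.
  by case: (l) => [|a' l']; rewrite ?encL_cons; do 2 eexists.
have [n2 H2 N2] := fetchP src t b (w ++ s) (rev (encode a) ++ true :: y) z.
have [n3 H3 N3] := IH (rev (encode a) ++ true :: y).
exists ((n1 + n2) + n3).+1.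
  apply: ex_whilet; [by rewrite get_mk| |].
    by apply: ex_then H1 _; rewrite Ew; exact: H2.
  rewrite Ew /= in H3 *.
  by apply: ex_eq H3 _ _ => //; rewrite -Ew rev_cons rev_cat cat_rcons catA.
by rewrite size_cat; nia.
Defined.

(** Unary, so that a number can drive a loop and polynomial time bounds its value. Numbers written
    in binary are handled as bit lists instead. *)
#[global] Instance enc_nat : encodable nat.
Proof.
refine (@Enc _ (fun n => encode (nseq n tt)) (mvc (T := seq unit)) (mvk (T := seq unit)) _).
by move=> src t a s y z; exact: mvP.
Defined.

Lemma encode_S n : encode n.+1 = true :: encode n.
Proof. by []. Qed.
Lemma encode_cons A {EA : encodable A} (a : A) l : encode (a :: l) = true :: encode a ++ encode l.
Proof. exact: encL_cons. Qed.
Lemma size_encode_nat n : size (encode n) = n.+1.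
Proof. by elim: n => // n IH; rewrite encode_S /= IH. Qed.
Lemma size_encode_pair A B {EA : encodable A} {EB : encodable B} (a : A) (b : B) :
  size (encode (a, b)) = size (encode a) + size (encode b).
Proof. exact: size_cat. Qed.
Lemma size_encode_cons A {EA : encodable A} (a : A) l :
  size (encode (a :: l)) = (size (encode a) + size (encode l)).+1.
Proof. by rewrite encode_cons /= size_cat. Qed.
Lemma size_encode_seq A {EA : encodable A} (l : seq A) :
  size (encode l) = (\sum_(a <- l) (size (encode a)).+1).+1.
Proof.
by elim: l => [|a l IH]; rewrite ?big_nil // size_encode_cons IH big_cons addSn addnS.
Qed.
Lemma size_encode_mem (A : eqType) {EA : encodable A} (a : A) l :
  a \in l -> size (encode a) < size (encode l).
Proof.
elim: l => // b l IH; rewrite inE size_encode_cons ltnS => /orP [/eqP ->|/IH Hl].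
  exact: leq_addr.
by rewrite ltnW // ltn_addl.
Qed.
Lemma size_encode_size A {EA : encodable A} (l : seq A) : size l < size (encode l).
Proof. by elim: l => // a l IH; rewrite size_encode_cons /= ltnS ltn_addl. Qed.

(** A base of at least 2 lets the exponent absorb all constants, so a polynomial bound is a single
    number [k]. *)
Definition PB A {EA : encodable A} (g : A -> nat) :=
  exists k, forall a, g a <= (size (encode a) + 2) ^ k.

Section PolyBounds.
Context A {EA : encodable A}.
Implicit Types f g : A -> nat.

Lemma leq_pw x k l : k <= l -> (x + 2) ^ k <= (x + 2) ^ l.
Proof. by move=> Hkl; rewrite leq_pexp2l // addn2. Qed.
Lemma leq_pwl x y k : x <= y -> (x + 2) ^ k <= (y + 2) ^ k.
Proof. by case: k => // k Hxy; rewrite leq_exp2r // leq_add2r. Qed.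

Lemma PB_le f g : PB g -> (forall a, f a <= g a) -> PB f.
Proof. by case=> k Hk Hfg; exists k => a; exact: leq_trans (Hfg a) (Hk a). Qed.
Lemma PB_const c : PB (fun _ : A => c).
Proof.
exists c => a; have H2 : c <= 2 ^ c by apply/ltnW; apply: ltn_expl.
apply: (leq_trans H2).
by have := @leq_pwl 0 (size (encode a)) c (leq0n _); rewrite add0n.
Qed.
Lemma PB_size : PB (fun a : A => size (encode a)).
Proof. by exists 1 => a; rewrite expn1 leq_addr. Qed.
Lemma PB_add f g : PB f -> PB g -> PB (fun a => f a + g a).
Proof.
move=> [k Hk] [l Hl]; exists (k + l).+1 => a.
apply: (@leq_trans (2 * (size (encode a) + 2) ^ (k + l))); last first.
  by rewrite expnS leq_mul2r; apply/orP; right; lia.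
rewrite mul2n -addnn leq_add //.
  exact: leq_trans (Hk a) (leq_pw _ (leq_addr _ _)).
exact: leq_trans (Hl a) (leq_pw _ (leq_addl _ _)).
Qed.
Lemma PB_mul f g : PB f -> PB g -> PB (fun a => f a * g a).
Proof. by move=> [k Hk] [l Hl]; exists (k + l) => a; rewrite expnD leq_mul. Qed.
Lemma PB_exp f c : PB f -> PB (fun a => f a ^ c).
Proof.
move=> [k Hk]; exists (k * c) => a; rewrite expnM.
by case: c => // c; rewrite leq_exp2r.
Qed.
Lemma PB_S f : PB f -> PB (fun a => (f a).+1).
Proof. by move=> Hf; apply: PB_le (PB_add Hf (PB_const 1)) _ => a; rewrite addn1. Qed.
End PolyBounds.

Ltac pb := repeat first
  [ assumption | simple apply PB_const | simple apply PB_size | simple apply PB_add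
  | simple apply PB_mul | simple apply PB_S | simple apply PB_exp ].

(** The rest [s] of the main stack and the unread input [i] are framed, and the auxiliary stacks are
    empty before and after. Commands of this kind compose, and can keep other values below their
    argument. *)
Record FP A B {EA : encodable A} {EB : encodable B} (f : A -> B) : Prop := MkFP {
  FPE : exists c k, forall a s i, exists2 n,
    ex c (St (encode a ++ s) [::] [::] i) (St (encode (f a) ++ s) [::] [::] i) n
    & n <= (size (encode a) + 2) ^ k }.

Lemma FP_size A B {EA : encodable A} {EB : encodable B} (f : A -> B) :
  FP f -> PB (fun a => size (encode (f a))).
Proof.
case=> -[c [k Hc]].
have Ht : PB (fun a : A => size (encode a) + 2 * (size (encode a) + 2) ^ k) by pb.
apply: (PB_le Ht) => a.
have [n He Hn] := Hc a [::] [::].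
by have := ex_load 0 He; rewrite /load /= !cats0 !addn0; move: Hn; lia.
Qed.

Lemma FP_intro A B {EA : encodable A} {EB : encodable B} (f : A -> B) c (t : A -> nat) : PB t ->
  (forall a s i, exists2 n,
    ex c (St (encode a ++ s) [::] [::] i) (St (encode (f a) ++ s) [::] [::] i) n & n <= t a) ->
  FP f.
Proof.
move=> [k Hk] Hc; split; exists c, k => a s i; have [n He Hn] := Hc a s i.
by exists n => //; exact: leq_trans Hn (Hk a).
Qed.

Lemma FP_ext A B {EA : encodable A} {EB : encodable B} (f g : A -> B) : f =1 g -> FP f -> FP g.
Proof. by move=> Efg [[c [k Hc]]]; split; exists c, k => a s i; rewrite -Efg. Qed.

Lemma FP_cast A B {EA : encodable A} {EB : encodable B} (f : A -> B) :
  (forall a, encode (f a) = encode a) -> FP f.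
Proof.
move=> Ef; have Ht : PB (fun _ : A => 1) by pb.
apply: (FP_intro (c := Nop) Ht) => a s i.
by exists 1 => //; rewrite Ef; exact: ex_nop.
Qed.

Lemma FP_id A {EA : encodable A} : FP (fun x : A => x).
Proof. exact: FP_cast. Qed.

Lemma FP_comp A B C {EA : encodable A} {EB : encodable B} {EC : encodable C} (g : B -> C) (f : A -> B) :
  FP g -> FP f -> FP (fun x => g (f x)).
Proof.
move=> [[d [l Hd]]] Hf; have [[c [k Hc]]] := Hf.
have Hs := FP_size Hf.
have Ht : PB (fun a : A => (size (encode a) + 2) ^ k + (size (encode (f a)) + 2) ^ l) by pb.
apply: (FP_intro (c := Then c d) Ht).
move=> a s i; have [n1 H1 N1] := Hc a s i; have [n2 H2 N2] := Hd (f a) s i.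
by exists (n1 + n2); [exact: ex_then H1 H2|exact: leq_add].
Qed.

(** * Moving, copying, swapping and discarding encoded values *)

Definition loop r (body : bool -> cmd) : cmd := CWhile isSome r (CIf is1 r (body true) (body false)).

Lemma loopP r body (S : seq bool -> seq bool -> store) k :
  (forall v w, get r (S v w) = v) ->
  (forall b v w, ex (body b) (S (b :: v) w) (S v (b :: w)) k) ->
  forall v, ex (loop r body) (S v [::]) (S [::] (rev v)) (size v * (k + 2) + 1).
Proof.
move=> Hg Hb v.
have H w : ex (loop r body) (S v w) (S [::] (rev v ++ w)) (size v * (k + 2) + 1); last first.
  by have := H [::]; rewrite cats0.
elim: v w => [|b v IH] w.
  by apply: ex_whilef; rewrite Hg.
apply: ex_eq (ex_whilet _ _ (IH (b :: w))) _ _; first by rewrite Hg.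
- have Hx := Hb b v w.
  by case: b Hx => Hx; [apply: ex_ift Hx|apply: ex_iff Hx]; rewrite Hg.
- by rewrite rev_cons cat_rcons.
- by rewrite /=; lia.
Qed.

Definition back t := loop (tgt t) (fun b => Then (Pop (tgt t)) (Push RM b)).
Definition dupA := loop RA (fun b => Then (Pop RA) (Then (Push RM b) (Push RB b))).
Definition moveBA := loop RB (fun b => Then (Pop RB) (Push RA b)).
Definition clear t := loop (tgt t) (fun b => Pop (tgt t)).

Lemma backP t m v z :
  ex (back t) (mk true t m v z) (mk true t (rev v ++ m) [::] z) (size v * 4 + 1).
Proof.
apply: (@loopP _ _ (fun v w => mk true t (w ++ m) v z) 2 _ _ v) => [v' w|b v' w].
  by case: t.
by apply: ex_eq (ex_then (ex_pop _ _) (ex_push _ _ _)) _ _; case: t.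
Qed.
Lemma dupAP m v b i :
  ex dupA (St m v b i) (St (rev v ++ m) [::] (rev v ++ b) i) (size v * 5 + 1).
Proof.
apply: (@loopP _ _ (fun v w => St (w ++ m) v (w ++ b) i) 3 _ _ v) => // c v' w.
by apply: ex_eq (ex_then (ex_pop _ _) (ex_then (ex_push _ _ _) (ex_push _ _ _))) _ _.
Qed.
Lemma moveBAP m a v i : ex moveBA (St m a v i) (St m (rev v ++ a) [::] i) (size v * 4 + 1).
Proof.
apply: (@loopP _ _ (fun v w => St m (w ++ a) v i) 2 _ _ v) => // c v' w.
by apply: ex_eq (ex_then (ex_pop _ _) (ex_push _ _ _)) _ _.
Qed.
Lemma clearP t m v z : ex (clear t) (mk true t m v z) (mk true t m [::] z) (size v * 3 + 1).
Proof.
apply: (@loopP _ _ (fun v w => mk true t m v z) 1 _ _ v) => [v' w|b v' w].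
  by case: t.
by apply: ex_eq (ex_pop _ _) _ _; case: t.
Qed.

Definition dropc A {EA : encodable A} := Then (mvc (T := A) true true) (clear true).
Lemma dropP A {EA : encodable A} (a : A) s i : exists2 n,
  ex (dropc (A := A)) (St (encode a ++ s) [::] [::] i) (St s [::] [::] i) n
  & n <= (mvk (T := A) + 4) * (size (encode a)).+1.
Proof.
have [n1 H1 N1] := mvP true true a s [::] ([::], i).
set v := encode a in H1 N1 *; rewrite cats0 in H1.
have H2 := clearP true s (rev v) ([::], i).
exists (n1 + (size (rev v) * 3 + 1)); first exact: ex_then H1 H2.
by rewrite size_rev; lia.
Qed.

Definition dupc A {EA : encodable A} :=
  Then (mvc (T := A) true true) (Then dupA (Then moveBA (back true))).
Lemma dupP A {EA : encodable A} (a : A) s i : exists2 n,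
  ex (dupc (A := A)) (St (encode a ++ s) [::] [::] i) (St (encode a ++ encode a ++ s) [::] [::] i) n
  & n <= (mvk (T := A) + 13) * (size (encode a)).+1.
Proof.
have [n1 H1 N1] := mvP true true a s [::] ([::], i).
set v := encode a in H1 N1 *; rewrite cats0 in H1.
have H2 := dupAP s (rev v) [::] i; rewrite revK cats0 in H2.
have H3 := moveBAP (v ++ s) [::] v i; rewrite cats0 in H3.
have H4 := backP true (v ++ s) (rev v) ([::], i); rewrite revK in H4.
exists (n1 + ((size (rev v) * 5 + 1) + ((size v * 4 + 1) + (size (rev v) * 4 + 1)))).
  exact: ex_then H1 (ex_then H2 (ex_then H3 H4)).
by rewrite size_rev; lia.
Qed.

Definition swapc A B {EA : encodable A} {EB : encodable B} :=
  Then (mvc (T := A) true true) (Then (mvc (T := B) true false) (Then (back true) (back false))).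
Lemma swapP A B {EA : encodable A} {EB : encodable B} (a : A) (b : B) s i : exists2 n,
  ex (swapc (A := A) (B := B)) (St (encode a ++ encode b ++ s) [::] [::] i)
     (St (encode b ++ encode a ++ s) [::] [::] i) n
  & n <= (mvk (T := A) + mvk (T := B) + 10) * (size (encode a) + size (encode b)).+1.
Proof.
have [n1 H1 N1] := mvP true true a (encode b ++ s) [::] ([::], i).
have [n2 H2 N2] := mvP true false b s [::] (rev (encode a), i).
set v := encode a in H1 N1 H2 *; set w := encode b in H1 H2 N2 *.
rewrite cats0 in H1; rewrite cats0 in H2.
have H3 := backP true s (rev v) (rev w, i); rewrite revK in H3.
have H4 := backP false (v ++ s) (rev w) ([::], i); rewrite revK in H4.
exists (n1 + (n2 + ((size (rev v) * 4 + 1) + (size (rev w) * 4 + 1)))).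
  exact: ex_then H1 (ex_then H2 (ex_then H3 H4)).
by rewrite !size_rev; nia.
Qed.

Lemma FP_snd_ A B {EA : encodable A} {EB : encodable B} : FP (fun p : A * B => p.2).
Proof.
have Ht : PB (fun p : A * B => (mvk (T := A) + 4) * (size (encode p)).+1) by pb.
apply: (FP_intro (c := dropc (A := A)) Ht).
move=> [a b] s i /=; rewrite -catA; have [n He Hn] := dropP a (encode b ++ s) i.
exists n => //; apply: leq_trans Hn _; rewrite leq_mul2l size_cat; apply/orP; right; lia.
Qed.

Lemma FP_swap_ A B {EA : encodable A} {EB : encodable B} : FP (fun p : A * B => (p.2, p.1)).
Proof.
have Ht : PB (fun p : A * B => (mvk (T := A) + mvk (T := B) + 10) * (size (encode p)).+1) by pb.
apply: (FP_intro (c := swapc (A := A) (B := B)) Ht).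
move=> [a b] s i /=; rewrite -!catA size_cat; exact: swapP.
Qed.

Lemma FP_snd A B C {EA : encodable A} {EB : encodable B} {EC : encodable C} (f : A -> B * C) :
  FP f -> FP (fun x => (f x).2).
Proof. by move=> Hf; exact: (FP_comp (@FP_snd_ B C _ _) Hf). Qed.
Lemma FP_fst A B C {EA : encodable A} {EB : encodable B} {EC : encodable C} (f : A -> B * C) :
  FP f -> FP (fun x => (f x).1).
Proof.
move=> Hf; exact: (FP_comp (@FP_snd_ C B _ _) (FP_comp (@FP_swap_ B C _ _) Hf)).
Qed.

Lemma FP_pair A B C {EA : encodable A} {EB : encodable B} {EC : encodable C} (f : A -> B) (g : A -> C) :
  FP f -> FP g -> FP (fun x => (f x, g x)).
Proof.
move=> [[c [k Hc]]] Hg; have [[d [l Hd]]] := Hg.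
have Hs := FP_size Hg.
have Ht : PB (fun a : A => (mvk (T := A) + 13) * (size (encode a)).+1 +
  ((size (encode a) + 2) ^ l +
   ((mvk (T := C) + mvk (T := A) + 10) * (size (encode (g a)) + size (encode a)).+1 +
    (size (encode a) + 2) ^ k))) by pb.
apply: (FP_intro (c := Then (dupc (A := A)) (Then d (Then (swapc (A := C) (B := A)) c))) Ht).
move=> a s i.
have [n1 H1 N1] := dupP a s i; have [n2 H2 N2] := Hd a (encode a ++ s) i.
have [n3 H3 N3] := swapP (g a) a s i; have [n4 H4 N4] := Hc a (encode (g a) ++ s) i.
exists (n1 + (n2 + (n3 + n4))); last by rewrite !leq_add.
apply: ex_eq (ex_then H1 (ex_then H2 (ex_then H3 H4))) _ _ => //=.
by rewrite catA.
Qed.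

Lemma FP_const A B {EA : encodable A} {EB : encodable B} (b : B) : FP (fun _ : A => b).
Proof.
pose pushl := fix pushl v := if v is b :: v' then Then (pushl v') (Push RM b) else Nop.
have Hp v m i : ex (pushl v) (St m [::] [::] i) (St (v ++ m) [::] [::] i) (size v).+1.
  elim: v => [|c v IH] /=; first exact: ex_nop.
  by apply: ex_eq (ex_then IH (ex_push _ _ _)) _ _ => //=; rewrite addn1.
have Ht : PB (fun a : A => (mvk (T := A) + 4) * (size (encode a)).+1 + (size (encode b)).+1) by pb.
apply: (FP_intro (c := Then (dropc (A := A)) (pushl (encode b))) Ht).
move=> a s i; have [n1 H1 N1] := dropP a s i.
by exists (n1 + (size (encode b)).+1); [exact: ex_then H1 (Hp _ _ _)|rewrite leq_add].
Qed.

Lemma FP_if A B {EA : encodable A} {EB : encodable B} (b : A -> bool) (f g : A -> B) :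
  FP b -> FP f -> FP g -> FP (fun x => if b x then f x else g x).
Proof.
move=> Hb [[c [k Hc]]] [[d [l Hd]]].
have H' : FP (fun p : bool * A => if p.1 then f p.2 else g p.2).
  have Ht : PB (fun a : bool * A =>
    2 + ((size (encode a) + 2) ^ k + (size (encode a) + 2) ^ l)) by pb.
  apply: (FP_intro (c := CIf is1 RM (Then (Pop RM) c) (Then (Pop RM) d)) Ht).
  move=> [[] a] s i /=.
    have [n H1 N1] := Hc a s i; exists (1 + n).+1.
      by apply: ex_ift => //; exact: ex_then (ex_popM _ _ _ _ _) H1.
    move: N1; set v := size (encode a) => N1; have := leq_pwl k (leqnSn v); lia.
  have [n H1 N1] := Hd a s i; exists (1 + n).+1.
    by apply: ex_iff => //; exact: ex_then (ex_popM _ _ _ _ _) H1.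
  move: N1; set v := size (encode a) => N1; have := leq_pwl l (leqnSn v); lia.
exact: (FP_comp H' (FP_pair Hb (FP_id (A := A)))).
Qed.

Lemma FP_cons A B {EA : encodable A} {EB : encodable B} (f : A -> B) (g : A -> seq B) :
  FP f -> FP g -> FP (fun x => f x :: g x).
Proof.
move=> Hf Hg; have H' : FP (fun p : B * seq B => p.1 :: p.2).
  have Ht : PB (fun _ : B * seq B => 1) by pb.
  apply: (FP_intro (c := Push RM true) Ht) => -[b l] s i.
  by exists 1 => //; rewrite encode_cons; exact: ex_push.
exact: (FP_comp H' (FP_pair Hf Hg)).
Qed.

Lemma FP_S A {EA : encodable A} (f : A -> nat) : FP f -> FP (fun x => (f x).+1).
Proof.
move=> Hf; have H' : FP S.
  have Ht : PB (fun _ : nat => 1) by pb.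
  apply: (FP_intro (c := Push RM true) Ht) => b s i.
  by exists 1 => //; exact: ex_push.
exact: (FP_comp H' Hf).
Qed.

(** Popping the leading tag turns the encoding of [(b :: r, a)] into that of [(b, (r, a))], so the
    case distinction only inspects one bit. *)
Lemma FP_case A B C {EA : encodable A} {EB : encodable B} {EC : encodable C} (l : A -> seq B)
    (f : A -> C) (g : A -> B -> seq B -> C) :
  FP l -> FP f -> FP (fun p : B * (seq B * A) => g p.2.2 p.1 p.2.1) ->
  FP (fun x => if l x is b :: r then g x b r else f x).
Proof.
move=> Hb [[d [m Hd]]] [[c [k Hc]]].
have H' : FP (fun p : seq B * A => if p.1 is b :: r then g p.2 b r else f p.2).
  have Ht : PB (fun a : seq B * A =>
    2 + ((size (encode a) + 2) ^ k + (size (encode a) + 2) ^ m)) by pb.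
  apply: (FP_intro (c := CIf is1 RM (Then (Pop RM) c) (Then (Pop RM) d)) Ht).
  move=> [[|b r] a] s i.
    have [n H1 N1] := Hd a s i; exists (1 + n).+1.
      by apply: ex_iff => //; exact: ex_then (ex_popM _ _ _ _ _) H1.
    move: N1; rewrite size_encode_pair; set v := size (encode a) => N1.
    set w := size _; have := leq_pwl m (leq_addl w v); lia.
  have [n H1 N1] := Hc (b, (r, a)) s i; exists (1 + n).+1.
    have -> : encode (b :: r, a) ++ s = true :: encode (b, (r, a)) ++ s.
      by rewrite /= /encL /= -!catA.
    by apply: ex_ift => //; exact: ex_then (ex_popM _ _ _ _ _) H1.
  move: N1; rewrite !size_encode_pair size_encode_cons.
  move: (size (encode a)) (size (encode b)) (size (encode r)) => x y z N1.
  have -> : (y + z).+1 + x = (y + (z + x)).+1 by lia.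
  by have := leq_pwl k (leqnSn (y + (z + x))); lia.
exact: (FP_comp H' (FP_pair Hb (FP_id (A := A)))).
Qed.

Lemma FP_natcase A C {EA : encodable A} {EC : encodable C} (n : A -> nat)
    (f : A -> C) (g : A -> nat -> C) :
  FP n -> FP f -> FP (fun p : nat * A => g p.2 p.1) ->
  FP (fun x => if n x is m.+1 then g x m else f x).
Proof.
move=> Hn Hf Hg.
have H1 : FP (fun x => nseq (n x) tt).
  by apply: (FP_comp (f := n) (g := fun n => nseq n tt)) => //; apply: FP_cast.
have H2 : FP (fun l : seq unit => size l).
  by apply: FP_cast => l; congr (encL encode _); elim: l => //= -[] l ->.
apply: FP_ext (FP_case (g := fun x _ r => g x (size r)) H1 Hf _) => [x|].
  by case: (n x) => //= m; rewrite size_nseq.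
apply: (FP_comp Hg (FP_pair _ _)); last exact: FP_snd (FP_snd (FP_id (A := _))).
exact: (FP_comp H2 (FP_fst (FP_snd (FP_id (A := _))))).
Qed.

(** Between two rounds the accumulator is parked, reversed, on stack A, which brings the tag of the
    remaining list to the top of the main stack. *)
Definition foldc A S {EA : encodable A} {ES : encodable S} (c : cmd) : cmd :=
  Then (mvc (T := S) true true)
    (Then (CWhile is1 RM (Then (Pop RM) (Then (back true) (Then c (mvc (T := S) true true)))))
      (Then (Pop RM) (back true))).

Lemma foldP A S {EA : encodable A} {ES : encodable S} (f : S * A -> S) c k :
  (forall a s i, exists2 n,
    ex c (St (encode a ++ s) [::] [::] i) (St (encode (f a) ++ s) [::] [::] i) n
    & n <= (size (encode a) + 2) ^ k) ->
  forall G s i l st,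
  (forall j, size (encode (foldl (fun s a => f (s, a)) st (take j l))) <= G) ->
  exists2 n,
    ex (foldc (A := A) (S := S) c) (St (encode st ++ encode l ++ s) [::] [::] i)
       (St (encode (foldl (fun s a => f (s, a)) st l) ++ s) [::] [::] i) n
    & n <= (mvk (T := S) + 10) * G.+1 * (size l).+2 + (G + size (encode l) + 2) ^ k * size l.
Proof.
move=> Hc G s i l st HG.
have [n1 H1 N1] := mvP true true st (encode l ++ s) [::] ([::], i).
rewrite cats0 in H1.
have [n2 H2 N2] : exists2 n,
    ex (CWhile is1 RM (Then (Pop RM) (Then (back true) (Then c (mvc (T := S) true true)))))
      (St (encode l ++ s) (rev (encode st)) [::] i)
      (St (false :: s) (rev (encode (foldl (fun s a => f (s, a)) st l))) [::] i) n
    & n <= (mvk (T := S) + 5) * G.+1 * (size l) + (G + size (encode l) + 2) ^ k * size l + 1; last first.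
  set v := encode (foldl _ _ _) in H2 *.
  have H3 := backP true s (rev v) ([::], i).
  rewrite revK in H3.
  eexists; first exact: ex_then H1 (ex_then H2 (ex_then (ex_popM _ _ _ _ _) H3)).
  rewrite size_rev; have := HG (size l); have := HG 0; rewrite take_size take0 /= -/v => G0 G1.
  have : n1 <= mvk (T := S) * G.+1 by apply: leq_trans N1 _; rewrite leq_mul2l ltnS G0 orbT.
  move=> N0; move: N0 N2 G0 G1.
  by move: (mvk) (size v) (size l) (size (encode st)) ((_ + 2) ^ k) => K sv L ss P; nia.
elim: l st {n1 H1 N1} HG => [|a l IH] st HG.
  by exists 1; [apply: ex_whilef|rewrite !muln0].
have [|n2 H2 N2] := IH (f (st, a)); first by move=> j; exact: (HG j.+1).
have H3 : ex (back true) (mk true true (encode a ++ encode l ++ s) (rev (encode st)) ([::], i))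
    (mk true true (encode st ++ encode a ++ encode l ++ s) [::] ([::], i))
    (size (encode st) * 4 + 1).
  by apply: ex_eq (backP _ _ _ _) _ _; rewrite ?revK ?size_rev.
have [n4 H4 N4] := Hc (st, a) (encode l ++ s) i.
have E4 : encode (st, a) = encode st ++ encode a by [].
rewrite E4 -catA in H4.
have [n5 H5 N5] := mvP true true (f (st, a)) (encode l ++ s) [::] ([::], i).
rewrite cats0 in H5.
rewrite {1}encode_cons [(_ :: _) ++ s]/= -catA.
eexists.
  apply: ex_whilet H2; first by [].
  exact: ex_then (ex_popM _ _ _ _ _) (ex_then H3 (ex_then H4 H5)).
have := HG 1; have := HG 0; rewrite take0 /= take0 => G0 G1.
have L4 : n4 <= (G + size (encode (a :: l)) + 2) ^ k.
  apply: leq_trans N4 (leq_pwl _ _).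
  by rewrite size_encode_pair size_encode_cons leq_add // ltnW // ltnS leq_addr.
have L2 : (G + size (encode l) + 2) ^ k <= (G + size (encode (a :: l)) + 2) ^ k.
  apply: leq_pwl; rewrite size_encode_cons; lia.
have L5 : n5 <= mvk (T := S) * G.+1.
  by apply: leq_trans N5 _; rewrite leq_mul2l ltnS G1 orbT.
move: N2 L2 L4; move: ((_ + 2) ^ k) ((_ + size (encode (a :: l)) + 2) ^ k) => u v N2 L2 L4.
nia.
Qed.

(** Bounded recursion in the style of Cobham: iterating a polynomial-time step may square the size
    each time, hence the bound [g] on every intermediate accumulator. The environment [x] travels
    along as part of the accumulator. *)
Lemma FP_foldl X A S {EX : encodable X} {EA : encodable A} {ES : encodable S} (f : X -> S -> A -> S)
    (st : X -> S) (l : X -> seq A) (g : X -> nat) :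
  FP (fun p : X * S * A => f p.1.1 p.1.2 p.2) -> FP st -> FP l -> PB g ->
  (forall x j, size (encode (foldl (f x) (st x) (take j (l x)))) <= g x) ->
  FP (fun x => foldl (f x) (st x) (l x)).
Proof.
move=> Hf Hst Hl Hg HG.
pose F (p : X * S * A) : X * S := (p.1.1, f p.1.1 p.1.2 p.2).
have EF x s r : foldl (fun s a => F (s, a)) (x, s) r = (x, foldl (f x) s r).
  by elim: r s => //= a r IH s; rewrite IH.
have [[c [k Hc]]] : FP F by apply: FP_pair Hf; exact: FP_fst (FP_fst (FP_id (A := _))).
have Hst' := FP_pair (FP_id (A := X)) Hst.
have [[d [m Hd]]] := FP_pair Hst' Hl.
have H' : FP (fun x => (x, foldl (f x) (st x) (l x))); last by exact: FP_snd H'.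
pose t x := size (@encode X EX x) + g x.
have Hls := FP_size Hl.
have Ht : PB (fun x => (size (encode x) + 2) ^ m +
  ((mvk (T := (X * S)%type) + 10) * (t x).+1 * (size (encode (l x))).+2 +
   (t x + size (encode (l x)) + 2) ^ k * size (encode (l x)))) by rewrite /t; pb.
apply: (FP_intro (c := Then d (foldc (A := A) (S := (X * S)%type) c)) Ht).
move=> x s i; have [n1 H1 N1] := Hd x s i.
have [|n2 H2 N2] := foldP Hc (G := t x) s i (l := l x) (st := (x, st x)).
  by move=> j; rewrite EF size_encode_pair leq_add2l.
rewrite EF in H2; exists (n1 + n2).
  by apply: ex_then (ex_eq H1 _ erefl) H2; rewrite /= -!catA.
rewrite leq_add //; apply: leq_trans N2 _; have Hs : size (l x) < size (encode (l x)) by exact: size_encode_size.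
by rewrite leq_add // leq_mul2l; apply/orP; right; lia.
Qed.

Arguments encode : simpl never.

Lemma size_encode_bool (b : bool) : size (encode b) = 1.
Proof. by []. Qed.

Lemma FP_app2 X {EX : encodable X} A B C {EA : encodable A} {EB : encodable B} {EC : encodable C} (F : A -> B -> C)
    (f : X -> A) (g : X -> B) :
  FP (fun p : A * B => F p.1 p.2) -> FP f -> FP g -> FP (fun x => F (f x) (g x)).
Proof. by move=> HF Hf Hg; exact: (FP_comp HF (FP_pair Hf Hg)). Qed.

Lemma FP_andb X {EX : encodable X} (b c : X -> bool) : FP b -> FP c -> FP (fun x => b x && c x).
Proof. by move=> Hb Hc; apply: FP_if Hb Hc _; exact: FP_const. Qed.
Lemma FP_orb X {EX : encodable X} (b c : X -> bool) : FP b -> FP c -> FP (fun x => b x || c x).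
Proof. by move=> Hb Hc; apply: FP_if Hb _ Hc; exact: FP_const. Qed.
Lemma FP_negb X {EX : encodable X} (b : X -> bool) : FP b -> FP (fun x => ~~ b x).
Proof. by move=> Hb; apply: FP_if Hb _ _; exact: FP_const. Qed.
Lemma FP_eqb X {EX : encodable X} (b c : X -> bool) : FP b -> FP c -> FP (fun x => b x == c x).
Proof.
move=> Hb Hc; apply: FP_ext (FP_if Hb Hc (FP_negb Hc)) => x.
by case: (b x); case: (c x).
Qed.

Lemma size_encode_take A {EA : encodable A} (l : seq A) j :
  size (encode (take j l)) <= size (encode l).
Proof.
elim: l j => [|a r IH] [|j].
- exact: leqnn.
- exact: leqnn.
- by rewrite take0 size_encode_cons.
- by rewrite [take _ _]/= !size_encode_cons ltnS leq_add2l IH.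
Qed.

(** If each step adds at most [h x] to the size, the bound needed by [FP_foldl] comes for free. *)
Lemma FP_fold_grow X {EX : encodable X} A S {EA : encodable A} {ES : encodable S} (f : X -> S -> A -> S)
    (st : X -> S) (l : X -> seq A) (h : X -> nat) :
  FP (fun p : X * S * A => f p.1.1 p.1.2 p.2) -> FP st -> FP l -> PB h ->
  (forall x s a, size (encode a) <= size (encode (l x)) ->
     size (encode (f x s a)) <= size (encode s) + h x) ->
  FP (fun x => foldl (f x) (st x) (l x)).
Proof.
move=> Hf Hst Hl Hh Hgrow.
apply: (FP_foldl (g := fun x => size (encode (st x)) + size (encode (l x)) * h x) Hf Hst Hl).
  exact: PB_add (FP_size Hst) (PB_mul (FP_size Hl) Hh).
move=> x j.
have Hall : forall r, size (encode r) <= size (encode (l x)) -> forall s,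
    size (encode (foldl (f x) s r)) <= size (encode s) + size r * h x.
  elim=> [|a r IH] Hr s /=; first by rewrite addn0.
  rewrite size_encode_cons in Hr.
  apply: leq_trans (IH _ _) _; first by apply: leq_trans Hr; rewrite ltnW // ltnS leq_addl.
  rewrite mulSn addnA leq_add2r Hgrow //.
  by apply: leq_trans Hr; rewrite ltnW // ltnS leq_addr.
have Htake : size (encode (take j (l x))) <= size (encode (l x)) by exact: size_encode_take.
apply: leq_trans (Hall _ Htake _) _; rewrite leq_add2l leq_mul2r.
by rewrite (leq_trans (ltnW (size_encode_size _)) Htake) orbT.
Qed.

Lemma FP_iter X {EX : encodable X} S {ES : encodable S} (f : X -> S -> S) (st : X -> S) (n : X -> nat) (g : X -> nat) :
  FP (fun p : X * S => f p.1 p.2) -> FP st -> FP n -> PB g ->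
  (forall x j, j <= n x -> size (encode (iter j (f x) (st x))) <= g x) ->
  FP (fun x => iter (n x) (f x) (st x)).
Proof.
move=> Hf Hst Hn Hg HG.
have H1 : FP (fun x => nseq (n x) tt).
  by apply: (FP_comp (f := n) (g := fun n => nseq n tt)) => //; apply: FP_cast.
have Ei x m s : foldl (fun s (_ : unit) => f x s) s (nseq m tt) = iter m (f x) s.
  by elim: m s => //= m IH s; rewrite IH -iterSr.
apply: (FP_ext (f := fun x => foldl (fun s (_ : unit) => f x s) (st x) (nseq (n x) tt))).
  by move=> x; rewrite Ei.
apply: FP_foldl Hst H1 Hg _; first exact: FP_comp Hf (FP_fst (FP_id (A := _))).
move=> x j; have -> : take j (nseq (n x) tt) = nseq (minn j (n x)) tt.
  by elim: (n x) j => [|m IH] [|j] //=; rewrite minnSS /= IH.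
by rewrite Ei HG // geq_minr.
Qed.

Lemma FP_addn X {EX : encodable X} (m n : X -> nat) : FP m -> FP n -> FP (fun x => m x + n x).
Proof.
move=> Hm Hn; apply: (FP_ext (f := fun x => iter (n x) S (m x))).
  by move=> x; elim: (n x) => [|k IH] /=; rewrite ?addn0 // IH addnS.
apply: FP_iter (PB_add (FP_size Hm) (FP_size Hn)) _ => //.
  exact: FP_S (FP_snd (FP_id (A := _))).
move=> x j Hj; rewrite !size_encode_nat.
have -> : iter j S (m x) = m x + j by elim: (j) => [|k /= ->]; rewrite ?addn0 ?addnS.
lia.
Qed.

Lemma FP_predn X {EX : encodable X} (n : X -> nat) : FP n -> FP (fun x => (n x).-1).
Proof.
move=> Hn; apply: FP_ext (FP_natcase (f := fun _ => 0) (g := fun _ m => m) Hn _ _).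
- by move=> x; case: (n x).
- exact: FP_const.
- exact: FP_fst (FP_id (A := _)).
Qed.

Lemma FP_subn X {EX : encodable X} (m n : X -> nat) : FP m -> FP n -> FP (fun x => m x - n x).
Proof.
move=> Hm Hn; apply: (FP_ext (f := fun x => iter (n x) predn (m x))).
  by move=> x; elim: (n x) => [|k IH] /=; rewrite ?subn0 // IH subnS.
apply: FP_iter (FP_size Hm) _ => //; first exact: FP_predn (FP_snd (FP_id (A := _))).
move=> x j _; rewrite !size_encode_nat ltnS.
by elim: j => //= j IH; apply: leq_trans (leq_pred _) IH.
Qed.

Ltac fp_hyp :=
  match goal with
  | H : FP ?f |- FP ?f => exact H
  | H : FP ?m |- FP (fun x => ?m (@?g x)) => apply (FP_comp (g := m) (f := g) H)
  | H : FP (fun p => ?F p.1 p.2) |- FP (fun x => ?F (@?g x) (@?h x)) =>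
      apply (FP_app2 (F := F) (f := g) (g := h) H)
  end.
Ltac fp0 :=
  first [ refine (FP_const _) | refine (FP_id (A := _)) | fp_hyp
  | lazymatch goal with |- FP (fun x => (@?f x, @?g x)) => refine (FP_pair (f := f) (g := g) _ _) end
  | refine (FP_fst _) | refine (FP_snd _) | refine (FP_cons _ _) | refine (FP_S _)
  | refine (FP_negb _) | refine (FP_andb _ _) | refine (FP_orb _ _) | refine (FP_eqb _ _)
  | refine (FP_if _ _ _)
  | refine (FP_addn _ _) | refine (FP_subn _ _) | refine (FP_predn _) ].
Ltac fp := repeat (fp0; cbv beta).

Lemma FP_muln X {EX : encodable X} (m n : X -> nat) : FP m -> FP n -> FP (fun x => m x * n x).
Proof.
move=> Hm Hn; apply: (FP_ext (f := fun x => iter (n x) (addn (m x)) 0)).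
  by move=> x; rewrite mulnC; elim: (n x) => //= k ->; rewrite mulSn.
have Hs := FP_size Hm; have Hs' := FP_size Hn.
have Hg : PB (fun x => size (encode (m x)) * size (encode (n x))) by pb.
apply: (FP_iter (f := fun x => addn (m x)) (st := fun _ => 0)) Hg _; [fp|fp|fp|].
move=> x j Hj; rewrite !size_encode_nat.
have -> : iter j (addn (m x)) 0 = j * m x by elim: (j) => //= k ->; rewrite mulSn.
nia.
Qed.

Lemma FP_expn X {EX : encodable X} (m : X -> nat) c : FP m -> FP (fun x => m x ^ c).
Proof.
move=> Hm; elim: c => [|c IH]; first exact: FP_const.
by apply: FP_ext (FP_muln Hm IH) => x; rewrite expnS.
Qed.

Lemma FP_eq0 X {EX : encodable X} (n : X -> nat) : FP n -> FP (fun x => n x == 0).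
Proof.
move=> Hn; apply: FP_ext (FP_natcase (f := fun _ => true) (g := fun _ _ => false) Hn _ _);
  [by move=> x; case: (n x)|fp|fp].
Qed.

Lemma FP_leq X {EX : encodable X} (m n : X -> nat) : FP m -> FP n -> FP (fun x => m x <= n x).
Proof. by move=> Hm Hn; apply: FP_eq0; fp. Qed.

Lemma FP_eqn X {EX : encodable X} (m n : X -> nat) : FP m -> FP n -> FP (fun x => m x == n x).
Proof.
move=> Hm Hn; apply: (FP_ext (f := fun x => (m x <= n x) && (n x <= m x))).
  by move=> x; rewrite eqn_leq.
by apply: FP_andb; apply: FP_leq.
Qed.

Lemma FP_double X {EX : encodable X} (n : X -> nat) : FP n -> FP (fun x => (n x).*2).
Proof. by move=> Hn; apply: (FP_ext (f := fun x => n x + n x)); [move=> x; rewrite addnn|fp]. Qed.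

Lemma FP_rev X {EX : encodable X} A {EA : encodable A} (l : X -> seq A) :
  FP l -> FP (fun x => rev (l x)).
Proof.
move=> Hl; apply: (FP_ext (f := fun x => foldl (fun s a => a :: s) [::] (l x))).
  move=> x; rewrite /rev; elim: (l x) [::] => //= a r IH s; exact: IH.
have Hs := FP_size Hl; have Hg : PB (fun x => (size (encode (l x))).+1) by pb.
apply: (FP_fold_grow (f := fun _ s a => a :: s) (st := fun _ => [::])) Hg _; [fp|fp|fp|].
by move=> x s a Ha; rewrite size_encode_cons addnC addnS ltnS leq_add2l.
Qed.

Lemma FP_map X {EX : encodable X} A B {EA : encodable A} {EB : encodable B}
    (f : X -> A -> B) (l : X -> seq A) :
  FP (fun p : X * A => f p.1 p.2) -> FP l -> FP (fun x => map (f x) (l x)).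
Proof.
move=> Hf Hl.
apply: (FP_ext (f := fun x => rev (foldl (fun s a => f x a :: s) [::] (l x)))).
  move=> x; rewrite -[RHS]revK; congr rev; rewrite /rev.
  by elim: (l x) [::] => //= a r IH s; exact: IH.
apply: FP_rev; have [k Hk] := FP_size Hf; have Hs := FP_size Hl.
have Hg : PB (fun x => (size (encode x) + size (encode (l x)) + 2) ^ k + 1) by pb.
apply: (FP_fold_grow (f := fun x s a => f x a :: s) (st := fun _ => [::])) Hg _; [fp|fp|fp|].
move=> x s a Ha; rewrite size_encode_cons addn1 addnS ltnS addnC leq_add2l.
apply: leq_trans (Hk (x, a)) _; apply: leq_pwl.
by rewrite size_encode_pair leq_add2l.
Qed.

Lemma FP_cat X {EX : encodable X} A {EA : encodable A} (l r : X -> seq A) :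
  FP l -> FP r -> FP (fun x => l x ++ r x).
Proof.
move=> Hl Hr; apply: (FP_ext (f := fun x => foldl (fun s a => a :: s) (r x) (rev (l x)))).
  move=> x; rewrite -{2}(revK (l x)); elim: (rev (l x)) (r x) => //= a s IH t.
  by rewrite IH rev_cons cat_rcons.
have Hs := FP_size (FP_rev Hl); have Hg : PB (fun x => (size (encode (rev (l x)))).+1) by pb.
have Hl' := FP_rev Hl.
apply: (FP_fold_grow (f := fun _ s a => a :: s) (st := r) (l := fun x => rev (l x))) Hg _;
  [fp|fp|fp|].
by move=> x s a Ha; rewrite size_encode_cons addnC addnS ltnS leq_add2l.
Qed.

Lemma size_encode_cat A {EA : encodable A} (l r : seq A) :
  (size (encode (l ++ r))).+1 = size (encode l) + size (encode r).
Proof. by rewrite !size_encode_seq big_cat /= addSn addnS. Qed.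

Lemma FP_flatten X {EX : encodable X} A {EA : encodable A} (l : X -> seq (seq A)) :
  FP l -> FP (fun x => flatten (l x)).
Proof.
move=> Hl; apply: (FP_ext (f := fun x => foldl (fun s a => s ++ a) [::] (l x))).
  move=> x; rewrite -[RHS]cat0s; elim: (l x) [::] => [|a r IH] s /=; first by rewrite cats0.
  by rewrite IH catA.
have Hs := FP_size Hl.
apply: (FP_fold_grow (f := fun _ s a => s ++ a) (st := fun _ => [::])) Hs _.
- by apply: FP_cat; fp.
- fp.
- fp.
move=> x s a Ha; apply: leq_trans (leqnSn _) _.
by rewrite size_encode_cat leq_add2l.
Qed.

Lemma FP_filter X {EX : encodable X} A {EA : encodable A} (p : X -> pred A) (l : X -> seq A) :
  FP (fun q : X * A => p q.1 q.2) -> FP l -> FP (fun x => filter (p x) (l x)).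
Proof.
move=> Hp Hl.
apply: (FP_ext (f := fun x => flatten (map (fun a => if p x a then [:: a] else [::]) (l x)))).
  by move=> x; elim: (l x) => //= a r ->; case: (p x a).
by apply: FP_flatten; apply: (FP_map (f := fun x a => if p x a then [:: a] else [::])); fp.
Qed.

Lemma FP_sizes X {EX : encodable X} A {EA : encodable A} (l : X -> seq A) :
  FP l -> FP (fun x => size (l x)).
Proof.
move=> Hl; apply: (FP_ext (f := fun x => foldl (fun s _ => s.+1) 0 (l x))).
  by move=> x; rewrite -[RHS]addn0; elim: (l x) 0 => //= a r IH s; rewrite IH addSnnS.
have Hg : PB (fun _ : X => 1) by pb.
apply: (FP_fold_grow (f := fun _ s _ => s.+1) (st := fun _ => 0)) Hg _; [fp|fp|fp|].
by move=> x s a Ha; rewrite !size_encode_nat addn1.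
Qed.

Lemma FP_has X {EX : encodable X} A {EA : encodable A} (p : X -> pred A) (l : X -> seq A) :
  FP (fun q : X * A => p q.1 q.2) -> FP l -> FP (fun x => has (p x) (l x)).
Proof.
move=> Hp Hl; apply: (FP_ext (f := fun x => foldl (fun s a => s || p x a) false (l x))).
  move=> x; rewrite -[RHS]orFb; elim: (l x) false => [|a r IH] s /=; first by rewrite orbF.
  by rewrite IH orbA.
have Hg : PB (fun _ : X => 0) by pb.
by apply: (FP_fold_grow (f := fun x s a => s || p x a) (st := fun _ => false)) Hg _; [fp|fp|fp|].
Qed.

Lemma FP_all X {EX : encodable X} A {EA : encodable A} (p : X -> pred A) (l : X -> seq A) :
  FP (fun q : X * A => p q.1 q.2) -> FP l -> FP (fun x => all (p x) (l x)).
Proof.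
move=> Hp Hl; apply: (FP_ext (f := fun x => ~~ has (predC (p x)) (l x))).
  by move=> x; rewrite -all_predC; apply: eq_all => a /=; rewrite negbK.
by apply: FP_negb; apply: (FP_has (p := fun x => predC (p x))); fp.
Qed.

Lemma FP_find X {EX : encodable X} A {EA : encodable A} (p : X -> pred A) (l : X -> seq A) :
  FP (fun q : X * A => p q.1 q.2) -> FP l -> FP (fun x => find (p x) (l x)).
Proof.
move=> Hp Hl.
pose F x (s : bool * nat) a := if s.1 then s else if p x a then (true, s.2) else (false, s.2.+1).
apply: (FP_ext (f := fun x => (foldl (F x) (false, 0) (l x)).2)).
  move=> x; rewrite -[RHS]add0n.
  have Ht r n : (foldl (F x) (true, n) r).2 = n by elim: r.
  elim: (l x) 0 => [|a r IH] s /=; first by rewrite addn0.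
  by rewrite /F /=; case: (p x a); rewrite -/F ?Ht ?addn0 // IH addSnnS.
have Hg : PB (fun _ : X => 1) by pb.
apply: FP_snd; apply: (FP_fold_grow (f := F) (st := fun _ => (false, 0))) Hg _; [|fp|fp|].
  by rewrite /F; fp.
move=> x [[] s] a Ha; rewrite /F [(_, _).1]/= [(_, _).2]/=; first exact: leq_addr.
by case: (p x a); rewrite !size_encode_pair !size_encode_nat !size_encode_bool; lia.
Qed.

Lemma FP_behead X {EX : encodable X} A {EA : encodable A} (l : X -> seq A) :
  FP l -> FP (fun x => behead (l x)).
Proof.
move=> Hl.
by apply: FP_ext (FP_case (f := fun _ => [::]) (g := fun _ _ r => r) Hl _ _);
  [move=> x; case: (l x)|fp|fp].
Qed.

Lemma FP_head X {EX : encodable X} A {EA : encodable A} (d : A) (l : X -> seq A) :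
  FP l -> FP (fun x => head d (l x)).
Proof.
move=> Hl.
by apply: FP_ext (FP_case (f := fun _ => d) (g := fun _ a _ => a) Hl _ _);
  [move=> x; case: (l x)|fp|fp].
Qed.

Lemma size_encode_behead A {EA : encodable A} (l : seq A) :
  size (encode (behead l)) <= size (encode l).
Proof.
case: l => [|a l]; first exact: leqnn.
by rewrite size_encode_cons [behead _]/= ltnW // ltnS leq_addl.
Qed.

Lemma FP_drop X {EX : encodable X} A {EA : encodable A} (n : X -> nat) (l : X -> seq A) :
  FP n -> FP l -> FP (fun x => drop (n x) (l x)).
Proof.
move=> Hn Hl; apply: (FP_ext (f := fun x => iter (n x) behead (l x))).
  by move=> x; elim: (n x) => [|m IH] /=; rewrite ?drop0 // IH -drop1 drop_drop.
have Hs := FP_size Hl.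
apply: (FP_iter (f := fun _ => behead)) Hs _ => //; first by apply: FP_behead; fp.
move=> x; elim=> [|j IH] Hj; first exact: leqnn.
exact: leq_trans (size_encode_behead _) (IH (ltnW Hj)).
Qed.

Lemma FP_nth X {EX : encodable X} A {EA : encodable A} (d : A) (l : X -> seq A) (n : X -> nat) :
  FP l -> FP n -> FP (fun x => nth d (l x) (n x)).
Proof.
move=> Hl Hn; apply: (FP_ext (f := fun x => head d (drop (n x) (l x)))).
  by move=> x; rewrite -nth0 nth_drop addn0.
by apply: FP_head; apply: FP_drop.
Qed.

Lemma FP_last X {EX : encodable X} A {EA : encodable A} (d : A) (l : X -> seq A) :
  FP l -> FP (fun x => last d (l x)).
Proof.
move=> Hl; apply: (FP_ext (f := fun x => head d (rev (l x)))).
  by move=> x; case/lastP: (l x) => // s a; rewrite rev_rcons last_rcons.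
by apply: FP_head; apply: FP_rev.
Qed.

Lemma FP_take X {EX : encodable X} A {EA : encodable A} (n : X -> nat) (l : X -> seq A) :
  FP n -> FP l -> FP (fun x => take (n x) (l x)).
Proof.
move=> Hn Hl; apply: (FP_ext (f := fun x => rev (drop (size (l x) - n x) (rev (l x))))).
  move=> x; rewrite drop_rev revK; case: (leqP (n x) (size (l x))) => H; first by rewrite subKn.
  have -> : size (l x) - n x = 0 by apply/eqP; rewrite subn_eq0 ltnW.
  by rewrite subn0 take_size take_oversize // ltnW.
by apply: FP_rev; apply: FP_drop; [apply: FP_subn => //; apply: FP_sizes|apply: FP_rev].
Qed.

Lemma FP_iota0 X {EX : encodable X} (n : X -> nat) : FP n -> FP (fun x => iota 0 (n x)).
Proof.
move=> Hn; pose F (p : nat * seq nat) := (p.1.+1, p.1 :: p.2).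
have EF j : iter j F (0, [::]) = (j, rev (iota 0 j)).
  by elim: j => //= j ->; rewrite /F /= -rev_rcons -cats1 -(iotaD 0 j 1) addn1.
apply: (FP_ext (f := fun x => rev (iter (n x) F (0, [::])).2)).
  by move=> x; rewrite EF revK.
have Hs := FP_size Hn.
have Hg : PB (fun x => size (encode (n x)) * (size (encode (n x)) + 4) + 4) by pb.
apply: FP_rev; apply: FP_snd.
apply: (FP_iter (f := fun _ => F) (st := fun _ => (0, [::]))) Hg _ => //; [by rewrite /F; fp|fp|].
move=> x j Hj; rewrite EF size_encode_pair !size_encode_nat size_encode_seq.
have : \sum_(a <- rev (iota 0 j)) (size (encode a)).+1 <= j * j.+2.
  apply: (@leq_trans (\sum_(a <- rev (iota 0 j)) j.+2)).
    rewrite big_seq [X in _ <= X]big_seq leq_sum // => i.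
    by rewrite mem_rev mem_iota add0n size_encode_nat /= => Hi; lia.
  by rewrite big_const_seq count_predT size_rev size_iota iter_addn_0 mulnC.
nia.
Qed.

Lemma FP_nseq X {EX : encodable X} A {EA : encodable A} (n : X -> nat) (a : X -> A) :
  FP n -> FP a -> FP (fun x => nseq (n x) (a x)).
Proof.
move=> Hn Ha; apply: (FP_ext (f := fun x => map (fun _ : nat => a x) (iota 0 (n x)))).
  by move=> x; elim: (n x) 0 => //= m IH i; rewrite IH.
by apply: (FP_map (f := fun x _ => a x)); [fp|apply: FP_iota0].
Qed.

Lemma FP_memn X {EX : encodable X} (a : X -> nat) (l : X -> seq nat) :
  FP a -> FP l -> FP (fun x => a x \in l x).
Proof.
move=> Ha Hl; apply: (FP_ext (f := fun x => has (fun b => b == a x) (l x))).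
  by move=> x; rewrite -has_pred1.
by apply: (FP_has (p := fun x b => b == a x)) => //; apply: FP_eqn; fp.
Qed.

Lemma FP_undup X {EX : encodable X} (l : X -> seq nat) : FP l -> FP (fun x => undup (l x)).
Proof.
move=> Hl.
apply: (FP_ext (f := fun x => foldl (fun s a => if a \in s then s else a :: s) [::] (rev (l x)))).
  by move=> x; rewrite foldl_rev; elim: (l x) => //= a r ->; rewrite mem_undup.
have Hl' := FP_rev Hl; have Hs := FP_size Hl'.
have Hg : PB (fun x => (size (encode (rev (l x)))).+1) by pb.
apply: (FP_fold_grow (f := fun _ s a => if a \in s then s else a :: s) (st := fun _ => [::])
  (l := fun x => rev (l x))) Hg _; [|fp|fp|].
  by apply: FP_if; [apply: FP_memn|..]; fp.
move=> x s a Ha; case: ifP => _; first exact: leq_addr.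
by rewrite size_encode_cons addnC addnS ltnS leq_add2l.
Qed.

Lemma FP_uniq X {EX : encodable X} (l : X -> seq nat) : FP l -> FP (fun x => uniq (l x)).
Proof.
move=> Hl; apply: (FP_ext (f := fun x => size (l x) <= size (undup (l x)))).
  by move=> x; rewrite leqNgt ltn_size_undup negbK.
by apply: FP_leq; apply: FP_sizes => //; apply: FP_undup.
Qed.

Ltac fp1 :=
  first [ fp0 | refine (FP_muln _ _) | refine (FP_expn _ _) | refine (FP_leq _ _)
  | refine (FP_eqn _ _) | refine (FP_double _)
  | refine (FP_rev _) | refine (FP_nth _ _ _) | refine (FP_map _ _) | refine (FP_cat _ _)
  | refine (FP_flatten _) | refine (FP_filter _ _) | refine (FP_sizes _)
  | refine (FP_has _ _) | refine (FP_all _ _) | refine (FP_find _ _)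
  | refine (FP_head _ _) | refine (FP_drop _ _) | refine (FP_last _ _)
  | refine (FP_take _ _) | refine (FP_iota0 _) | refine (FP_nseq _ _)
  | refine (FP_memn _ _) | refine (FP_undup _) | refine (FP_uniq _) ].
Ltac fps := repeat (fp1; cbv beta).

(** * The algorithm *)

Definition incb (s : seq bool) :=
  nseq (find negb s) false ++ true :: drop (find negb s).+1 s.
Definition ubits (m : nat) := iter m incb [::].

(* The value of a binary numeral (least significant bit first), truncated at [cap]. *)
Definition ubin (cap : nat) (s : seq bool) : nat :=
  foldl (fun a (b : bool) => minn cap (b + a.*2)) 0 (rev s).

Section Matrices.
Definition at_ T (A : seq (seq (seq T))) i j := nth [::] (nth [::] A i) j.
Definition tabulate T m (f : nat -> nat -> T) := mkseq (fun i => mkseq (f i) m) m.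

(* Polynomials over F_2 are bit lists; a matrix entry is a list of at most one
   exponent, the empty list standing for 0. *)
Definition xorp (s t : seq bool) :=
  mkseq (fun i => nth false s i != nth false t i) (maxn (size s) (size t)).
Definition xsum (l : seq (seq bool)) := foldl xorp [::] l.
Definition mulm (es : seq nat) (p : seq bool) := xsum [seq nseq e false ++ p | e <- es].
(** Bird's operator on matrices: the strict upper triangle is kept and a diagonal entry becomes
    minus the sum of the later diagonal entries. Over F_2 the minus sign disappears. *)
Definition mu m (X : seq (seq (seq bool))) i j :=
  if i < j then at_ X i j
  else if i == j then xsum [seq at_ X l l | l <- [seq l <- iota 0 m | i < l]] else [::].
Definition bstep (A : seq (seq (seq nat))) m X :=
  tabulate m (fun i j => xsum [seq mulm (at_ A l j) (mu m X i l) | l <- iota 0 m]).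
(* Bird's division-free determinant. *)
Definition bdet (A : seq (seq (seq nat))) m :=
  at_ (iter m.-1 (bstep A m) (tabulate m (fun i j => mulm (at_ A i j) [:: true]))) 0 0.
Definition del (A : seq (seq (seq nat))) m u v :=
  tabulate m (fun a b => if (a == u) && (b == v) then [::] else at_ A a b).

(* The coefficient parity at an isolated code [W] flips exactly when an edge of the
   isolated permutation is deleted. *)
Definition succW A m W u :=
  find (fun v => nth false (bdet A m) W != nth false (bdet (del A m u v) m) W) (iota 0 m).
Definition orbseq (sg : seq nat) m u := undup (mkseq (fun i => iter i (nth 0 sg) u) m).
Definition cycs (sg : seq nat) m : seq (seq nat) :=
  foldl (fun cs u => if has (fun c => u \in c) cs then cs else orbseq sg m u :: cs) [::] (iota 0 m).
(* Code of the edge closing the cycle [c], which is lost when [c] is cut into a path. *)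
Definition rcode (A : seq (seq (seq nat))) (c : seq nat) := head 0 (at_ A (last 0 c) (head 0 c)).
Definition cut A (tbl : seq (seq (seq nat))) cy c j :=
  if rcode A (rot j cy) <= c then
    [seq o ++ rot j cy | o <- nth [::] tbl (c - rcode A (rot j cy))] else [::].
(** A cycle is opened at one of two consecutive edges, through [rot 0] or [rot 1]. Keeping one
    representative for each total code, by [take 1], keeps the table polynomial. *)
Definition dpstep D A tbl cy :=
  mkseq (fun c => take 1 (cut A tbl cy c 0 ++ cut A tbl cy c 1)) D.
(** The lost edges are among those of the cover, whose codes sum to [W]; therefore [W.+1] table
    entries suffice. *)
Definition tours A m W : seq (seq nat) :=
  flatten (foldl (dpstep W.+1 A) [:: [:: [::]]] (cycs (mkseq (succW A m W) m) m)).
End Matrices.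

(* [(coins, (binary n, binary weights))] *)
Definition inp := (seq bool * (seq bool * seq (seq bool)))%type.
(** Number of weights plus their total length. For [k >= 1] and [n >= 2] it bounds [n], hence the
    number of paths, and the length of every weight. *)
Definition xZ (x : inp) := size x.2.2 + size (flatten x.2.2).
Definition xn (x : inp) := ubin (xZ x) x.2.1.
Definition xt (x : inp) := size (ubits (xZ x)).
Definition wt k (x : inp) u v i : seq bool :=
  nth [::] x.2.2 (find (fun e => (e.1 == u) && (e.2 == v)) (edges_of (xn x)) * k + i).
(** For a numeral of length at most [s] the quotient is below [2 ^ xt x], hence at most [2 * xZ x]:
    on edges that are light enough the cap changes nothing. *)
Definition qv (x : inp) s (b : seq bool) := ubin (2 * xZ x) (drop (s - xt x) b).
(* The weight vector of an edge, rounded down to multiples of 2^(s_i - t), as one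
   number in base 4 Z^2. *)
Fixpoint qcode k (x : inp) sv u v j :=
  if j is i.+1 then
    qcode k x sv u v i + qv x (nth 0 sv i) (wt k x u v i) * (4 * xZ x ^ 2) ^ i
  else 0.
(** Each pair [(a, b)] of path indices below [xZ x] owns a block of [C * xt x] coins. *)
Definition rnd C (x : inp) a b :=
  ubin ((2 * xZ x) ^ C) (take (C * xt x) (drop ((a * xZ x + b) * (C * xt x)) x.1)).
(** The edge from the end of path [a] to the start of path [b]. Excluding [a = b] forces every cycle
    of a cover to have at least two edges, as the opening step requires. The random weight is placed
    above the [k] rounded digits. *)
Definition ent k C (x : inp) (P : seq (seq nat)) sv a b : seq nat :=
  let u := last 0 (nth [::] P a) in let v := head 0 (nth [::] P b) in
  if (a != b) && all (fun i => size (wt k x u v i) <= nth 0 sv i) (iota 0 k)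
  then [:: qcode k x sv u v k + (4 * xZ x ^ 2) ^ k * rnd C x a b] else [::].
Definition adjm k C x P sv := tabulate (size P) (ent k C x P sv).

Definition joins (P : seq (seq nat)) : seq (seq (seq nat)) :=
  flatten [seq [seq (nth [::] P a ++ nth [::] P b) ::
                    [seq nth [::] P c | c <- [seq c <- iota 0 (size P) | (c != a) && (c != b)]]
               | b <- iota 0 (size P)] | a <- iota 0 (size P)].
(** Each level keeps a system or joins two of its paths, so that up to order every system with at
    most [L] edges occurs. *)
Fixpoint guesses L n : seq (seq (seq nat)) :=
  if L is l.+1 then flatten [seq P :: joins P | P <- guesses l n]
  else [:: [seq [:: v] | v <- iota 0 n]].
Fixpoint svecs k Z : seq (seq nat) :=
  if k is j.+1 then flatten [seq [seq s :: v | v <- svecs j Z] | s <- iota 0 (Z + 1)]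
  else [:: [::]].
Definition lift_tours k C x P sv : seq (seq nat) :=
  flatten [seq [seq flatten [seq nth [::] P a | a <- o] | o <- tours (adjm k C x P sv) (size P) W]
          | W <- iota 0 (size (bdet (adjm k C x P sv) (size P)))].
(** The concatenation of [P] is itself a candidate: for [n <= L + 1] a whole tour is guessed as a
    single path, and nothing else is needed. *)
Definition cands k L C x : seq (seq nat) :=
  flatten [seq flatten P :: flatten [seq lift_tours k C x P sv | sv <- svecs k (xZ x)]
          | P <- guesses L (xn x)].
Definition sols k L C x := [seq s <- cands k L C x | ham_order (xn x) s].
Definition alg k L C x : seq (seq (seq bool)) := [seq [seq ubits v | v <- s] | s <- sols k L C x].

(** ** Polynomial-time bounds *)

Lemma FP_nat_of_bool X {EX : encodable X} (b : X -> bool) :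
  FP b -> FP (fun x => nat_of_bool (b x)).
Proof. by move=> Hb; refine (FP_if Hb _ _); fp. Qed.

Lemma size_encode_bits (s : seq bool) : size (encode s) = (2 * size s).+1.
Proof.
by elim: s => // b s IH; rewrite size_encode_cons IH size_encode_bool -[size (b :: s)]/(size s).+1; lia.
Qed.

Lemma FP_incb X {EX : encodable X} (s : X -> seq bool) : FP s -> FP (fun x => incb (s x)).
Proof. by move=> Hs; rewrite /incb; fps. Qed.

Lemma size_incb s : size (incb s) <= (size s).+1.
Proof.
rewrite /incb size_cat size_nseq /= size_drop.
by have := find_size negb s; lia.
Qed.

Lemma size_ubits n : size (ubits n) <= n.
Proof. by elim: n => // n IH; apply: leq_trans (size_incb _) _. Qed.

Lemma FP_ubits X {EX : encodable X} (n : X -> nat) : FP n -> FP (fun x => ubits (n x)).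
Proof.
move=> Hn; have Hs := FP_size Hn; have Hg : PB (fun x => 2 * size (encode (n x))) by pb.
apply: (FP_iter (f := fun _ => incb) (st := fun _ => [::])) Hg _ => //; [|fp|].
  by apply: FP_incb; fp.
by move=> x j Hj; rewrite size_encode_bits size_encode_nat; have := size_ubits j; rewrite /ubits; lia.
Qed.

Lemma FP_ubin X {EX : encodable X} (c : X -> nat) (s : X -> seq bool) :
  FP c -> FP s -> FP (fun x => ubin (c x) (s x)).
Proof.
move=> Hc Hs; have Hg := FP_size Hc.
apply: (FP_foldl (f := fun x a b => minn (c x) (nat_of_bool b + a.*2)) (st := fun _ => 0)
  (l := fun x => rev (s x))) Hg _; [|fp|fps|].
  by fps; apply: FP_nat_of_bool; fp.
move=> x j; rewrite !size_encode_nat ltnS; case/lastP: (take j _) => // r b.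
by rewrite -cats1 foldl_cat /= geq_minl.
Qed.

Lemma FP_at X {EX : encodable X} T {ET : encodable T} (A : X -> seq (seq (seq T))) (i j : X -> nat) :
  FP A -> FP i -> FP j -> FP (fun x => at_ (A x) (i x) (j x)).
Proof. by move=> HA Hi Hj; rewrite /at_; fps. Qed.

Lemma FP_tabulate X {EX : encodable X} T {ET : encodable T} (m : X -> nat) (f : X -> nat -> nat -> T) :
  FP (fun p : X * nat * nat => f p.1.1 p.1.2 p.2) -> FP m -> FP (fun x => tabulate (m x) (f x)).
Proof. by move=> Hf Hm; rewrite /tabulate; fps. Qed.

Lemma size_xorp s t : size (xorp s t) = maxn (size s) (size t).
Proof. exact: size_mkseq. Qed.

Lemma FP_xsum X {EX : encodable X} (l : X -> seq (seq bool)) : FP l -> FP (fun x => xsum (l x)).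
Proof.
move=> Hl; have Hg := FP_size Hl.
apply: (FP_fold_grow (f := fun _ => xorp) (st := fun _ => [::])) Hg _; [|fp|fp|].
  by rewrite /xorp; fps.
move=> x s a Ha; apply: leq_trans (leq_add (leqnn _) Ha).
by rewrite !size_encode_bits size_xorp; lia.
Qed.

Lemma FP_mulm X {EX : encodable X} (e : X -> seq nat) (p : X -> seq bool) :
  FP e -> FP p -> FP (fun x => mulm (e x) (p x)).
Proof. by move=> He Hp; rewrite /mulm; apply: FP_xsum; fps. Qed.

Ltac fpa := first [ fp1 | refine (FP_xsum _) | refine (FP_mulm _ _) | refine (FP_at _ _ _)
  | refine (FP_tabulate _ _) | refine (FP_ubin _ _) | refine (FP_ubits _) ].
Ltac fpb := repeat (fpa; cbv beta).

Lemma FP_bstep X {EX : encodable X} (A : X -> seq (seq (seq nat))) (m : X -> nat)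
    (P : X -> seq (seq (seq bool))) :
  FP A -> FP m -> FP P -> FP (fun x => bstep (A x) (m x) (P x)).
Proof. by move=> HA Hm HP; rewrite /bstep /mu; fpb. Qed.

Lemma size_xsum l b : all (fun p : seq bool => size p <= b) l -> size (xsum l) <= b.
Proof.
rewrite /xsum -[X in _ -> _ <= X]max0n -[X in maxn X]/(size ([::] : seq bool)).
elim: l [::] => [|p l IH] s /=; first by rewrite leq_maxl.
move=> /andP [Hp Hl]; apply: leq_trans (IH _ Hl) _.
by rewrite size_xorp; lia.
Qed.

Lemma size_mulm es p b : (forall e, e \in es -> e <= b) -> size (mulm es p) <= b + size p.
Proof.
move=> He; apply: size_xsum; apply/allP => q /mapP [e /He Hb ->].
by rewrite size_cat size_nseq leq_add2r.
Qed.

Lemma at_tabulate T m (f : nat -> nat -> seq T) i j :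
  at_ (tabulate m f) i j = if (i < m) && (j < m) then f i j else [::].
Proof.
rewrite /at_ /tabulate; case: (ltnP i m) => Hi; last by rewrite [nth [::] (mkseq _ _) i]nth_default ?size_mkseq // nth_nil.
rewrite nth_mkseq //; case: (ltnP j m) => Hj; first by rewrite nth_mkseq.
by rewrite nth_default ?size_mkseq.
Qed.

Definition entries_le (A : seq (seq (seq nat))) b :=
  forall i j e, e \in at_ A i j -> e <= b.

(** Exponents are stored in unary, so the degrees occurring in the determinant are polynomial in the
    size of the matrix. *)
Lemma entries_encode A : entries_le A (size (encode A)).
Proof.
move=> i j e; rewrite /at_ => He.
have [Hj|Hj] := ltnP j (size (nth [::] A i)); last by rewrite nth_default in He.
have [Hi|Hi] := ltnP i (size A); last by rewrite (nth_default _ Hi) nth_nil in He.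
have H1 : size (encode e) < size (encode (nth [::] (nth [::] A i) j)) by exact: size_encode_mem.
have H2 : size (encode (nth [::] (nth [::] A i) j)) < size (encode (nth [::] A i)).
  exact: (size_encode_mem (mem_nth [::] Hj)).
have H3 : size (encode (nth [::] A i)) < size (encode A).
  exact: (size_encode_mem (mem_nth [::] Hi)).
by move: H1; rewrite size_encode_nat; lia.
Qed.

Lemma bird_size A m b j : entries_le A b -> forall u v,
  size (at_ (iter j (bstep A m) (tabulate m (fun i j => mulm (at_ A i j) [:: true]))) u v)
    <= j.+1 * b + 1.
Proof.
move=> Hb; elim: j => [|j IH] u v /=.
  rewrite at_tabulate; case: ifP => // _.
  by apply: leq_trans (size_mulm _ (Hb u v)) _; rewrite mul1n.
rewrite {1}/bstep at_tabulate; case: ifP => // _.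
apply: size_xsum; apply/allP => p /mapP [l _ ->].
apply: leq_trans (size_mulm _ (Hb l v)) _.
suff : size (mu m (iter j (bstep A m) (tabulate m (fun i j => mulm (at_ A i j) [:: true]))) u l)
    <= j.+1 * b + 1 by nia.
rewrite /mu; case: ifP => // _; case: ifP => // _.
by apply: size_xsum; apply/allP => q /mapP [l' _ ->].
Qed.

Lemma size_encode_mkseq T {ET : encodable T} m (f : nat -> T) b :
  (forall i, size (encode (f i)) <= b) -> size (encode (mkseq f m)) <= (m * b.+1).+1.
Proof.
move=> Hb; rewrite size_encode_seq ltnS.
apply: (@leq_trans (\sum_(a <- mkseq f m) b.+1)).
  rewrite big_map [X in _ <= X]big_map; apply: leq_sum => i _; exact: Hb.
by rewrite big_const_seq count_predT size_mkseq iter_addn_0 mulnC.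
Qed.

Lemma size_encode_tabulate m (f : nat -> nat -> seq bool) b :
  (forall i j, size (f i j) <= b) ->
  size (encode (tabulate m f)) <= (m * (m * (2 * b).+2).+2).+1.
Proof.
move=> Hb; apply: size_encode_mkseq => i; apply: size_encode_mkseq => j.
by rewrite size_encode_bits; have := Hb i j; lia.
Qed.

Lemma FP_bdet X {EX : encodable X} (A : X -> seq (seq (seq nat))) (m : X -> nat) :
  FP A -> FP m -> FP (fun x => bdet (A x) (m x)).
Proof.
move=> HA Hm; rewrite /bdet; apply: FP_at; [|fp|fp].
have Hs := FP_size HA; have Hs' := FP_size Hm.
pose F (M a : nat) := (M * (M * (2 * ((M + 1) * a + 1 * a + 1)).+2).+2).+1.
have Hg : PB (fun x => F (size (encode (m x))) (size (encode (A x)))) by rewrite /F; pb.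
apply: (FP_iter (f := fun x => bstep (A x) (m x))) Hg _; [|fpb|fps|].
  by apply: FP_bstep; fp.
move=> x j Hj; set M := m x; set a := size (encode (A x)).
have Hb := bird_size M j (@entries_encode (A x)).
have Et : exists f, iter j (bstep (A x) M) (tabulate M (fun i j => mulm (at_ (A x) i j) [:: true]))
    = tabulate M f.
  by case: (j) => [|j']; eexists; rewrite ?iterS.
have [f Ef] := Et; rewrite Ef in Hb *.
(* The bound [Hb] concerns [f] only inside the range; tabulating through [at_] gives a function that
   is bounded everywhere. *)
have -> : tabulate M f = tabulate M (fun i j => at_ (tabulate M f) i j).
  rewrite /tabulate; apply/eq_in_map => u; rewrite mem_iota => /= Hu.
  by apply/eq_in_map => v; rewrite mem_iota => /= Hv; rewrite at_tabulate Hu Hv.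
apply: leq_trans (size_encode_tabulate M Hb) _; rewrite /F size_encode_nat -/M -/a.
have H1 : j.+1 * a + 1 <= (M.+1 + 1) * a + 1 * a + 1 by move: Hj; rewrite -/M; nia.
by rewrite ltnS leq_mul // !ltnS leq_mul // !ltnS leq_mul2l H1.
Qed.

Lemma FP_del X {EX : encodable X} (A : X -> seq (seq (seq nat))) (m u v : X -> nat) :
  FP A -> FP m -> FP u -> FP v -> FP (fun x => del (A x) (m x) (u x) (v x)).
Proof. by move=> HA Hm Hu Hv; rewrite /del; fpb. Qed.

Lemma FP_succW X {EX : encodable X} (A : X -> seq (seq (seq nat))) (m W u : X -> nat) :
  FP A -> FP m -> FP W -> FP u -> FP (fun x => succW (A x) (m x) (W x) (u x)).
Proof.
move=> HA Hm HW Hu; rewrite /succW.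
have H1 : FP (fun p : X * nat => bdet (A p.1) (m p.1)) by apply: FP_bdet; fp.
have H2 : FP (fun p : X * nat => bdet (del (A p.1) (m p.1) (u p.1) p.2) (m p.1)).
  by apply: FP_bdet; [apply: FP_del|]; fp.
by fps.
Qed.

Lemma size_encode_nth (s : seq nat) i : size (encode (nth 0 s i)) <= size (encode s).
Proof.
have [Hi|Hi] := ltnP i (size s); first by rewrite ltnW // size_encode_mem // mem_nth.
by rewrite nth_default // size_encode_nat; case: s {Hi} => // a s; rewrite size_encode_cons.
Qed.

Lemma FP_orbseq X {EX : encodable X} (sg : X -> seq nat) (m u : X -> nat) :
  FP sg -> FP m -> FP u -> FP (fun x => orbseq (sg x) (m x) (u x)).
Proof.
move=> Hsg Hm Hu; rewrite /orbseq; fps.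
have Hsg' : FP (fun p : X * nat => sg p.1) by fp.
have Hu' : FP (fun p : X * nat => u p.1) by fp.
have Hs := FP_size Hsg'; have Hs' := FP_size Hu'.
have Hg : PB (fun p : X * nat => size (encode (sg p.1)) + size (encode (u p.1))) by pb.
apply: (FP_iter (f := fun p : X * nat => nth 0 (sg p.1)) (st := fun p => u p.1)
  (n := fun p => p.2)) Hg _ => //; [fps|fp|].
move=> p [|j] _; first exact: leq_addl.
exact: leq_trans (size_encode_nth _ _) (leq_addr _ _).
Qed.

Lemma FP_cycs X {EX : encodable X} (sg : X -> seq nat) (m : X -> nat) :
  FP sg -> FP m -> FP (fun x => cycs (sg x) (m x)).
Proof.
move=> Hsg Hm; rewrite /cycs.
have Ho : FP (fun p : X * nat => orbseq (sg p.1) (m p.1) p.2) by apply: FP_orbseq; fp.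
have Hi : FP (fun x => iota 0 (m x)) by fps.
have [k Hk] := FP_size Ho; have Hs := FP_size Hi.
have Hg : PB (fun x => ((size (encode x) + size (encode (iota 0 (m x)))) + 2) ^ k + 1) by pb.
apply: (FP_fold_grow (f := fun x cs u => if has (fun c => u \in c) cs then cs else orbseq (sg x) (m x) u :: cs)
  (st := fun _ => [::])) Hg _; [|fp|fps|].
  have Ho' : FP (fun p : X * seq (seq nat) * nat => orbseq (sg p.1.1) (m p.1.1) p.2).
    by apply: FP_orbseq; fp.
  by fps.
move=> x s u Hu'; case: ifP => _; first exact: leq_addr.
rewrite size_encode_cons addn1 addnS ltnS addnC leq_add2l.
apply: leq_trans (Hk (x, u)) _; apply: leq_pwl.
by rewrite size_encode_pair leq_add2l.
Qed.

Lemma FP_cut X {EX : encodable X} (A tbl : X -> seq (seq (seq nat))) (cy : X -> seq nat)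
    (c : X -> nat) j :
  FP A -> FP tbl -> FP cy -> FP c -> FP (fun x => cut (A x) (tbl x) (cy x) (c x) j).
Proof. by move=> HA Ht Hcy Hc; rewrite /cut /rcode; fpb. Qed.

Lemma FP_dpstep X {EX : encodable X} (A tbl : X -> seq (seq (seq nat))) (cy : X -> seq nat)
    (D : X -> nat) :
  FP A -> FP tbl -> FP cy -> FP D -> FP (fun x => dpstep (D x) (A x) (tbl x) (cy x)).
Proof.
move=> HA Ht Hcy HD; rewrite /dpstep.
have Hc j : FP (fun p : X * nat => cut (A p.1) (tbl p.1) (cy p.1) p.2 j) by apply: FP_cut; fp.
by have H0 := Hc 0; have H1 := Hc 1; fps.
Qed.

Lemma size_encode_rot (s : seq nat) i : size (encode (rot i s)) = size (encode s).
Proof. by rewrite !size_encode_seq (perm_big _ (permEl (perm_rot i s))). Qed.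

Definition tbl_le b (tbl : seq (seq (seq nat))) :=
  all (fun e => (size e <= 1) && all (fun o => size (encode o) <= b) e) tbl.

Lemma tbl_le_nth b tbl c : tbl_le b tbl ->
  (size (nth [::] tbl c) <= 1) && all (fun o => size (encode o) <= b) (nth [::] tbl c).
Proof.
move=> Ht; have [Hc|Hc] := ltnP c (size tbl); last by rewrite nth_default.
exact: (allP Ht _ (mem_nth [::] Hc)).
Qed.

Lemma dpstep_le b D A tbl cy : tbl_le b tbl -> tbl_le (b + size (encode cy)) (dpstep D A tbl cy).
Proof.
move=> Ht; apply/allP => e /mapP [c _ ->]; rewrite size_take.
have Hall : all (fun o => size (encode o) <= b + size (encode cy))
    (cut A tbl cy c 0 ++ cut A tbl cy c 1).
  rewrite all_cat; apply/andP; split; rewrite /cut; case: ifP => // _; apply/allP => o /mapP [o' Ho ->].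
    have /andP [_ /allP Hb] := tbl_le_nth (c - rcode A (rot 0 cy)) Ht.
    by apply: leq_trans (leqnSn _) _; rewrite size_encode_cat size_encode_rot leq_add2r Hb.
  have /andP [_ /allP Hb] := tbl_le_nth (c - rcode A (rot 1 cy)) Ht.
  by apply: leq_trans (leqnSn _) _; rewrite size_encode_cat size_encode_rot leq_add2r Hb.
apply/andP; split; first by case: ltnP => // /ltnW.
by apply/allP => o /mem_take; exact: (allP Hall).
Qed.

Lemma tbl_size b D tbl : tbl_le b tbl -> size tbl <= D ->
  size (encode tbl) <= (D * (b + 2).+1).+1.
Proof.
move=> Ht HD; rewrite size_encode_seq ltnS.
apply: (@leq_trans (\sum_(a <- tbl) (b + 2).+1)); last first.
  by rewrite big_const_seq count_predT iter_addn_0 mulnC leq_mul2r HD orbT.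
rewrite big_seq [X in _ <= X]big_seq; apply: leq_sum => e He.
have /andP [] := allP Ht e He; case: e {He} => [|o [|o' e]] // _.
  by rewrite size_encode_seq big_nil ltnS addn2.
by rewrite [all _ _]/= andbT size_encode_cons !size_encode_seq !big_nil => Ho; lia.
Qed.

Lemma FP_tours X {EX : encodable X} (A : X -> seq (seq (seq nat))) (m W : X -> nat) :
  FP A -> FP m -> FP W -> FP (fun x => tours (A x) (m x) (W x)).
Proof.
move=> HA Hm HW; rewrite /tours; refine (FP_flatten _).
have Hc : FP (fun x => cycs (mkseq (succW (A x) (m x) (W x)) (m x)) (m x)).
  have H1 : FP (fun p : X * nat => succW (A p.1) (m p.1) (W p.1) p.2) by apply: FP_succW; fp.
  by apply: FP_cycs; fps.
have Hs := FP_size Hc; have Hs' := FP_size HW.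
pose cs x := cycs (mkseq (succW (A x) (m x) (W x)) (m x)) (m x).
have Hg : PB (fun x => (size (encode (W x)) * (1 + size (encode (cs x)) + 2).+1).+1) by rewrite /cs; pb.
apply: (FP_foldl (f := fun x => dpstep (W x).+1 (A x)) (st := fun _ => [:: [:: [::]]])) Hg _ => //.
- by apply: FP_dpstep; fp.
- by fp.
move=> x j; rewrite -/(cs x) size_encode_nat.
have Hinv r tbl b : tbl_le b tbl -> 0 < size tbl <= (W x).+1 ->
    tbl_le (b + (size (encode r)).-1) (foldl (dpstep (W x).+1 (A x)) tbl r) /\
    size (foldl (dpstep (W x).+1 (A x)) tbl r) <= (W x).+1.
  elim: r tbl b => [|c r IH] tbl b Ht /andP [_ Hs1].
    by rewrite size_encode_seq big_nil addn0.
  have [|H1 H2] := IH _ _ (dpstep_le (W x).+1 (A x) c Ht); first by rewrite size_mkseq leqnn.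
  split=> //; apply: sub_all H1 => e /andP [-> /allP H]; apply/allP => o /H Ho.
  apply: leq_trans Ho _; rewrite size_encode_cons.
  have : 0 < size (encode r) by rewrite size_encode_seq.
  by lia.
have H0 : tbl_le 1 [:: [:: [::]]] by [].
have [|H1 H2] := Hinv (take j (cs x)) _ _ H0; first by [].
apply: leq_trans (tbl_size H1 H2) _.
rewrite ltnS leq_mul2l ltnS; apply/orP; right.
rewrite leq_add2r leq_add2l; apply: leq_trans (leq_pred _) _.
exact: size_encode_take.
Qed.

Lemma FP_xZ X {EX : encodable X} (x : X -> inp) : FP x -> FP (fun y => xZ (x y)).
Proof. by move=> Hx; rewrite /xZ; fpb. Qed.
Lemma FP_xn X {EX : encodable X} (x : X -> inp) : FP x -> FP (fun y => xn (x y)).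
Proof. by move=> Hx; rewrite /xn; apply: FP_ubin; [apply: FP_xZ|fp]. Qed.
Lemma FP_xt X {EX : encodable X} (x : X -> inp) : FP x -> FP (fun y => xt (x y)).
Proof. by move=> Hx; rewrite /xt; refine (FP_sizes _); apply: FP_ubits; apply: FP_xZ. Qed.

Lemma FP_wt X {EX : encodable X} k (x : X -> inp) (u v i : X -> nat) :
  FP x -> FP u -> FP v -> FP i -> FP (fun y => wt k (x y) (u y) (v y) (i y)).
Proof.
move=> Hx Hu Hv Hi; rewrite /wt.
have Hn := FP_xn Hx; have Hn' : FP (fun p : X * nat => xn (x p.1)) by apply: FP_xn; fp.
have He : FP (fun y => edges_of (xn (x y))).
  rewrite /edges_of; apply: FP_filter; first by fps.
  by apply: (FP_flatten (l := fun y => [seq [seq (u, v) | v <- iota 0 (xn (x y))] | u <- iota 0 (xn (x y))]));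
    fps.
by fps.
Qed.

Lemma FP_qv X {EX : encodable X} (x : X -> inp) (s : X -> nat) (b : X -> seq bool) :
  FP x -> FP s -> FP b -> FP (fun y => qv (x y) (s y) (b y)).
Proof.
move=> Hx Hs Hb; rewrite /qv; have HZ := FP_xZ Hx; have Ht := FP_xt Hx.
by apply: FP_ubin; fps.
Qed.

Lemma FP_qcode X {EX : encodable X} k (x : X -> inp) (sv : X -> seq nat) (u v : X -> nat) j :
  FP x -> FP sv -> FP u -> FP v -> FP (fun y => qcode k (x y) (sv y) (u y) (v y) j).
Proof.
move=> Hx Hsv Hu Hv; have HZ := FP_xZ Hx; elim: j => [|j IH] /=; first by fp.
apply: FP_addn => //; apply: FP_muln; last by fps.
by apply: FP_qv; [fp|fps|apply: FP_wt; fp].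
Qed.

Lemma FP_rnd X {EX : encodable X} C (x : X -> inp) (a b : X -> nat) :
  FP x -> FP a -> FP b -> FP (fun y => rnd C (x y) (a y) (b y)).
Proof.
move=> Hx Ha Hb; rewrite /rnd; have HZ := FP_xZ Hx; have Ht := FP_xt Hx.
by apply: FP_ubin; fps.
Qed.

Lemma FP_adjm X {EX : encodable X} k C (x : X -> inp) (P : X -> seq (seq nat)) (sv : X -> seq nat) :
  FP x -> FP P -> FP sv -> FP (fun y => adjm k C (x y) (P y) (sv y)).
Proof.
move=> Hx HP Hsv; rewrite /adjm; have HZ := FP_xZ Hx; apply: FP_tabulate; last by fps.
rewrite /ent; cbv zeta.
pose nd (p : X * nat * nat) := (last 0 (nth [::] (P p.1.1) p.1.2), head 0 (nth [::] (P p.1.1) p.2)).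
have H0 : FP nd by rewrite /nd; fps.
have H1 : FP (fun p : X * nat * nat * nat => wt k (x p.1.1.1) (nd p.1).1 (nd p.1).2 p.2).
  by apply: FP_wt; fp.
have H2 : FP (fun p : X * nat * nat => qcode k (x p.1.1) (sv p.1.1) (nd p).1 (nd p).2 k).
  by apply: FP_qcode; fp.
have H3 : FP (fun p : X * nat * nat => rnd C (x p.1.1) p.1.2 p.2) by apply: FP_rnd; fp.
by rewrite /nd in H1 H2; fps.
Qed.

Lemma FP_guesses X {EX : encodable X} L (n : X -> nat) : FP n -> FP (fun y => guesses L (n y)).
Proof.
move=> Hn; elim: L => [|L IH] /=; first by fps.
by rewrite /joins; fps.
Qed.

Lemma FP_svecs X {EX : encodable X} k (Z : X -> nat) : FP Z -> FP (fun y => svecs k (Z y)).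
Proof.
move=> HZ; elim: k => [|k IH]; first by fp.
have IH' : FP (fun p : X * nat => svecs k (Z p.1)).
  by apply: (FP_comp (f := fun p : X * nat => p.1) IH); fp.
by rewrite /=; fps.
Qed.

Lemma FP_sols X {EX : encodable X} k L C (x : X -> inp) : FP x -> FP (fun y => sols k L C (x y)).
Proof.
move=> Hx; rewrite /sols /ham_order /cands /lift_tours; have HZ : FP xZ by apply: FP_xZ; fp.
have Hn : FP xn by apply: FP_xn; fp.
have Hg : FP (guesses L) by apply: (FP_guesses L (n := id)); fp.
have Hv : FP (svecs k) by apply: (FP_svecs k (Z := id)); fp.
pose Y := (X * seq (seq nat) * seq nat)%type.
have Ha : FP (fun p : Y => adjm k C (x p.1.1) p.1.2 p.2) by apply: FP_adjm; fp.
have Hb : FP (fun p : Y => bdet (adjm k C (x p.1.1) p.1.2 p.2) (size p.1.2)).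
  by apply: FP_bdet; fps.
have Ht : FP (fun p : Y * nat => tours (adjm k C (x p.1.1.1) p.1.1.2 p.1.2) (size p.1.1.2) p.2).
  have Ha' : FP (fun p : Y * nat => adjm k C (x p.1.1.1) p.1.1.2 p.1.2) by apply: FP_adjm; fp.
  by apply: FP_tours; fps.
by rewrite /Y in Hb Ht; fps.
Qed.

Lemma FP_alg k L C : FP (alg k L C).
Proof.
have H := FP_sols k L C (FP_id (A := inp)).
have Hu : FP (fun p : inp * seq nat * nat => ubits p.2) by apply: FP_ubits; fp.
by rewrite /alg; fps.
Qed.

(** * From polynomial-time functions to a randomized Turing machine *)

Section Randomized.
Context A B {EA : encodable A} {EB : encodable B}.

Definition loadc := Then (mvc (T := A) false true) (back true).
(** The unary counter on the main stack says how many coins to read. Each is pushed with its tag,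
    which builds the encoding of a bit list. *)
Definition coinc := Then (CWhile is1 RM (Then (Pop RM) (Then (Push RA true) (Read RA))))
  (Then (Pop RM) (Then (Push RA false) (back true))).
(* Consumes as many input bits as the main stack holds, so that the output fits
   into the blank part of the input area. *)
Definition clearc := Then (CWhile isSome RM (CIf is1 RM
    (Then (Pop RM) (Push RA true)) (Then (Pop RM) (Push RA false))))
  (Then dupA (loop RB (fun _ => Then (Pop RB) (Then (Read RA) (Pop RA))))).

Lemma loadP (a : A) r : exists2 n,
  ex loadc (St [::] [::] [::] (encode a ++ r)) (St (encode a) [::] [::] r) n
  & n <= (mvk (T := A) + 5) * (size (encode a)).+1.
Proof.
have [n1 H1 N1] := mvP false true a r [::] ([::], [::]).
set v := encode a in H1 N1 *; rewrite cats0 in H1.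
have H2 := backP true [::] (rev v) ([::], r); rewrite revK cats0 in H2.
exists (n1 + (size (rev v) * 4 + 1)); first exact: ex_then H1 H2.
by rewrite size_rev; lia.
Qed.

Lemma coinP m s r : m <= size r ->
  ex coinc (St (encode m ++ s) [::] [::] r)
     (St (encode (take m r) ++ s) [::] [::] (drop m r)) (m * 12 + 8).
Proof.
move=> Hm; pose fl (l : seq bool) := flatten [seq [:: true; b] | b <- l].
have Hfl l : encode l = fl l ++ [:: false] by elim: l => // b l IH; rewrite encode_cons IH.
have Hsz l : size (fl l) = 2 * size l by elim: l => // b l IH; rewrite /fl /= -/(fl l) IH; lia.
have Hloop : forall m r a, m <= size r ->
    ex (CWhile is1 RM (Then (Pop RM) (Then (Push RA true) (Read RA))))
      (St (encode m ++ s) a [::] r)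
      (St (false :: s) (rev (fl (take m r)) ++ a) [::] (drop m r)) (m * 4 + 1).
  elim=> [|k IH] [|b l] a // Hk; first exact: ex_whilef.
    exact: ex_whilef.
  rewrite encode_S; apply: ex_eq (ex_whilet _ _ (IH l (b :: true :: a) Hk)) _ _ => //.
  - apply: (@ex_then _ _ _ _ _ 1 2 (ex_popM _ _ _ _ _)).
    apply: (@ex_then _ _ _ _ _ 1 1); first exact: ex_push.
    exact: ex_read.
  - by rewrite /= -/(fl (take k l)) !rev_cons !cat_rcons.
  - by lia.
have H1 := Hloop m r [::] Hm; rewrite cats0 in H1.
have H2 := backP true s (false :: rev (fl (take m r))) ([::], drop m r).
have H0 w i : ex (Push RA false) (St s w [::] i) (mk true true s (false :: w) ([::], i)) 1.
  exact: ex_push.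
apply: ex_eq (ex_then H1 (ex_then (ex_popM _ _ _ _ _) (ex_then (H0 _ _) H2))) _ _.
- by rewrite Hfl rev_cons revK cats1.
- by rewrite /= size_rev Hsz size_take_min (minn_idPl Hm); lia.
Qed.

Lemma clearcP v r : size v <= size r ->
  ex clearc (St v [::] [::] r) (St v [::] [::] (drop (size v) r)) (size v * 14 + 3).
Proof.
move=> Hv.
have H1 : ex (loop RM (fun b => Then (Pop RM) (Push RA b))) (St v [::] [::] r)
    (St [::] (rev v) [::] r) (size v * 4 + 1).
  apply: (@loopP _ _ (fun v w => St v w [::] r) 2) => // b v' w.
  exact: ex_then (ex_popM _ _ _ _ _) (ex_push _ _ _).
have H2 := dupAP [::] (rev v) [::] r; rewrite revK !cats0 in H2.
have H3 : forall v' r', size v' <= size r' ->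
    ex (loop RB (fun _ => Then (Pop RB) (Then (Read RA) (Pop RA))))
      (St v [::] v' r') (St v [::] [::] (drop (size v') r')) (size v' * 5 + 1).
  elim=> [|b v' IH] [|c r'] //= Hr'; try exact: ex_whilef.
  have Hb : ex (Then (Pop RB) (Then (Read RA) (Pop RA))) (St v [::] (b :: v') (c :: r'))
      (St v [::] v' r') 3.
    apply: (@ex_then _ _ _ (St v [::] v' (c :: r')) _ 1 2); first exact: ex_pop.
    by apply: (@ex_then _ _ _ (St v [:: c] v' r') _ 1 1); [exact: ex_read|exact: ex_pop].
  have Hi : ex (CIf is1 RB (Then (Pop RB) (Then (Read RA) (Pop RA)))
      (Then (Pop RB) (Then (Read RA) (Pop RA)))) (St v [::] (b :: v') (c :: r')) (St v [::] v' r') 4.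
    by case: b Hb => Hb; [apply: ex_ift Hb|apply: ex_iff Hb].
  by apply: ex_eq (ex_whilet _ Hi (IH r' Hr')) _ _ => //; lia.
apply: ex_eq (ex_then H1 (ex_then H2 (H3 v r Hv))) _ _ => //.
by rewrite size_rev; lia.
Qed.

(** One polynomial [p] serves as running time and as number of coins; only the first [g a] coins
    reach [f]. The hypothesis [1 < size (encode a)] provides the two spare cells that [machineP]
    asks for. *)
Lemma randomized (f : seq bool * A -> B) (g : A -> nat) :
  FP f -> FP g -> (forall a : A, 1 < size (encode a)) ->
  exists M c, forall (a : A) (r : seq bool),
    let p := c * size (encode a) ^ c + c in
    size r = p -> g a <= p /\ runs_to M p (encode a) r (encode (f (take (g a) r, a))).
Proof.
move=> Hf Hg HA; have [[cf [kf Hcf]]] := Hf.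
have Hg' := FP_pair Hg (FP_id (A := A)); have [[cg [kg Hcg]]] := Hg'.
have Hs := FP_size Hg; have [ks Hks] := FP_size Hf.
pose N (a : A) := size (@encode A EA a).
pose u a := 2 * (g a).+1 + N a.
pose T a := (@mvk A EA + 5) * (N a).+1 + ((N a + 2) ^ kg + ((g a * 12 + 8) +
  ((u a + 2) ^ kf + ((u a + 2) ^ ks * 14 + 3)))).
pose Q a := 1000 * (T a + 1) ^ 2 + g a + (u a + 2) ^ ks.
have [c Hc] : exists c, forall a, Q a <= c * N a ^ c + c.
  have HQ : PB Q.
    have HgN : PB g by apply: PB_le Hs _ => a; rewrite size_encode_nat.
    by rewrite /Q /T /u /N; pb.
  (* Since [N + 2 <= 3 N], the bound [(N + 2) ^ k] is at most [3 ^ k * N ^ k]; one number must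
     dominate both the factor and the exponent. *)
  have [k Hk] := HQ; exists (3 ^ k + k) => a; apply: leq_trans (Hk a) _.
  apply: leq_trans (_ : (3 * N a) ^ k <= _).
    by case: (k) => // k'; rewrite leq_exp2r //; have := HA a; rewrite /N; lia.
  rewrite expnMn; apply: leq_trans (_ : _ <= (3 ^ k + k) * N a ^ (3 ^ k + k)) (leq_addr _ _).
  rewrite leq_mul ?leq_addr // leq_pexp2l ?leq_addl //.
  by have := HA a; rewrite /N; lia.
exists (machine (Then loadc (Then cg (Then coinc (Then cf clearc))))), c => a r p Hr.
have Hp : Q a <= p by exact: Hc.
have Hga : g a <= p by apply: leq_trans Hp; rewrite /Q; lia.
split=> //; set y := f _.
have [n1 H1 N1] := loadP a r; have [n2 H2 N2] := Hcg a [::] r.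
rewrite !cats0 in H2.
have H3 : ex coinc (St (encode (g a, a) ++ [::]) [::] [::] r)
   (St (encode (take (g a) r, a) ++ [::]) [::] [::] (drop (g a) r)) (g a * 12 + 8).
  have E (m : nat) : encode (m, a) ++ [::] = encode m ++ encode a by rewrite cats0.
  have E' (l : seq bool) : encode (l, a) ++ [::] = encode l ++ encode a by rewrite cats0.
  by rewrite E E'; apply: coinP; rewrite Hr.
have [n4 H4 N4] := Hcf (take (g a) r, a) [::] (drop (g a) r).
have Hu : size (encode (take (g a) r, a)) <= u a.
  rewrite size_encode_pair size_encode_bits size_take_min Hr (minn_idPl Hga).
  by rewrite /u /N; lia.
have Hy : size (encode y) <= (u a + 2) ^ ks by exact: leq_trans (Hks _) (leq_pwl _ Hu).
have Hrest : size (encode y) <= size (drop (g a) r).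
  by rewrite size_drop Hr; move: Hp; rewrite /Q; lia.
have H5 := clearcP Hrest; rewrite -/y !cats0 in H4.
rewrite !cats0 in H3.
have HH := ex_then H1 (ex_then H2 (ex_then H3 (ex_then H4 H5))).
apply: (machineP HH); first by rewrite !size_drop Hr; have := HA a; move: Hrest; rewrite size_drop Hr; lia.
have L4 : n4 <= (u a + 2) ^ kf := leq_trans N4 (leq_pwl _ Hu).
set n := n1 + _; have Hn : n <= T a by rewrite /n /T !leq_add // leq_mul2r Hy orbT.
have Hn2 : (n + 1) ^ 2 <= (T a + 1) ^ 2 by rewrite leq_exp2r // leq_add2r.
apply: leq_trans Hp; rewrite /Q -[X in _ <= X]addnA; apply: leq_trans (leq_addr _ _).
by move: Hn2; set P := _ ^ 2; set P' := _ ^ 2; lia.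
Qed.
End Randomized.

(** * Bird's determinant algorithm *)

Section Bird.
Local Open Scope ring_scope.
Variables (R : idomainType) (n : nat) (A : 'M[R]_n).

Let B : 'M[{poly R}]_n := map_mx polyC A.
Definition mask (c : nat) : 'M[{poly R}]_n := diag_mx (\row_j (c <= j)%N%:R).
(** Masking stands in for the principal submatrix on the indices [>= c]: outside that block the
    matrix is the identity, so [bd c] is the determinant of [1 + X A] on the block, with no change
    of dimension. *)
Definition bQ c : 'M[{poly R}]_n := 1%:M + 'X *: (mask c *m B *m mask c).
Definition bd c : {poly R} := \det (bQ c).
(* The determinant of [Q] bordered by row [i] and column [j] of [A]. *)
Definition bH (i j : 'I_n) : {poly R} :=
  B i j * bd i.+1 - 'X * (row i B *m mask i.+1 *m \adj (bQ i.+1) *m mask i.+1 *m col j B) 0 0.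

Lemma mask_mul p c (M : 'M_(p, n)) i j : (M *m mask c) i j = M i j *+ (c <= j)%N.
Proof. by rewrite mul_mx_diag mxE [in X in _ * X]mxE mulr_natr. Qed.
Lemma mul_mask p c (M : 'M_(n, p)) i j : (mask c *m M) i j = M i j *+ (c <= i)%N.
Proof. by rewrite mul_diag_mx mxE [in X in X * _]mxE mulr_natl. Qed.

Lemma bQE c i j : bQ c i j = (i == j)%:R + 'X * (A i j)%:P *+ ((c <= i) && (c <= j))%N.
Proof.
have E : (mask c *m B *m mask c) i j = (A i j)%:P *+ ((c <= i) && (c <= j))%N.
  by rewrite mask_mul mul_mask mxE -mulrnA mulnb.
by rewrite /bQ mxE [X in _ + X]mxE E mxE mulrnAr.
Qed.

Lemma bQ_horner0 c : (bd c)`_0 = 1.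
Proof.
rewrite -horner_coef0 /bd -[LHS]/(horner_eval 0 _) -det_map_mx.
have -> : map_mx (horner_eval 0) (bQ c) = 1%:M; last by rewrite det1.
apply/matrixP => i j; rewrite mxE bQE /horner_eval hornerD !hornerMn hornerM hornerX.
by rewrite mul0r mul0rn addr0 [RHS]mxE -polyC1 hornerC.
Qed.

Lemma bd_neq0 c : bd c != 0.
Proof. by apply: contra_eq_neq (bQ_horner0 c) => ->; rewrite coef0 eq_sym oner_neq0. Qed.

Lemma bd_max c : (n <= c)%N -> bd c = 1.
Proof.
move=> Hc; rewrite /bd (_ : bQ c = 1%:M) ?det1 //; apply/matrixP => i j.
by rewrite bQE mxE (leqNgt c i) (leq_trans (ltn_ord i) Hc) mulr0n addr0.
Qed.

Lemma cofactor_eq_row (M N : 'M[{poly R}]_n) i j :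
  (forall i' j', i' != i -> M i' j' = N i' j') -> cofactor M i j = cofactor N i j.
Proof.
move=> H; rewrite /cofactor; congr (_ * \det _); apply/matrixP => a b.
by rewrite !mxE H // eq_sym neq_lift.
Qed.

(* Expansion along row and column [i] of the matrix masked below [i]. *)
Lemma bd_step (i : 'I_n) : bd i = bd i.+1 + 'X * bH i i.
Proof.
set Q := bQ i.+1; set d := bd i.+1.
pose D := mask i.+1; pose r := row i B *m D; pose s := D *m col i B.
pose e : 'cV[{poly R}]_n := delta_mx i 0; pose e' : 'rV[{poly R}]_n := delta_mx 0 i.
have He (M : 'cV[{poly R}]_n) : e' *m M = (M i 0)%:M.
  by apply/matrixP => a b; rewrite -rowE !mxE !ord1 eqxx mulr1n.
have HQe : Q *m e = e.
  rewrite -colE; apply/matrixP => a b; rewrite mxE bQE !mxE !ord1 eqxx andbT ltnn andbF mulr0n.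
  by rewrite addr0.
have He'Q : e' *m Q = e'.
  rewrite -rowE; apply/matrixP => a b; rewrite mxE bQE !mxE !ord1 eqxx /= ltnn mulr0n.
  by rewrite addr0 eq_sym.
have Hes : e' *m s = 0.
  by apply/matrixP => a b; rewrite He mxE /s mul_mask ltnn mulr0n mul0rn mxE.
have HadjQ : Q *m \adj Q = d%:M by rewrite mul_mx_adj.
have HQadj : \adj Q *m Q = d%:M by rewrite mul_adj_mx.
(* [M1] is [bQ i] with row [i] replaced by the unit row. The cofactors along row [i] are therefore
   the same, while the determinant is already [d]. *)
pose M1 := Q + 'X *: (s *m e').
have Es a : s a 0 = (A a i)%:P *+ (i < a)%N by rewrite mul_mask !mxE.
have M1E0 a b : M1 a b = Q a b + 'X * (s a 0 * (b == i)%:R).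
  by rewrite [LHS]mxE [X in _ + X]mxE [X in 'X * X]mxE big_ord1 [e' _ _]mxE eqxx.
have HM1 (v : 'cV_n) : M1 *m v = Q *m v + 'X *: (s *m (e' *m v)).
  by rewrite /M1 mulmxDl -scalemxAl mulmxA.
have M1E a b : M1 a b = if a == i then (b == i)%:R else bQ i a b.
  rewrite M1E0 /Q !bQE Es; case: (a =P i) => [->|/val_eqP Ha].
    by rewrite ltnn /= !mulr0n mul0r mulr0 !addr0 eq_sym.
  rewrite [(i <= a)%N]leq_eqVlt [(i == a :> nat)]eq_sym (negbTE Ha) /=.
  case: (b =P i) => [->|/val_eqP Hb].
    by rewrite ltnn leqnn andbF andbT mulr0n addr0 mulr1 mulrnAr.
  by rewrite mulr0 mulr0 addr0 [(i <= b)%N]leq_eqVlt [(i == b :> nat)]eq_sym (negbTE Hb).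
have detM1 : \det M1 = d.
  rewrite (expand_det_row _ i) (bigD1 i) //= big1 ?addr0; last first.
    by move=> j Hj; rewrite M1E eqxx (negbTE Hj) mul0r.
  rewrite M1E !eqxx mul1r /d /bd (expand_det_row _ i) (bigD1 i) //= big1 ?addr0; last first.
    by move=> j Hj; rewrite bQE eq_sym (negbTE Hj) ltnn mulr0n addr0 mul0r.
  rewrite bQE eqxx ltnn mulr0n addr0 mul1r /cofactor; congr (_ * \det _).
  apply/matrixP => a b; rewrite [LHS]mxE [RHS]mxE [LHS]mxE [RHS]mxE M1E0.
  by rewrite eq_sym (negbTE (neq_lift _ _)) mulr0 mulr0 addr0.
(* Both sides solve [M1 v = d e]; multiplying by the adjugate and cancelling [d], whose constant
   term is 1, identifies them. *)
have adjM1 : \adj M1 *m e = d *: e - 'X *: (\adj Q *m s).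
  have E1 : M1 *m (\adj M1 *m e) = d *: e.
    by rewrite mulmxA mul_mx_adj detM1 mul_scalar_mx.
  have E2 : M1 *m (d *: e - 'X *: (\adj Q *m s)) = d *: e.
    rewrite mulmxBr -!scalemxAr !HM1 HQe.
    have -> : e' *m e = 1%:M by rewrite He mxE !eqxx.
    have -> : e' *m (\adj Q *m s) = 0.
      rewrite -{1}He'Q -mulmxA [Q *m _]mulmxA HadjQ mul_scalar_mx -scalemxAr Hes scaler0 //.
    rewrite mulmxA HadjQ mul_scalar_mx mulmx1 mulmx0 scaler0 addr0 scalerDr.
    by rewrite !scalerA mulrC addrK.
  have : \adj M1 *m (M1 *m (\adj M1 *m e)) = \adj M1 *m (M1 *m (d *: e - 'X *: (\adj Q *m s))).
    by rewrite E1 E2.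
  rewrite mulmxA [in RHS]mulmxA !mul_adj_mx detM1 !mul_scalar_mx => /matrixP H.
  apply/matrixP => a b; apply: (mulfI (bd_neq0 i.+1)).
  by have := H a b; rewrite [LHS]mxE [RHS]mxE.
rewrite {1}/bd (expand_det_row _ i).
have -> : \sum_j bQ i i j * cofactor (bQ i) i j =
    \sum_j ((j == i)%:R + 'X * (r 0 j + B i i * (j == i)%:R)) * cofactor M1 i j.
  apply: eq_bigr => j _; rewrite (@cofactor_eq_row (bQ i) M1 i j); last first.
    by move=> a b Ha; rewrite M1E (negbTE Ha).
  congr (_ * _); rewrite bQE leqnn mask_mul !mxE eq_sym /=; congr (_ + _).
  case: (j =P i) => [->|Hj]; first by rewrite ltnn leqnn mulr0n add0r mulr1.
  rewrite mulr0 addr0 mulrnAr; congr (_ *+ _).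
  by rewrite ltn_neqAle eq_sym (_ : (j == i :> nat) = false) //; apply/eqP => E; apply: Hj; apply: val_inj.
under eq_bigr do rewrite mulrDl; rewrite big_split /=; congr (_ + _).
  rewrite -detM1 (expand_det_row _ i); apply: eq_bigr => j _.
  by rewrite M1E eqxx.
under eq_bigr do rewrite -mulrA; rewrite -big_distrr /=; congr (_ * _).
have -> : \sum_j (r 0 j + B i i * (j == i)%:R) * cofactor M1 i j =
    ((r + B i i *: e') *m (\adj M1 *m e)) 0 0.
  rewrite [RHS]mxE; apply: eq_bigr => j _; rewrite -colE [col _ _ _ _]mxE [\adj _ _ _]mxE.
  by congr (_ * _); rewrite [RHS]mxE [X in _ = _ + X]mxE [e' _ _]mxE eqxx.
rewrite adjM1 mulmxBr !mulmxDl -!scalemxAr -!scalemxAl.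
have -> : r *m e = 0.
  by apply/matrixP => a b; rewrite -colE mxE [RHS]mxE /r mask_mul ltnn mulr0n.
have -> : e' *m e = 1%:M by rewrite He mxE !eqxx.
have -> : e' *m (\adj Q *m s) = 0.
  by rewrite -{1}He'Q -mulmxA [Q *m _]mulmxA HadjQ mul_scalar_mx -scalemxAr Hes scaler0.
rewrite !scaler0 add0r addr0 /bH -/d -/D -/Q /r /s !mulmxA !mxE eqxx mulr1n mulr1 mulrC.
by [].
Qed.

(** From [adj Q * Q = d] with [Q = 1 + X D B D] one gets [r adj Q = d r - X (r adj Q D B D)]. Its
    entries at the indices above [i] are the values [bH i m]. *)
Lemma bH_rec (i j : 'I_n) :
  bH i j = B i j * bd i.+1 - 'X * \sum_(m : 'I_n | (i < m)%N) bH i m * B m j.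
Proof.
set Q := bQ i.+1; set d := bd i.+1; pose D := mask i.+1; pose r := row i B *m D.
have HQadj : \adj Q *m Q = d%:M by rewrite mul_adj_mx.
have Hrow : r *m \adj Q = d *: r - 'X *: (r *m \adj Q *m D *m B *m D).
  have : r *m (\adj Q *m Q) = d *: r by rewrite HQadj mul_mx_scalar.
  rewrite {2}/Q /bQ mulmxDr mulmx1 mulmxDr -!scalemxAr -/D !mulmxA => <-.
  by rewrite addrK.
rewrite {1}/bH -/d -/Q -/D -/r; congr (_ - _ * _).
rewrite Hrow mxE [RHS]big_mkcond /=; apply: eq_bigr => m _.
rewrite mask_mul [col j B m 0]mxE.
case: ifP => Him; last by rewrite mulr0n mul0r.
rewrite mulr1n; congr (_ * _).
rewrite [LHS]mxE [X in X + _]mxE [X in _ + X]mxE [X in - X]mxE /bH -/d -/Q -/D -/r.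
rewrite /r [X in d * X]mask_mul Him mulr1n mxE mulrC; congr (_ - _ * _).
rewrite mask_mul Him mulr1n -/r.
rewrite [RHS]mxE [LHS]mxE; apply: eq_bigr => l _; by rewrite [col m B l 0]mxE.
Qed.

Lemma bQ_coef1 c i j : (bQ c i j)`_1 = A i j *+ ((c <= i) && (c <= j))%N.
Proof.
by rewrite bQE coefD !coefMn coef1 coefXM coefC /= mul0rn add0r.
Qed.

Lemma size_bQ c i j : (size (bQ c i j) <= 2)%N.
Proof.
apply/leq_sizeP => l Hl; rewrite bQE coefD !coefMn coef1 coefXM coefC.
by case: l Hl => [|[|l]] //= _; rewrite !mul0rn addr0.
Qed.

Lemma coef_prod_top (m : nat) (F : 'I_m -> {poly R}) : (forall i, (size (F i) <= 2)%N) ->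
  (\prod_i F i)`_m = \prod_i (F i)`_1.
Proof.
move=> HF.
suff [] : (\prod_i F i)`_m = \prod_i (F i)`_1 /\ (size (\prod_i F i)%R <= m.+1)%N by [].
elim: m F HF => [|m IH] F HF; first by rewrite !big_ord0 coef1 size_poly1.
have [E Hs] := IH (fun i => F (widen_ord (leqnSn m) i)) (fun i => HF _).
rewrite !big_ord_recr /=; set p := \prod_(i < m) _ in E Hs *; set q := F ord_max.
have Hq : q = (q`_0)%:P + (q`_1)%:P * 'X.
  apply/polyP => l; rewrite coefD coefMX !coefC.
  case: l => [|[|l]] /=; rewrite ?addr0 ?add0r //; have /leq_sizeP -> := HF ord_max => //.
split.
  rewrite Hq mulrDr coefD coefMC mulrA coefMX /= coefMC coefD coefMX !coefC /= add0r.
  have /leq_sizeP -> := Hs => //; rewrite mul0r add0r E.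
  by [].
apply: leq_trans (size_polyMleq _ _) _; have := HF ord_max; rewrite -/q.
by move: Hs; case: (size p) => [|a]; case: (size q) => [|b] //=; lia.
Qed.

Lemma coef_det_top (M : 'M[{poly R}]_n) : (forall i j, (size (M i j) <= 2)%N) ->
  (\det M)`_n = \det (map_mx (fun p : {poly R} => p`_1) M).
Proof.
move=> HM.
have Hp (t : {perm 'I_n}) : (\prod_i M i (t i))`_n = \prod_i (map_mx (fun p : {poly R} => p`_1) M) i (t i).
  by rewrite coef_prod_top //; apply: eq_bigr => i _; rewrite mxE.
rewrite /determinant coef_sum; apply: eq_bigr => s _.
by rewrite !mulr_sign -Hp; case: ifP; rewrite ?coefN.
Qed.

Lemma bd_top c : (bd c)`_n = \det (\matrix_(i, j) (A i j *+ ((c <= i) && (c <= j))%N)).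
Proof.
rewrite /bd coef_det_top; last by move=> i j; exact: size_bQ.
by congr (\det _); apply/matrixP => i j; rewrite [LHS]mxE [RHS]mxE bQ_coef1.
Qed.

(** Telescoping of [bd_step] from the top index, where [bd] is 1. *)
Lemma bd_coef c l : (bd c)`_l.+1 = \sum_(m : 'I_n | (c <= m)%N) (bH m m)`_l.
Proof.
have [k Hk] : exists k, n = (c + k)%N \/ (n <= c)%N.
  by exists (n - c)%N; have [/ltnW|] := ltnP c n; [left; rewrite subnKC|right].
elim: k c Hk => [|k IH] c Hk.
  have Hc : (n <= c)%N by case: Hk; lia.
  rewrite bd_max // coef1 big_pred0 // => m.
  by apply/negbTE; rewrite -ltnNge (leq_trans (ltn_ord m)).
case: (ltnP c n) => Hc; last first.
  rewrite bd_max // coef1 big_pred0 // => m.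
  by apply/negbTE; rewrite -ltnNge (leq_trans (ltn_ord m)).
rewrite (bd_step (Ordinal Hc)) /= coefD coefXM /= IH; last by lia.
rewrite [RHS](bigD1 (Ordinal Hc)) //= addrC; congr (_ + _).
apply: eq_bigl => m; rewrite ltn_neqAle andbC; congr (_ && _).
by rewrite eq_sym.
Qed.

Lemma bH_coef0 i j : (bH i j)`_0 = A i j.
Proof.
by rewrite /bH coefB coefXM subr0 mxE coefCM bQ_horner0 mulr1.
Qed.

(** This is Bird's recursion up to sign: the sum over the later diagonal entries is, up to sign, the
    diagonal entry that [mu] installs. *)
Lemma bH_coefS l i j : (bH i j)`_l.+1 =
  A i j * (\sum_(m : 'I_n | (i < m)%N) (bH m m)`_l) - \sum_(m : 'I_n | (i < m)%N) (bH i m)`_l * A m j.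
Proof.
rewrite bH_rec coefB coefXM mxE coefCM bd_coef /=; congr (_ - _).
by rewrite coef_sum; apply: eq_bigr => m _; rewrite mxE coefMC.
Qed.
End Bird.

(** The top coefficient of [bd 0] is [det A]. By [bd_coef] it is the wanted entry plus the top
    coefficient of [bd 1], which is the determinant of a matrix with a zero row. *)
Lemma bH_det (R : idomainType) n (A : 'M[R]_n.+1) : ((bH A ord0 ord0)`_n = \det A)%R.
Proof.
have := bd_coef A 0 n; rewrite (bigD1 ord0) //=.
have -> : (\sum_(m < n.+1 | m != ord0) (bH A m m)`_n = 0)%R.
  transitivity ((bd A 1)`_n.+1)%R.
    by rewrite bd_coef; apply: eq_bigl => m; rewrite lt0n.
  rewrite bd_top (expand_det_row _ ord0) big1 // => j _.
  by rewrite mxE /= mulr0n mul0r.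
rewrite addr0 => <-; rewrite bd_top; congr (\det _)%R; apply/matrixP => i j.
by rewrite mxE.
Qed.

(** * Bit lists as polynomials over F_2 *)

Section F2.
Local Open Scope ring_scope.

Definition P2 (s : seq bool) : {poly 'F_2} := Poly [seq (nat_of_bool b)%:R | b <- s].

Lemma coef_P2 s i : (P2 s)`_i = (nat_of_bool (nth false s i))%:R.
Proof.
rewrite coef_Poly; case: (ltnP i (size s)) => Hi; first by rewrite (nth_map false).
by rewrite !nth_default ?size_map.
Qed.

Lemma P2_xorp s t : P2 (xorp s t) = P2 s + P2 t.
Proof.
apply/polyP => i; rewrite coefD !coef_P2 /xorp.
case: (ltnP i (maxn (size s) (size t))) => Hi.
  by rewrite nth_mkseq //; case: (nth false s i); case: (nth false t i); apply/val_inj.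
rewrite nth_default ?size_mkseq // !nth_default ?addr0 //.
  by apply: leq_trans Hi; rewrite leq_maxr.
by apply: leq_trans Hi; rewrite leq_maxl.
Qed.

Lemma P2_nil : P2 [::] = 0.
Proof. exact: polyC0. Qed.

Lemma P2_xsum l : P2 (xsum l) = \sum_(s <- l) P2 s.
Proof.
rewrite /xsum -[RHS]add0r -{1}P2_nil; elim: l [::] => [|s l IH] t /=.
  by rewrite big_nil addr0.
by rewrite IH P2_xorp big_cons addrA.
Qed.

Lemma P2_shift e s : P2 (nseq e false ++ s) = 'X^e * P2 s.
Proof.
apply/polyP => i; rewrite coefXnM !coef_P2 nth_cat size_nseq nth_nseq.
by case: ifP => // ->.
Qed.

Definition xpow (es : seq nat) : {poly 'F_2} := \sum_(e <- es) 'X^e.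

Lemma P2_mulm es s : P2 (mulm es s) = xpow es * P2 s.
Proof.
rewrite /mulm P2_xsum big_map mulr_suml; apply: eq_bigr => e _; exact: P2_shift.
Qed.

Lemma opp_F2 (p : {poly 'F_2}) : - p = p.
Proof.
apply/polyP => i; rewrite coefN; case: (p`_i) => -[|[|//]] H; exact/val_inj.
Qed.

Variables (m : nat) (E : seq (seq (seq nat))).
Definition xmat : 'M[{poly 'F_2}]_m := \matrix_(i, j) xpow (at_ E i j).

Lemma bird_coef l (i j : 'I_m) :
  P2 (at_ (iter l (bstep E m) (tabulate m (fun i j => mulm (at_ E i j) [:: true]))) i j)
  = (bH xmat i j)`_l.
Proof.
elim: l i j => [|l IH] i j.
  rewrite at_tabulate !ltn_ord /= P2_mulm bH_coef0 mxE (_ : P2 [:: true] = 1) ?mulr1 //.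
  by apply/polyP => -[|[|k]]; rewrite coef_P2 coef1.
rewrite iterS; set X := iter l _ _ in IH *; rewrite /bstep at_tabulate !ltn_ord /= P2_xsum big_map.
have Ei : iota 0 m = index_iota 0 m by rewrite /index_iota subn0.
rewrite {1}Ei big_mkord bH_coefS opp_F2.
rewrite (bigID (fun k : 'I_m => i < k)%N) /= addrC; congr (_ + _); last first.
  apply: eq_bigr => k Hk; rewrite P2_mulm /mu Hk IH mulrC mxE //.
rewrite (bigD1 i) ?ltnn //= big1 ?addr0 => [|k /andP [Hk Hki]]; last first.
  rewrite P2_mulm /mu (negbTE Hk) ifF ?P2_nil ?mulr0 //.
  by apply/negbTE; rewrite eq_sym.
rewrite P2_mulm /mu ltnn eqxx mxE P2_xsum big_map big_filter; congr (_ * _).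
rewrite Ei big_mkord; apply: eq_bigr => k _; exact: IH.
Qed.
End F2.

(** * Reading a permutation off the parities of coefficients *)

Section Parity.
Local Open Scope ring_scope.

Definition allowed m (E : seq (seq (seq nat))) (s : {perm 'I_m}) :=
  [forall i : 'I_m, at_ E i (s i) != [::]].
Definition psum m (E : seq (seq (seq nat))) (s : {perm 'I_m}) : nat :=
  (\sum_(i : 'I_m) head 0 (at_ E i (s i)))%N.

(** In characteristic 2 the determinant is the permanent, and with entries that are monomials or 0
    every allowed permutation contributes exactly one monomial. *)
Lemma bdet_parity n (E : seq (seq (seq nat))) W :
  (forall i j : 'I_n.+1, (size (at_ E i j) <= 1)%N) ->
  (nat_of_bool (nth false (bdet E n.+1) W))%:R =
  #|[set s : {perm 'I_n.+1} | allowed E s && (psum E s == W)]|%:R :> 'F_2.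
Proof.
move=> Em.
rewrite -coef_P2 /bdet /= (bird_coef E n ord0 ord0) bH_det /determinant coef_sum.
rewrite -sum1_card natr_sum [RHS]big_mkcond /=; apply: eq_bigr => s _.
rewrite inE mulr_sign opp_F2 if_same.
have -> : \prod_i xmat n.+1 E i (s i) = if allowed E s then 'X^(psum E s) else 0.
  case: ifP => [/forallP Ha|/negbT]; last first.
    rewrite negb_forall => /existsP [i]; rewrite negbK => /eqP Hi.
    by rewrite (bigD1 i) //= mxE Hi /xpow big_nil mul0r.
  rewrite /psum expr_sum; apply: eq_bigr => i _; rewrite mxE.
  have := Em i (s i); have := Ha i; case: (at_ E i (s i)) => [|e [|//]] // _ _.
  by rewrite /xpow big_seq1.
case: (allowed E s); last by rewrite coef0.
by rewrite coefXn eq_sym; case: (_ == _).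
Qed.
End Parity.

Section SuccW.
Variables (n : nat) (E : seq (seq (seq nat))) (W : nat).
Hypothesis Em : forall i j : 'I_n.+1, size (at_ E i j) <= 1.

Lemma at_del (u v i j : 'I_n.+1) :
  at_ (del E n.+1 u v) i j = if (i == u) && (j == v) then [::] else at_ E i j.
Proof. by rewrite /del at_tabulate !ltn_ord. Qed.

Lemma allowed_del (u v : 'I_n.+1) (s : {perm 'I_n.+1}) :
  allowed (del E n.+1 u v) s = allowed E s && (s u != v).
Proof.
apply/forallP/andP => [H|[/forallP H Hu] i]; last first.
  rewrite at_del; case: (i =P u) => [->|_] /=; last exact: H.
  by rewrite (negbTE Hu); exact: H.
split; last by have := H u; rewrite at_del eqxx /=; case: (s u == v).
by apply/forallP => i; have := H i; rewrite at_del; case: ifP.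
Qed.

Lemma psum_del (u v : 'I_n.+1) (s : {perm 'I_n.+1}) :
  s u != v -> psum (del E n.+1 u v) s = psum E s.
Proof.
move=> Hu; apply: eq_bigr => i _; rewrite at_del.
by case: (i =P u) => //= ->; rewrite (negbTE Hu).
Qed.

Lemma find_iota (p : pred nat) m k : k < m -> (forall v, v < m -> p v = (v == k)) ->
  find p (iota 0 m) = k.
Proof.
move=> Hk Hp; rewrite (@eq_in_find _ p (pred1 k)).
  have := @index_uniq _ 0 k (iota 0 m); rewrite nth_iota // size_iota iota_uniq.
  by apply.
by move=> v; rewrite mem_iota => /= /Hp.
Qed.

Lemma succW_perm (s : {perm 'I_n.+1}) :
  allowed E s -> psum E s = W -> (forall t, allowed E t -> psum E t = W -> t = s) ->
  forall u : 'I_n.+1, succW E n.+1 W u = s u.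
Proof.
move=> Ha Hs Hu u; apply: find_iota => // v Hv.
have natF2 (b : bool) (k : nat) : ((nat_of_bool b)%:R = k%:R :> 'F_2)%R -> k <= 1 -> b = (k == 1).
  by case: b => /(congr1 val); case: k => [|[|]].
have E0 : [set t : {perm 'I_n.+1} | allowed E t && (psum E t == W)] = [set s].
  apply/setP => t; rewrite !inE; apply/andP/eqP => [[H1 /eqP H2]|->]; first exact: Hu.
  by rewrite Ha Hs.
have -> : nth false (bdet E n.+1) W = true.
  by rewrite (natF2 _ _ (bdet_parity W Em)) E0 cards1.
have Ed (i j : 'I_n.+1) : size (at_ (del E n.+1 u (Ordinal Hv)) i j) <= 1.
  by rewrite at_del; case: ifP.
have Es : [set t : {perm 'I_n.+1} | allowed (del E n.+1 u (Ordinal Hv)) t &&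
             (psum (del E n.+1 u (Ordinal Hv)) t == W)] = if v == s u then set0 else [set s].
  have E1 : (v == s u :> nat) = (s u == Ordinal Hv) by rewrite eq_sym.
  apply/setP => t; rewrite E1 inE allowed_del.
  case: (boolP (t u == Ordinal Hv)) => [Ht|Ht].
    rewrite andbF; case: ifP => H; rewrite inE //.
    by apply/esym/negbTE; apply: contraFN H => /eqP <-.
  rewrite andbT psum_del //; case: ifP => H; rewrite inE.
    apply/negbTE; apply: contra Ht => /andP [H1 /eqP H2].
    by rewrite (Hu _ H1 H2).
  by apply/andP/eqP => [[H1 /eqP H2]|->]; [exact: Hu|rewrite Ha Hs].
have -> : nth false (bdet (del E n.+1 u v) n.+1) W = (#|if v == s u then set0 else [set s]| == 1).
  rewrite -Es; apply: natF2 (bdet_parity W Ed) _.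
  by rewrite Es; case: ifP; rewrite ?cards0 ?cards1.
by case: ifP; rewrite ?cards0 ?cards1.
Qed.
End SuccW.

(** * Isolation *)

Section Isolation.
Variables (m : nat) (F : pred {perm 'I_m}).
Implicit Types (r : 'I_m -> 'I_m -> nat) (s : {perm 'I_m}).

Definition pwt r s := \sum_a r a (s a).
Definition minw r s := F s && [forall t, F t ==> (pwt r s <= pwt r t)].
(** The bad event of the isolation lemma: among the members of least weight some use the edge
    [(a0, b0)] and some avoid it. *)
Definition tie r a0 b0 := [exists s, minw r s && (s a0 == b0)] && [exists s, minw r s && (s a0 != b0)].

Lemma minw_le r s t : minw r s -> F t -> pwt r s <= pwt r t.
Proof. by move=> /andP [_ /forallP /(_ t) /implyP]; exact. Qed.

(** Two distinct minimizers differ at some [a], and then the edge that one of them uses at [a] is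
    tied. *)
Lemma tie_or_unique r s : F s ->
  (exists a b, tie r a b) \/
  exists2 s0, F s0 & forall t, F t -> pwt r t = pwt r s0 -> t = s0.
Proof.
move=> Fs; case: (arg_minnP (pwt r) Fs) => s0 Fs0 Hmin.
have M0 : minw r s0 by rewrite /minw Fs0; apply/forallP => t; apply/implyP => /Hmin.
have [H|H] := boolP [forall t, F t ==> (pwt r t == pwt r s0) ==> (t == s0)].
  right; exists s0 => // t Ft Et; have /forallP /(_ t) := H.
  by rewrite Ft Et eqxx => /eqP.
left; move: H; rewrite negb_forall => /existsP [t]; rewrite !negb_imply => /and3P [Ft /eqP Et Hne].
have Mt : minw r t.
  by rewrite /minw Ft; apply/forallP => v; apply/implyP => /Hmin; rewrite Et.
have /existsP [a Ha] : [exists a, s0 a != t a].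
  rewrite -negb_forall; apply: contra Hne => /forallP H.
  by apply/eqP/permP => a; apply/esym/eqP/H.
exists a, (s0 a); apply/andP; split; apply/existsP; first by exists s0; rewrite M0 eqxx.
by exists t; rewrite Mt eq_sym.
Qed.

Lemma pwt_off r r' a0 b0 s : (forall a b, (a != a0) || (b != b0) -> r a b = r' a b) ->
  s a0 != b0 -> pwt r s = pwt r' s.
Proof.
by move=> H Hs; apply: eq_bigr => a _; apply: H; case: eqP => // ->.
Qed.

Lemma pwt_on r r' a0 b0 s : (forall a b, (a != a0) || (b != b0) -> r a b = r' a b) ->
  s a0 = b0 -> pwt r s + r' a0 b0 = pwt r' s + r a0 b0.
Proof.
move=> H Hs.
have Ew (q : 'I_m -> 'I_m -> nat) : pwt q s = q a0 b0 + \sum_(a | a != a0) q a (s a).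
  by rewrite /pwt (bigD1 a0) //= Hs.
have Er : \sum_(a | a != a0) r a (s a) = \sum_(a | a != a0) r' a (s a).
  by apply: eq_bigr => a Ha; apply: H; rewrite Ha.
by rewrite (Ew r) (Ew r') Er; lia.
Qed.

(** At a tie the least weight with the edge equals the least weight without it. The latter does not
    depend on [r a0 b0] while the former is shifted by it, so the other weights leave a single value
    for [r a0 b0]. *)
Lemma tie_determined r r' a0 b0 : (forall a b, (a != a0) || (b != b0) -> r a b = r' a b) ->
  tie r a0 b0 -> tie r' a0 b0 -> r a0 b0 = r' a0 b0.
Proof.
move=> H /andP [/existsP [s1 /andP [M1 /eqP E1]] /existsP [s2 /andP [M2 E2]]].
move=> /andP [/existsP [t1 /andP [N1 /eqP D1]] /existsP [t2 /andP [N2 D2]]].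
have F1 : F s1 by case/andP: M1. have F2 : F s2 by case/andP: M2.
have G1 : F t1 by case/andP: N1. have G2 : F t2 by case/andP: N2.
have := pwt_on H E1; have := pwt_on H D1; have := pwt_off H E2; have := pwt_off H D2.
have := minw_le M1 G1; have := minw_le M1 F2; have := minw_le M2 F1; have := minw_le M2 G2.
have := minw_le N1 F1; have := minw_le N1 G2; have := minw_le N2 G1; have := minw_le N2 F2.
lia.
Qed.
End Isolation.

(** * Independent blocks of coins *)

Section Coins.
Variables (p b : nat).

Definition chunk e (r : seq bool) := take b (drop (e * b) r).
Definition overwrite e (r : p.-tuple bool) (v : b.-tuple bool) : seq bool :=
  take (e * b) r ++ v ++ drop (e.+1 * b) r.

Lemma size_overwrite e r v : e.+1 * b <= p -> size (overwrite e r v) = p.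
Proof. by move=> He; rewrite !size_cat size_take_min size_drop !size_tuple; lia. Qed.

Lemma chunk_overwrite e r v : e.+1 * b <= p -> chunk e (overwrite e r v) = v.
Proof.
move=> He; rewrite /chunk /overwrite drop_size_cat; last by rewrite size_take_min size_tuple; lia.
by rewrite take_size_cat // size_tuple.
Qed.

Lemma chunk_overwrite_neq e e' r v : e.+1 * b <= p -> e'.+1 * b <= p -> e != e' ->
  chunk e' (overwrite e r v) = chunk e' r.
Proof.
move=> He He' Hne; apply: (@eq_from_nth _ false).
  by rewrite !size_take_min !size_drop size_overwrite ?size_tuple.
move=> i; rewrite size_take_min size_drop size_overwrite // => Hi.
have Hib : i < b by lia.
rewrite !nth_take // !nth_drop /overwrite !nth_cat size_take_min !size_tuple.
have [Hlt|Hge] := ltnP e' e.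
  have H1 : e' * b + i < e * b by nia.
  by rewrite ifT ?nth_take //; lia.
have H1 : e.+1 * b <= e' * b + i by have := leq_mul2r b e.+1 e'; nia.
rewrite ifF; last by lia.
rewrite ifF; last by lia.
by rewrite nth_drop; congr nth; lia.
Qed.

(** Replacing block [e] of a bad string by an arbitrary block is injective on pairs, because the new
    block is visible and the remaining coins determine the old one. Hence a bad event has
    probability at most [2 ^ -b]. *)
Lemma chunk_determined_card (Bad : {set p.-tuple bool}) e : e.+1 * b <= p ->
  (forall r r', r \in Bad -> r' \in Bad ->
     (forall e', e'.+1 * b <= p -> e' != e -> chunk e' r = chunk e' r') ->
     take (e * b) r = take (e * b) r' -> drop (e.+1 * b) r = drop (e.+1 * b) r' ->
     chunk e r = chunk e r') ->
  #|Bad| * 2 ^ b <= 2 ^ p.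
Proof.
move=> He HB.
have Hsz r v : size (overwrite e r v) == p by rewrite size_overwrite.
pose g (z : p.-tuple bool * b.-tuple bool) : p.-tuple bool := Tuple (Hsz z.1 z.2).
have Hg : {in setX Bad setT &, injective g}.
  move=> [r v] [r' v']; rewrite !inE /= !andbT => Hr Hr' /(congr1 val) /= E.
  have Ev : v = v' by apply: val_inj; rewrite /= -(chunk_overwrite r v He) E chunk_overwrite.
  rewrite -Ev in E *; congr pair; have E0 := E; move: E; rewrite /overwrite.
  have S1 : size (take (e * b) r) = size (take (e * b) r').
    by rewrite !size_take_min !size_tuple.
  move=> /eqP; rewrite eqseq_cat // => /andP [/eqP Et]; rewrite eqseq_cat // eqxx /= => /eqP Ed.
  have Ec : chunk e r = chunk e r'.
    apply: HB => // e' He' Hne.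
    by rewrite -(chunk_overwrite_neq r v He He') 1?eq_sym // E0 chunk_overwrite_neq 1?eq_sym.
  apply: val_inj => /=.
  rewrite -(cat_take_drop (e * b) r) -(cat_take_drop (e * b) r') Et.
  rewrite -(cat_take_drop b (drop (e * b) r)) -(cat_take_drop b (drop (e * b) r')).
  by rewrite -/(chunk e r) -/(chunk e r') Ec !drop_drop -mulSn Ed.
have := max_card (mem (g @: setX Bad setT)); rewrite card_in_imset // cardsX cardsT !card_tuple.
by rewrite card_bool.
Qed.
End Coins.

(** * Balanced choices *)

Section Balance.
Local Open Scope ring_scope.
Variable k : nat.

(* Moving along a kernel vector of [D] until a coordinate reaches 1 or -1. *)
Lemma move_to_face (D : 'M[rat]_(k.+1, k)) (x : 'rV[rat]_k.+1) : (forall j, -1 <= x 0 j <= 1) ->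
  exists2 x' : 'rV[rat]_k.+1, x' *m D = x *m D /\ (forall j, -1 <= x' 0 j <= 1) &
    exists r, (x' 0 r == 1) || (x' 0 r == -1).
Proof.
move=> Hx; have Hker : kermx D != 0.
  rewrite -mxrank_eq0 mxrank_ker -lt0n subn_gt0; exact: leq_ltn_trans (rank_leq_col _) _.
pose y := nz_row (kermx D); have Hy : y != 0 by rewrite nz_row_eq0.
have HyD : y *m D = 0 by apply/sub_kermxP; exact: nz_row_sub.
have [j0 Hj0] : exists j, y 0 j != 0.
  apply/existsP; apply: contraNT Hy; rewrite negb_exists => /forallP H.
  by apply/eqP/rowP => j; have := H j; rewrite negbK mxE => /eqP.
(* The time at which coordinate [j], moving along [y], reaches the face in front of it; the earliest
   of these keeps all coordinates in range. *)
pose t j := ((if 0 < y 0 j then 1 else -1) - x 0 j) / y 0 j.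
have [r Hr Hmin] := @arg_minP _ rat _ j0 (fun j => y 0 j != 0) t Hj0.
have Ht j : y 0 j != 0 -> 0 <= t j.
  move=> Hj; rewrite /t; case: ltP => H.
    by apply: divr_ge0 (ltW H); have := Hx j; lra.
  by rewrite -mulrNN -invrN; apply: divr_ge0; have := Hx j; lra.
have Hty j : y 0 j != 0 -> t j * y 0 j = (if 0 < y 0 j then 1 else -1) - x 0 j.
  by move=> Hj; rewrite /t mulfVK.
exists (x + t r *: y).
  split; first by rewrite mulmxDl -scalemxAl HyD scaler0 addr0.
  move=> j; rewrite !mxE; have [->|Hj] := eqVneq (y 0 j) 0; first by rewrite mulr0 addr0.
  have H1 := Hmin j Hj; have H2 := Ht r Hr; have := Hty j Hj; have := Hx j.
  case: ltP => H3 H4 H5.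
    have H6 : t r * y 0 j <= t j * y 0 j by rewrite ler_wpM2r // ltW.
    have H7 : 0 <= t r * y 0 j by rewrite mulr_ge0 // ltW.
    by lra.
  have H6 : t j * y 0 j <= t r * y 0 j by rewrite ler_wnM2r.
  have H7 : t r * y 0 j <= 0 by rewrite mulr_ge0_le0.
  by lra.
by exists r; rewrite !mxE Hty // addrC subrK; case: ifP; rewrite eqxx ?orbT.
Qed.

Definition signs (s : seq rat) := all (fun e => (e == 1) || (e == -1)) s.

(** At any time only the [k] rows of [D] carry fractional coefficients [x]. A new vector, entered
    with coefficient 0, makes [k + 1] vectors in dimension [k], and one of them can be frozen at 1
    or -1 without changing the sum. Rounding the last [k] coefficients costs at most [2 * Q i]
    each. *)
Lemma balance (Q : 'I_k -> rat) (ds : seq 'rV[rat]_k) :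
  all (fun d : 'rV[rat]_k => [forall i, `|d 0 i| <= Q i]) ds ->
  forall (D : 'M[rat]_k) (x : 'rV[rat]_k),
  (forall s i, `|D s i| <= Q i) -> (forall s, -1 <= x 0 s <= 1) ->
  exists es, [/\ signs es, size es = size ds & exists2 dl : 'rV[rat]_k,
    forall s, (dl 0 s == 1) || (dl 0 s == -1) &
    forall i, `|\sum_(p <- zip es ds) p.1 * p.2 0 i + (dl *m D) 0 i - (x *m D) 0 i| <= (2 * k)%:R * Q i].
Proof.
elim: ds => [|d ds IH] /= Hds D x HD Hx.
  exists [::]; split=> //; exists (const_mx 1) => [s|i]; first by rewrite mxE eqxx.
  rewrite big_nil add0r -[X in `|X|]/((const_mx 1 *m D) 0 i + - (x *m D) 0 i).
  rewrite !mxE -sumrB; apply: le_trans (ler_norm_sum _ _ _) _.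
  apply: le_trans (_ : \sum_(s < k) 2 * Q i <= _).
    apply: ler_sum => s _; rewrite -mulrBl normrM mxE; apply: ler_pM => //.
    by have := Hx s; rewrite ler_norml; lra.
  by rewrite sumr_const card_ord -mulrnAl -mulrnA natrM mulr_natr -mulrnA mulnC.
have {Hds} /andP [/forallP Hd Hds] := Hds.
pose D1 : 'M[rat]_(1 + k, k) := col_mx d D.
pose x1 : 'rV[rat]_(1 + k) := row_mx 0 x.
have Hx1 j : -1 <= x1 0 j <= 1.
  by rewrite mxE; case: (split j) => s //; rewrite mxE; lra.
have [x' [Ex' Hx'] [r Hr]] := move_to_face D1 Hx1.
pose D' := row' r (D1 : 'M_(k.+1, k)); pose x'' := col' r (x' : 'rV_k.+1).
have HD1 s i : `|D1 s i| <= Q i.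
  by rewrite mxE; case: (split s) => s' //; rewrite ord1.
have [||es [Hes Hsz [dl Hdl Hb]]] := IH Hds D' x''.
- by move=> s i; rewrite mxE.
- by move=> s; rewrite mxE.
pose d1 : 'rV[rat]_(1 + k) := \row_j (if unlift r j is Some s then dl 0 s else x' 0 r).
have Hd1 j : (d1 0 j == 1) || (d1 0 j == -1) by rewrite mxE; case: unliftP.
have Ed1 (v : 'rV[rat]_(1 + k)) i : (v *m D1) 0 i = v 0 r * D1 r i + (col' r (v : 'rV_k.+1) *m D') 0 i.
  rewrite mxE (bigD1_ord r) //=; congr (_ + _); rewrite [RHS]mxE.
  by apply: eq_bigr => s _; rewrite !mxE.
have Edl : col' r (d1 : 'rV_k.+1) = dl by apply/rowP => s; rewrite !mxE liftK.
exists (d1 0 (lshift k 0) :: es); split=> /=; [by rewrite Hd1|by rewrite Hsz|].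
exists (rsubmx d1) => [s|i]; first by rewrite mxE.
have Ex : (x *m D) 0 i = x' 0 r * D1 r i + (x'' *m D') 0 i.
  have E0 : x1 *m D1 = x *m D by rewrite /x1 /D1 mul_row_col mul0mx add0r.
  by rewrite -Ed1 -E0 -[RHS]/((x' *m D1) 0 i) [x' *m D1]Ex'.
have Ed : d1 0 (lshift k 0) * d 0 i + (rsubmx d1 *m D) 0 i = x' 0 r * D1 r i + (dl *m D') 0 i.
  have : (d1 *m D1) 0 i = x' 0 r * D1 r i + (dl *m D') 0 i by rewrite Ed1 Edl mxE unlift_none.
  rewrite -{1}[d1]hsubmxK /D1 mul_row_col => <-.
  by rewrite [RHS]mxE [X in _ = X + _]mxE big_ord1 [lsubmx _ _ _]mxE.
rewrite big_cons /=; have := Hb i; set S := \sum_(p <- zip es ds) _.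
by rewrite (_ : _ + S + _ - _ = S + (dl *m D') 0 i - (x'' *m D') 0 i) // Ex; lra.
Qed.
End Balance.

(** Twice the chosen value is [f + g] plus a sign times [g - f]; the signs come from [balance],
    started with [k] zero vectors. *)
Lemma balanced_choice k (T : eqType) (cs : seq T) (f g : T -> 'I_k -> nat) (Q : 'I_k -> nat) :
  (forall c i, c \in cs -> f c i <= Q i /\ g c i <= Q i) ->
  exists2 js : seq bool, size js = size cs &
    forall i, 2 * (\sum_(p <- zip js cs) (if p.1 then g p.2 i else f p.2 i)) <=
      \sum_(c <- cs) (f c i + g c i) + 2 * k * Q i.
Proof.
move=> HQ; pose d c : 'rV[rat]_k := (\row_i ((g c i)%:R - (f c i)%:R))%R.
have [||s|es [Hes Hsz [dl Hdl Hb]]] := @balance k (fun i => (Q i)%:R)%R (map d cs) _ 0%R 0%R.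
- apply/allP => v /mapP [c Hc ->]; apply/forallP => i; have [H1 H2] := HQ c i Hc.
  have H1' : ((f c i)%:R <= (Q i)%:R :> rat)%R by rewrite ler_nat.
  have H2' : ((g c i)%:R <= (Q i)%:R :> rat)%R by rewrite ler_nat.
  have H3 : (0 <= (f c i)%:R :> rat)%R := ler0n _ _.
  have H4 : (0 <= (g c i)%:R :> rat)%R := ler0n _ _.
  by rewrite mxE ler_norml; lra.
- by move=> s i; rewrite mxE normr0 ler0n.
- by rewrite mxE; lra.
exists (map (fun e : rat => e == 1%R) es); first by rewrite size_map Hsz size_map.
move=> i; have := Hb i; rewrite !mulmx0 !mxE addr0 subr0 => Hi.
rewrite -(ler_nat rat) natrM natrD natrM.
have Hz : ((2%:R * (\sum_(p <- zip [seq e == 1 | e <- es] cs) (if p.1 then g p.2 i else f p.2 i))%:R : rat) =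
  (\sum_(c <- cs) (f c i + g c i))%:R + \sum_(p <- zip es (map d cs)) p.1 * p.2 0 i)%R.
  have {Hb Hi} Hsz' : size es = size cs by rewrite Hsz size_map.
  elim: es cs Hes Hsz' {HQ Hsz} => [|e es IH] [|c cs] //= Hes; first by rewrite !big_nil mulr0 addr0.
  have /andP [He Hes'] := Hes; case=> /(IH cs Hes') {}IH.
  rewrite !big_cons /= !natrD mulrDr IH mxE.
  by case/orP: He => /eqP -> /=; lra.
rewrite Hz lerD2l; move: Hi; rewrite ler_norml natrM => /andP [_].
by [].
Qed.

(** * Weights of paths and cycles *)

Section PathWeight.
Variables (T : Type) (W : T -> T -> nat).
Fixpoint pwr x (p : seq T) := if p is y :: q then W x y + pwr y q else 0.
Definition pw (s : seq T) := if s is x :: p then pwr x p else 0.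
Definition cw (s : seq T) := if s is x :: p then pwr x (rcons p x) else 0.

Lemma pwr_cat x p q : pwr x (p ++ q) = pwr x p + pwr (last x p) q.
Proof. by elim: p x => //= y p IH x; rewrite IH addnA. Qed.
Lemma pwr_rcons x p y : pwr x (rcons p y) = pwr x p + W (last x p) y.
Proof. by rewrite -cats1 pwr_cat /= addn0. Qed.
Lemma cwE d s : cw s = pw s + (if s is [::] then 0 else W (last d s) (head d s)).
Proof. by case: s => //= x p; rewrite pwr_rcons. Qed.
Lemma pw_cat s t : pw s + pw t <= pw (s ++ t).
Proof. by case: s t => //= x p [|y q]; rewrite ?cats0 ?addn0 // pwr_cat /=; lia. Qed.
Lemma pw_flatten ss : \sum_(s <- ss) pw s <= pw (flatten ss).
Proof.
elim: ss => [|s ss IH] /=; first by rewrite big_nil.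
by rewrite big_cons; apply: leq_trans (pw_cat _ _); rewrite leq_add2l.
Qed.
End PathWeight.

Lemma fcycle_cw (T : eqType) (W : T -> T -> nat) (f : T -> T) c :
  fcycle f c -> cw W c = \sum_(u <- c) W u (f u).
Proof.
case: c => [|x p] /=; first by rewrite big_nil.
have H : forall p x, fpath f x p -> pwr W x p = \sum_(u <- belast x p) W u (f u).
  elim=> {x p} [|y p IH] x /=; first by rewrite big_nil.
  by move=> /andP [/eqP Ey /IH ->]; rewrite big_cons Ey.
by move=> /H ->; rewrite belast_rcons.
Qed.

Lemma cyc_edges_cw (W : nat -> nat -> nat) s : \sum_(e <- cyc_edges s) W e.1 e.2 = cw W s.
Proof.
have -> : cyc_edges s = zip s (rot 1 s).
  apply: (@eq_from_nth _ (0, 0)); first by rewrite size_map size_iota size_zip size_rot minnn.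
  move=> i; rewrite size_map size_iota => Hi.
  rewrite (nth_map 0) ?size_iota // nth_iota // add0n nth_zip ?size_rot //; congr pair.
  rewrite /rot nth_cat size_drop nth_drop add1n.
  have [H|H] := ltnP i (size s - 1); first by rewrite modn_small //; lia.
  have -> : i.+1 = size s by lia.
  by rewrite modnn (_ : i - _ = 0) ?nth_take //; lia.
case: s => [|x p]; first by rewrite big_nil.
rewrite rot1_cons /cw; elim: p {1 3}x => [|y p IH] z /=; first by rewrite big_seq1 addn0.
by rewrite big_cons /= -IH.
Qed.

(** * Cycles of a permutation *)

Section Cycles.
Variables (m : nat) (s : {perm 'I_m}) (sg : seq nat).
Hypothesis Hsg : forall u : 'I_m, nth 0 sg u = s u.

Lemma iter_sg i (u : 'I_m) : iter i (nth 0 sg) u = iter i s u.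
Proof. by elim: i => //= i ->. Qed.

Let sinj : injective s. Proof. exact: perm_inj. Qed.

(** [undup] keeps last occurrences, so of the [m] iterates the last [order s u] survive: an orbit
    whose starting point [x] may differ from [u]. *)
Lemma orbseqE (u : 'I_m) : exists2 x : 'I_m, orbseq sg m u = map val (orbit s x) & fconnect s x u.
Proof.
set o := order s u; have Ho : o <= m by rewrite -[X in _ <= X]card_ord; exact: max_card.
exists (iter (m - o) s u).
  rewrite /orbseq; have -> : mkseq (fun i => iter i (nth 0 sg) u) m = map val (traject s u m).
    apply: (@eq_from_nth _ 0); first by rewrite size_map size_traject size_mkseq.
    move=> i; rewrite size_mkseq => Hi; rewrite nth_mkseq // (nth_map u) ?size_traject //.
    by rewrite nth_traject // iter_sg.
  have Em : traject s u m = traject s u (m - o) ++ traject s (iter (m - o) s u) o.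
    by rewrite -trajectD subnK.
  rewrite Em map_cat undup_cat.
  have Eo : order s (iter (m - o) s u) = o.
    by apply: eq_card => y; apply/esym/(same_connect (fconnect_sym sinj))/fconnect_iter.
  have Et : traject s (iter (m - o) s u) o = orbit s (iter (m - o) s u) by rewrite /orbit Eo.
  rewrite Et; set x := iter _ _ _.
  rewrite (undup_id (s := map val (orbit s x))) ?map_inj_uniq ?orbit_uniq //; last exact: val_inj.
  rewrite (_ : filter _ _ = [::]) //; apply/eqP; rewrite -[_ == _]negbK -has_filter.
  apply/hasPn => y; rewrite mem_undup => /mapP [z Hz ->] /=; rewrite negbK map_f //.
  rewrite -fconnect_orbit; have /trajectP [i _ ->] := Hz.
  apply: connect_trans (fconnect_iter s i u); rewrite fconnect_sym //; exact: fconnect_iter.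
by rewrite fconnect_sym //; exact: fconnect_iter.
Qed.

Definition is_cyc (c : seq nat) := exists x : 'I_m, c = map val (orbit s x).

Lemma cycs_inv r : all (fun u => u < m) r ->
  let cs := foldl (fun cs u => if has (fun c => u \in c) cs then cs else orbseq sg m u :: cs) [::] r in
  [/\ forall c, c \in cs -> is_cyc c, uniq (flatten cs) & forall u, u \in r -> u \in flatten cs].
Proof.
elim/last_ind: r => [|r u IH] //; rewrite all_rcons => /andP [Hu /IH] {IH}.
rewrite foldl_rcons; set cs := foldl _ _ _ => -[H1 H2 H3] /=.
case: ifP => [/hasP [c Hc Huc]|Hn].
  split=> // v; rewrite mem_rcons inE => /orP [/eqP ->|/H3 //].
  by apply/flattenP; exists c.
have [x Ex Hx] := orbseqE (Ordinal Hu); rewrite -[u]/(val (Ordinal Hu)) Ex.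
split=> [c|/=|v].
- by rewrite inE => /orP [/eqP ->|/H1 //]; exists x.
- rewrite cat_uniq H2 andbT map_inj_uniq ?orbit_uniq /=; last exact: val_inj.
  apply/hasPn => v /flattenP [c Hc Hvc]; apply/negP => /mapP [y Hy Ev].
  have [z Ez] := H1 c Hc; move: Hvc; rewrite Ez Ev => /mapP [y' Hy' /val_inj Ey].
  move/negP: Hn; apply; apply/hasP; exists c => //; rewrite Ez; apply/mapP.
  exists (Ordinal Hu) => //; rewrite -fconnect_orbit.
  move: Hy Hy'; rewrite -Ey -!fconnect_orbit => Hy Hy'.
  apply: connect_trans Hy' _; apply: connect_trans Hx.
  by rewrite fconnect_sym.
- rewrite mem_rcons inE mem_cat => /orP [/eqP ->|/H3 ->]; last by rewrite orbT.
  by rewrite -[u]/(val (Ordinal Hu)) map_f // -fconnect_orbit.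
Qed.

Lemma cycs_perm : perm_eq (flatten (cycs sg m)) (iota 0 m).
Proof.
have [|H1 H2 H3] := @cycs_inv (iota 0 m); first by apply/allP => u; rewrite mem_iota.
apply: uniq_perm => // [|u]; first exact: iota_uniq.
apply/idP/idP => [/flattenP [c /H1 [x ->] /mapP [y _ ->]]|]; last exact: H3.
by rewrite mem_iota /= add0n.
Qed.

Lemma cycs_cyc c : c \in cycs sg m -> is_cyc c.
Proof.
by have [|H1 _ _] := @cycs_inv (iota 0 m); [apply/allP => u; rewrite mem_iota|exact: H1].
Qed.

Lemma is_cyc_fcycle c : is_cyc c -> fcycle (nth 0 sg) c.
Proof.
have H q : forall v : 'I_m, fpath s v q -> fpath (nth 0 sg) v (map val q).
  elim: q => //= z q IH v /andP [/eqP Ez /IH ->].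
  by rewrite Hsg Ez eqxx.
case=> x ->; have := cycle_orbit sinj x; case: (orbit s x) => //= y p.
by rewrite -map_rcons; exact: H.
Qed.

Lemma sum_cycs (F : nat -> nat) :
  \sum_(c <- cycs sg m) \sum_(u <- c) F u = \sum_(u : 'I_m) F u.
Proof.
rewrite -big_flatten (perm_big _ cycs_perm) /= -(big_mkord xpredT F).
by rewrite /index_iota subn0.
Qed.

Lemma size_cyc c : (forall u, s u != u) -> is_cyc c -> 1 < size c.
Proof.
move=> Hs [x ->]; rewrite size_map size_orbit ltnNge; apply: contra (Hs x).
have := in_orbit s x; have := iter_order sinj x; have := order_gt0 s x.
by case: (order s x) => [|[|]] //= _ ->.
Qed.
End Cycles.

Lemma rot_cyc_cw (W : nat -> nat -> nat) (sg : seq nat) c j :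
  fcycle (nth 0 sg) c -> cw W (rot j c) = \sum_(u <- c) W u (nth 0 sg u).
Proof.
have Hr : fcycle (nth 0 sg) (rot j c) = fcycle (nth 0 sg) c by rewrite rot_cycle.
move=> Hc; rewrite -Hr in Hc; rewrite (fcycle_cw W Hc).
by apply: perm_big; rewrite perm_rot.
Qed.

(** * The subset-sum table *)

Section Table.
Variables (A : seq (seq (seq nat))) (D : nat).

Definition ocat (js : seq bool) (cs : seq (seq nat)) := flatten [seq rot (nat_of_bool p.1) p.2 | p <- zip js cs].
Definition csum (js : seq bool) (cs : seq (seq nat)) :=
  \sum_(p <- zip js cs) rcode A (rot (nat_of_bool p.1) p.2).

Definition table cs := foldl (dpstep D A) [:: [:: [::]]] cs.

Lemma zip_rcons T U (x : T) (y : U) s t : size s = size t ->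
  zip (rcons s x) (rcons t y) = rcons (zip s t) (x, y).
Proof. by move=> H; rewrite -!cats1 zip_cat. Qed.

Lemma ocat_rcons j js c cs : size js = size cs ->
  ocat (rcons js j) (rcons cs c) = ocat js cs ++ rot (nat_of_bool j) c.
Proof. by move=> H; rewrite /ocat zip_rcons // map_rcons flatten_rcons. Qed.

Lemma csum_rcons j js c cs : size js = size cs ->
  csum (rcons js j) (rcons cs c) = csum js cs + rcode A (rot (nat_of_bool j) c).
Proof. by move=> H; rewrite /csum zip_rcons // big_rcons /= addnC. Qed.

Lemma table_sound cs c o : o \in nth [::] (table cs) c ->
  exists js, [/\ size js = size cs, o = ocat js cs & csum js cs = c].
Proof.
elim/last_ind: cs c o => [|cs cy IH] c o.
  case: c => [|[|c]] //=; rewrite inE => /eqP ->; exists [::]; split=> //.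
  by rewrite /csum big_nil.
rewrite /table foldl_rcons -/(table cs) /dpstep.
have [Hc|Hc] := ltnP c D; last by rewrite nth_default ?size_mkseq.
rewrite nth_mkseq // => /mem_take; rewrite mem_cat.
have Hj (j : bool) : o \in cut A (table cs) cy c j -> exists js,
    [/\ size js = size (rcons cs cy), o = ocat js (rcons cs cy) & csum js (rcons cs cy) = c].
  rewrite /cut; case: ifP => // Hle /mapP [o' /IH [js [H1 -> H3]] ->].
  exists (rcons js j); rewrite ocat_rcons // csum_rcons // !size_rcons H1 H3; split=> //.
  by rewrite subnK.
by case/orP; [exact: (Hj false)|exact: (Hj true)].
Qed.

Lemma table_complete cs js : size js = size cs -> csum js cs < D ->
  nth [::] (table cs) (csum js cs) != [::].
Proof.
elim/last_ind: cs js => [|cs cy IH] js; first by case: js => // _; rewrite /csum big_nil.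
case/lastP: js => [|js j]; first by rewrite size_rcons.
rewrite !size_rcons => -[Hsz]; rewrite csum_rcons // => HD.
rewrite /table foldl_rcons -/(table cs) /dpstep nth_mkseq //.
have Hj : cut A (table cs) cy (csum js cs + rcode A (rot (nat_of_bool j) cy)) j != [::].
  rewrite /cut leq_addl addnK.
  have := IH js Hsz (leq_ltn_trans (leq_addr _ _) HD).
  by case: (nth _ _ _).
set c := csum _ _ + _ in Hj *; have : cut A (table cs) cy c 0 ++ cut A (table cs) cy c 1 != [::].
  have [E|E] : nat_of_bool j = 0 \/ nat_of_bool j = 1 by case: (j); [right|left].
    by rewrite E in Hj; case: (cut A (table cs) cy c 0) Hj.
  by rewrite E in Hj; case: (cut A (table cs) cy c 0) => //=; case: (cut _ _ _ _ 1) Hj.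
by case: (_ ++ _).
Qed.
End Table.

(** The opening [js] itself may have been dropped by [take 1], but its table entry is nonempty and
    holds some [js'] of the same total code. *)
Lemma tours_complete (A : seq (seq (seq nat))) n (s : {perm 'I_n.+1}) W (js : seq bool) :
  (forall u : 'I_n.+1, succW A n.+1 W u = s u) ->
  W = \sum_(u : 'I_n.+1) head 0 (at_ A u (s u)) ->
  let sg := mkseq (succW A n.+1 W) n.+1 in
  size js = size (cycs sg n.+1) ->
  exists2 js' : seq bool, size js' = size (cycs sg n.+1) /\
      csum A js' (cycs sg n.+1) = csum A js (cycs sg n.+1) &
    ocat js' (cycs sg n.+1) \in tours A n.+1 W.
Proof.
move=> Hs HW sg Hsz; set cs := cycs sg n.+1 in Hsz *.
have Hsg (u : 'I_n.+1) : nth 0 sg u = s u by rewrite nth_mkseq.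
have HC : csum A js cs < W.+1.
  rewrite ltnS HW; apply: (@leq_trans (\sum_(c <- cs) \sum_(u <- c) head 0 (at_ A u (nth 0 sg u)))).
    have Ecs : cs = unzip2 (zip js cs) by rewrite unzip2_zip ?Hsz.
    rewrite [X in _ <= X](_ : _ =
        \sum_(p <- zip js cs) \sum_(u <- p.2) head 0 (at_ A u (nth 0 sg u))); last first.
      by rewrite {1}Ecs big_map.
    rewrite /csum big_seq [X in _ <= X]big_seq.
    apply: leq_sum => -[j c] Hjc /=.
    have Hc : c \in cs by rewrite Ecs; apply/mapP; exists (j, c).
    have Hcyc := is_cyc_fcycle Hsg (cycs_cyc Hsg Hc).
    rewrite -(rot_cyc_cw (fun u v => head 0 (at_ A u v)) j Hcyc) (cwE _ 0) /rcode.
    case E : (rot j c) => [|x p]; last exact: leq_addl.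
    have := size_rot j c; rewrite E => /esym/size0nil Ec; have [x Ex] := cycs_cyc Hsg Hc.
    by have := in_orbit s x; move: Ex; rewrite Ec; case: (orbit s x).
  rewrite (sum_cycs Hsg (fun u => head 0 (at_ A u (nth 0 sg u)))).
  by apply: leq_sum => u _; rewrite Hsg.
have := table_complete Hsz HC; case E : (nth _ _ _) => [|o os] // _.
have Ho : o \in nth [::] (table A W.+1 cs) (csum A js cs) by rewrite E mem_head.
have [js' [H1 H2 H3]] := table_sound Ho.
exists js' => //; rewrite -H2 /tours; apply/flattenP; exists (nth [::] (table A W.+1 cs) (csum A js cs)) => //.
by apply: mem_nth; rewrite ltnNge; apply/negP => Hle; move: Ho; rewrite nth_default.
Qed.

(** * Path systems *)

Definition nonempty (b : seq nat) := b != [::].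

Lemma iota_perm2 N a b : a < N -> b < N -> a != b ->
  perm_eq (iota 0 N) (a :: b :: [seq c <- iota 0 N | (c != a) && (c != b)]).
Proof.
move=> Ha Hb Hab; apply: uniq_perm; first exact: iota_uniq.
  by rewrite /= !inE !mem_filter !eqxx /= (negbTE Hab) /= andbF /= filter_uniq // iota_uniq.
move=> c; rewrite !inE mem_filter mem_iota add0n /=.
by case: eqP => [->|_] //=; case: eqP => [->|_].
Qed.

Lemma joins_complete Q A B (b1 b2 : seq nat) : perm_eq Q (A ++ b1 :: b2 :: B) -> b1 != b2 ->
  exists2 R, R \in joins Q & perm_eq R (A ++ (b1 ++ b2) :: B).
Proof.
move=> HQ Hne; have H1 : b1 \in Q by rewrite (perm_mem HQ) mem_cat mem_head orbT.
have H2 : b2 \in Q by rewrite (perm_mem HQ) mem_cat !inE eqxx !orbT.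
pose a := index b1 Q; pose b := index b2 Q.
have Ha : a < size Q by rewrite index_mem.
have Hb : b < size Q by rewrite index_mem.
have Ea : nth [::] Q a = b1 by exact: nth_index.
have Eb : nth [::] Q b = b2 by exact: nth_index.
have Hab : a != b by apply: contra Hne => /eqP E; rewrite -Ea -Eb E.
exists ((nth [::] Q a ++ nth [::] Q b) ::
   [seq nth [::] Q c | c <- [seq c <- iota 0 (size Q) | (c != a) && (c != b)]]).
  apply/flattenP; eexists; first by apply/mapP; exists a => //; rewrite mem_iota.
  by apply/mapP; exists b => //; rewrite mem_iota.
rewrite Ea Eb; apply: perm_trans (_ : perm_eq ((b1 ++ b2) :: (A ++ B)) _); last first.
  by rewrite perm_sym -[_ :: B]cat1s perm_catCA.
rewrite perm_cons -(perm_cons b2) -(perm_cons b1).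
have E : map (nth [::] Q) (iota 0 (size Q)) = Q by exact: mkseq_nth.
have := perm_map (nth [::] Q) (iota_perm2 Ha Hb Hab); rewrite E /= Ea Eb => HE.
apply: perm_trans (_ : perm_eq Q _); first by rewrite perm_sym.
apply: perm_trans HQ _.
rewrite -[b1 :: b2 :: B]/([:: b1; b2] ++ B) -[X in perm_eq _ X]/([:: b1; b2] ++ (A ++ B)).
by rewrite perm_catCA.
Qed.

(** Induction on the number [n - size P'] of edges: the first vertex of a path with an edge is split
    off, and [joins] restores it. *)
Lemma guesses_complete L n P' : perm_eq (flatten P') (iota 0 n) -> all nonempty P' ->
  n - size P' <= L -> exists2 P, P \in guesses L n & perm_eq P P'.
Proof.
elim: L P' => [|L IH] P' HP Hne HL.
  exists [seq [:: v] | v <- iota 0 n]; first by rewrite mem_head.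
  have Hs : size (flatten P') <= size P'.
    by rewrite (perm_size HP) size_iota; lia.
  have -> : P' = [seq [:: v] | v <- flatten P'].
    elim: P' Hne Hs {HP HL} => //= b P' IH /andP [Hb HP]; rewrite size_cat.
    have Hge : size P' <= size (flatten P').
      elim: (P') HP => //= b' Q IHQ /andP [Hb' /IHQ]; rewrite size_cat.
      by case: b' Hb' => //= *; lia.
    case: b Hb => [|x [|y b]] //= _ Hs; last by lia.
    by rewrite -IH //; lia.
  by apply: perm_map; rewrite perm_sym.
have [HL'|HL'] := leqP (n - size P') L.
  have [P HP1 HP2] := IH P' HP Hne HL'; exists P => //.
  by apply/flattenP; exists (P :: joins P); rewrite ?mem_head //; apply/mapP; exists P.
have [A [x [y [b [B EP]]]]] : exists (A : seq (seq nat)) (x y : nat) b B, P' = A ++ (x :: y :: b) :: B.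
  have : size P' < size (flatten P') by rewrite (perm_size HP) size_iota; lia.
  elim: P' Hne {HP HL HL'} => // b P' IHP /= /andP [Hb HP]; rewrite size_cat.
  case: b Hb => [|x [|y b]] //= _ Hs.
    have [|A [u [v [b [B ->]]]]] := IHP HP; first exact: Hs.
    by exists ([:: x] :: A), u, v, b, B.
  by exists [::], x, y, b, P'.
have [|||Q HQ1 HQ2] := IH (A ++ [:: x] :: (y :: b) :: B).
- apply: perm_trans HP; rewrite EP !flatten_cat /=; exact: perm_refl.
- by move: Hne; rewrite EP !all_cat /=.
- by move: HL; rewrite EP !size_cat /=; lia.
have [|R HR1 HR2] := joins_complete HQ2.
  have : uniq (flatten P') by rewrite (perm_uniq HP) iota_uniq.
  rewrite EP flatten_cat cat_uniq => /and3P [_ _ /= /andP [H _]].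
  by apply: contraNneq H => -[-> _]; rewrite inE eqxx.
exists R; last by rewrite EP.
by apply/flattenP; exists (Q :: joins Q); [apply/mapP; exists Q|rewrite inE HR1 orbT].
Qed.

Lemma size_joins Q R : R \in joins Q -> size R <= size Q.
Proof.
move=> /flattenP [l' /mapP [a Ha ->]] /mapP [b Hb ->] /=.
rewrite size_map size_filter -[X in _ <= X](size_iota 0) -(count_predC (fun c => (c != a) && (c != b))).
rewrite -addn1 leq_add2l -has_count; apply/hasP; exists a => //.
by rewrite /= eqxx.
Qed.

Lemma size_guesses L n P : P \in guesses L n -> size P <= n.
Proof.
elim: L P => [|L IH] P; first by rewrite inE => /eqP ->; rewrite size_map size_iota.
move=> /flattenP [l /mapP [Q /IH HQ ->]]; rewrite inE => /orP [/eqP -> //|].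
by move=> /size_joins /leq_trans; apply.
Qed.

Lemma size_flatten_le (T : eqType) (U : Type) (f : T -> seq U) l c :
  (forall x, x \in l -> size (f x) <= c) -> size (flatten (map f l)) <= size l * c.
Proof.
elim: l => //= x l IH H; rewrite size_cat mulSn leq_add ?H ?mem_head //.
by apply: IH => y Hy; apply: H; rewrite inE Hy orbT.
Qed.

Lemma card_guesses L n : size (guesses L n) <= (n ^ 2 + 1) ^ L.
Proof.
elim: L => // L IH; rewrite expnSr; apply: leq_trans (_ : size (guesses L n) * (n ^ 2 + 1) <= _).
  apply: size_flatten_le => P /size_guesses HP; rewrite /= addn1 ltnS.
  apply: leq_trans (_ : size (iota 0 (size P)) * size P <= _); last first.
    by rewrite size_iota -mulnn leq_mul.
  by apply: size_flatten_le => a _; rewrite size_map size_iota.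
by rewrite leq_mul2r IH orbT.
Qed.

Lemma svecs_complete k Z v : size v = k -> all (fun s => s <= Z) v -> v \in svecs k Z.
Proof.
elim: k v => [|k IH] [|s v] //= [Hs] /andP [Hsz Hv].
apply/flattenP; exists [seq s :: v | v <- svecs k Z].
  by apply/mapP; exists s => //; rewrite mem_iota; lia.
by apply/mapP; exists v => //; exact: IH.
Qed.

Lemma card_svecs k Z : size (svecs k Z) <= (Z + 1) ^ k.
Proof.
elim: k => // k IH; rewrite [svecs _ _]/=.
apply: leq_trans (size_flatten_le (c := (Z + 1) ^ k) _) _.
  by move=> s _; rewrite size_map.
by rewrite size_iota expnS.
Qed.

(** * Cutting a tour into paths *)

Section Blocks.
Variable F : pred nat.

(** A vertex in [F] marks the edge leaving it, so the list is cut behind every vertex outside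
    [F]. *)
Fixpoint blocks x (p : seq nat) : seq (seq nat) :=
  if p is y :: q then
    if F x then (x :: head [::] (blocks y q)) :: behead (blocks y q) else [:: x] :: blocks y q
  else [:: [:: x]].

Lemma blocks_cons x p : exists b bs, blocks x p = (x :: b) :: bs.
Proof. by case: p => [|y p] /=; [|case: (F x)]; do 2 eexists. Qed.

Lemma flatten_blocks x p : flatten (blocks x p) = x :: p.
Proof.
elim: p x => //= y p IH x; case: (F x) => /=; last by rewrite IH.
by have := IH y; have [b [bs ->]] := blocks_cons y p => /= ->.
Qed.

Lemma blocks_nonempty x p : all nonempty (blocks x p).
Proof.
elim: p x => //= y p IH x; have := IH y; have [b [bs ->]] := blocks_cons y p.
by case: (F x).
Qed.

Lemma blocks_last x p : ~~ F (last x p) ->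
  size (blocks x p) = count (predC F) (x :: p) /\ all (fun b => ~~ F (last 0 b)) (blocks x p).
Proof.
elim: p x => [|y p IH] x /=; first by move=> H; rewrite H.
move=> /IH; rewrite [count _ (_ :: _)]/=; have [b [bs ->]] := blocks_cons y p.
by case HF: (F x) => /= -[-> H]; split=> //=; rewrite ?HF.
Qed.

Lemma blocks_pw (W : nat -> nat -> nat) g x p : fpath g x p ->
  \sum_(b <- blocks x p) pw W b = \sum_(u <- belast x p | F u) W u (g u).
Proof.
elim: p x => [|y p IH] x /=; first by rewrite big_seq1 big_nil.
move=> /andP [/eqP Ey /IH]; rewrite big_cons; have [b [bs ->]] := blocks_cons y p.
by case: (F x); rewrite !big_cons /= ?Ey => <-; rewrite ?addnA ?add0n.
Qed.
End Blocks.

Definition jw (W : nat -> nat -> nat) (b c : seq nat) := W (last 0 b) (head 0 c).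

Lemma pw_flattenE W bs : all nonempty bs ->
  pw W (flatten bs) = \sum_(b <- bs) pw W b + pw (jw W) bs.
Proof.
case: bs => [|b bs]; first by rewrite big_nil.
elim: bs b => [|c bs IH] b /= /andP [Hb Hc]; first by rewrite big_seq1 cats0 addn0.
have {IH} := IH c Hc; move: Hc; case: c => [|z c] //= _.
case: b Hb => [|x b] //= _ Hp; rewrite !big_cons /= in Hp *.
by rewrite pwr_cat /= Hp /jw /=; lia.
Qed.

Lemma cw_flattenE W bs : all nonempty bs ->
  cw W (flatten bs) = \sum_(b <- bs) pw W b + cw (jw W) bs.
Proof.
move=> Hb; rewrite (cwE W 0) (cwE (jw W) [::]) pw_flattenE // -addnA; congr (_ + (_ + _)).
case: bs Hb => [|b bs] //= /andP [Hb Hbs]; case: b Hb => [|x b] //= _.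
rewrite /jw /=; congr (W _ _).
elim/last_ind: bs Hbs => [|bs c IH] Hbs; first by rewrite cats0.
rewrite all_rcons in Hbs; rewrite flatten_rcons last_rcons catA last_cat.
by case/andP: Hbs; case: c.
Qed.

Lemma pw_map T U (h : T -> U) W s : pw W (map h s) = pw (fun a b => W (h a) (h b)) s.
Proof. by case: s => //= x p; elim: p x => //= y p IH x; rewrite IH. Qed.

Lemma fcycle_flatten (g : nat -> nat) bs : all nonempty bs -> fcycle g (flatten bs) ->
  cycle (fun b c => head 0 c == g (last 0 b)) bs.
Proof.
case: bs => [|b bs] // Hne.
have H : forall bs b d, all nonempty (b :: bs) ->
    fpath g (head 0 b) (behead (flatten (b :: bs)) ++ [:: d]) ->
    path (fun b c => head 0 c == g (last 0 b)) b bs /\ d = g (last 0 (last b bs)).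
  elim=> [|c l IH] {Hne bs}b d /= /andP [Hb Hc].
    case: b Hb => [|x b] //= _; rewrite cats0 cat_path /= andbT => /andP [_ /eqP ->].
    by [].
  case: b Hb => [|x b] //= _; case: c Hc => [|z c] //= Hc.
  rewrite -catA cat_path /= => /and3P [_ /eqP Ez Hp].
  by have [||-> ->] := IH (z :: c) d => //; rewrite Ez eqxx.
case: b Hne => [|x b] // Hne Hc.
have [|Hp Ed] := H bs (x :: b) x Hne; first by rewrite cats1.
by rewrite /cycle rcons_path Hp /=; apply/eqP.
Qed.

Lemma next_neq (T : eqType) (s : seq T) u : uniq s -> 1 < size s -> u \in s -> next s u != u.
Proof.
move=> Hs Hz Hu; rewrite -(next_rot (index u s) Hs); move: Hs Hz.
rewrite -(rot_uniq (index u s)) -(size_rot (index u s)) rot_index //.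
by case: (_ ++ _) => [|y q] //=; rewrite eqxx inE eq_sym => /and3P [/norP []].
Qed.

(* The contracted tour, as a permutation of the indices of [P]. *)
Section Contract.
Variables (P P' : seq (seq nat)).
Hypotheses (HP : perm_eq P P') (HU : uniq P) (H2 : 1 < size P).
Let m := size P.

Definition cnext (a : 'I_m) : nat := index (next P' (nth [::] P a)) P.

Lemma cnext_lt a : cnext a < m.
Proof. by rewrite index_mem (perm_mem HP) mem_next -(perm_mem HP) mem_nth. Qed.

Definition csucc a : 'I_m := Ordinal (cnext_lt a).

Lemma csuccE a : nth [::] P (csucc a) = next P' (nth [::] P a).
Proof. by rewrite nth_index // (perm_mem HP) mem_next -(perm_mem HP) mem_nth. Qed.

Lemma csucc_inj : injective csucc.
Proof.
move=> a b /(congr1 (fun c : 'I_m => nth [::] P c)); rewrite !csuccE => E.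
have HU' : uniq P' by rewrite -(perm_uniq HP).
have := congr1 (prev P') E; rewrite !prev_next // => /eqP.
by rewrite nth_uniq // => /eqP /val_inj.
Qed.

Definition cperm : {perm 'I_m} := perm csucc_inj.

Lemma cpermE a : nth [::] P (cperm a) = next P' (nth [::] P a).
Proof. by rewrite permE csuccE. Qed.

Lemma cperm_neq a : cperm a != a.
Proof.
apply/negP => /eqP E; have := cpermE a; rewrite E => /eqP; rewrite eq_sym.
by apply/negP/next_neq; rewrite -?(perm_uniq HP) -?(perm_size HP) -?(perm_mem HP) // mem_nth.
Qed.

Lemma sum_cperm (V : seq nat -> seq nat -> nat) :
  \sum_(a : 'I_m) V (nth [::] P a) (nth [::] P (cperm a)) = cw V P'.
Proof.
have HU' : uniq P' by rewrite -(perm_uniq HP).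
rewrite (fcycle_cw V (cycle_next HU')) -(perm_big _ HP) /= (big_nth [::]) big_mkord.
by apply: eq_bigr => a _; rewrite cpermE.
Qed.

Lemma cperm_rel (e : rel (seq nat)) (a : 'I_m) : cycle e P' -> e (nth [::] P a) (nth [::] P (cperm a)).
Proof.
move=> He; rewrite cpermE; apply: (next_cycle He).
by rewrite -(perm_mem HP) mem_nth.
Qed.
End Contract.

(** * Heavy edges *)

(* [F] consists of the [K] longest elements for each of the [k] length functions. *)
Lemma heavy (s : seq nat) k K (len : 'I_k -> nat -> nat) : uniq s -> K <= size s ->
  exists (F : pred nat) (sv : 'I_k -> nat),
    [/\ count F s <= k * K,
        forall i u, u \in s -> ~~ F u -> len i u <= sv i
      & forall i, exists h, [/\ uniq h, size h = K, {subset h <= s} &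
          forall u, u \in h -> F u /\ sv i <= len i u]].
Proof.
move=> Hs HK.
pose srt i := sort (fun u v => len i v <= len i u) s.
have Htot i : total (fun u v => len i v <= len i u) by move=> u v; exact: leq_total.
have Htr i : transitive (fun u v => len i v <= len i u) by move=> v u w H1 H2; exact: leq_trans H2 H1.
pose F u := [exists i, u \in take K (srt i)].
(* The list is sorted by decreasing length, so this is the [K]-th longest one; for [K = 0] nothing
   is marked and the maximum bounds everything. *)
pose sv i := if K is K'.+1 then len i (nth 0 (srt i) K') else \max_(u <- s) len i u.
have Hsort i : sorted (fun u v => len i v <= len i u) (srt i) by exact: sort_sorted.
have Hsz i : size (srt i) = size s by exact: size_sort.
exists F, sv; split.
- have -> : count F s = size [seq u <- s | F u] by rewrite size_filter.
  apply: leq_trans (_ : size (flatten [seq take K (srt i) | i <- enum 'I_k]) <= _).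
    apply: uniq_leq_size; first exact: filter_uniq.
    move=> u; rewrite mem_filter => /andP [/existsP [i Hi] _].
    by apply/flattenP; exists (take K (srt i)) => //; apply/mapP; exists i; rewrite ?mem_enum.
  apply: leq_trans (size_flatten_le (c := K) _) _; last by rewrite size_enum_ord.
  by move=> i _; rewrite size_take_min geq_minl.
- move=> i u Hu HF; rewrite /sv; case E : K => [|K'].
    by rewrite (big_rem u) //= leq_maxl.
  have Hu' : u \in srt i by rewrite mem_sort.
  have Hi : K <= index u (srt i).
    rewrite leqNgt; apply/negP => Hlt; move/negP: HF; apply; apply/existsP; exists i.
    by rewrite -(nth_index 0 Hu') -(nth_take _ Hlt) mem_nth // size_take_min leq_min Hlt index_mem.
  rewrite -{1}(nth_index 0 Hu').
  apply: (sorted_leq_nth (Htr i) _ 0 (Hsort i)); rewrite ?inE ?index_mem //; last by lia.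
    by rewrite Hsz; lia.
- move=> i; exists (take K (srt i)); split.
  + by rewrite take_uniq // sort_uniq.
  + by rewrite size_takel // Hsz.
  + by move=> u /mem_take; rewrite mem_sort.
  + move=> u Hu; split; first by apply/existsP; exists i.
    rewrite /sv; case E : K Hu => [|K'] Hu; first by rewrite take0 in Hu.
    have Hu' := mem_take Hu.
    have Hlt : index u (srt i) < K'.+1 by rewrite -in_take.
    rewrite -{1}(nth_index 0 Hu').
    apply: (sorted_leq_nth (Htr i) _ 0 (Hsort i)); rewrite ?inE ?index_mem //.
    by rewrite Hsz; lia.
Qed.

(** * Binary numerals *)

Definition valb (s : seq bool) : nat := foldr (fun (b : bool) a => b + a.*2) 0 s.

Lemma valb_cat s t : valb (s ++ t) = valb s + valb t * 2 ^ size s.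
Proof. by elim: s => [|b s IH] /=; rewrite ?muln1 // IH expnS; lia. Qed.

Lemma valb_lt s : valb s < 2 ^ size s.
Proof. by elim: s => //= b s IH; rewrite expnS; case: b; lia. Qed.

Lemma valb_inj s t : size s = size t -> valb s = valb t -> s = t.
Proof.
elim: s t => [|b s IH] [|b' t] //= [Hs] E.
have Eb : b = b' by move: (congr1 odd E); rewrite !oddD !odd_double !addbF; case: b b' {E} => -[].
by rewrite -Eb in E *; congr cons; apply: IH => //; lia.
Qed.

Lemma valb_drop j s : valb (drop j s) = valb s %/ 2 ^ j.
Proof.
have [Hj|Hj] := leqP (size s) j.
  rewrite drop_oversize // divn_small //; apply: leq_trans (valb_lt s) _.
  by rewrite leq_exp2l.
rewrite -{2}(cat_take_drop j s) valb_cat size_takel; last exact: ltnW.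
have H := valb_lt (take j s); rewrite size_takel in H; last exact: ltnW.
by rewrite addnC divnMDl ?expn_gt0 // divn_small // addn0.
Qed.

Lemma ubinE cap s : ubin cap s = minn cap (valb s).
Proof.
rewrite /ubin; elim: s => [|b s IH]; first by rewrite /= minn0.
by rewrite rev_cons foldl_rcons IH /=; case: b; lia.
Qed.

Lemma bitsF_fuel f g m : m <= f -> m <= g -> bitsF f m = bitsF g m.
Proof.
elim: f g m => [|f IH] [|g] [|m] //= Hf Hg; rewrite (IH g) //; have := odd_double_half m.+1 => /=; lia.
Qed.

Lemma bitsF_incb f m : m <= f -> incb (bitsF f m) = bitsF f.+1 m.+1.
Proof.
elim: f m => [|f IH] [|m] // Hm; rewrite ?[bitsF f.+1 0]/= //.
have E : bitsF f.+1 m.+1 = odd m.+1 :: bitsF f m.+1./2 by [].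
have E' : bitsF f.+2 m.+2 = odd m.+2 :: bitsF f.+1 m.+2./2 by [].
have Ho : odd m.+2 = ~~ odd m.+1 by [].
rewrite E E' Ho; case Hm1 : (odd m.+1).
  have -> : m.+2./2 = m.+1./2.+1 by have := odd_double_half m.+1; have := odd_double_half m.+2; rewrite Ho Hm1 /=; lia.
  by rewrite -IH //; have := odd_double_half m.+1; rewrite Hm1; lia.
have -> : m.+2./2 = m.+1./2 by have := odd_double_half m.+1; have := odd_double_half m.+2; rewrite Ho Hm1 /=; lia.
rewrite /incb /= drop0; congr cons.
have Hle : m.+1./2 <= f by have := odd_double_half m.+1; rewrite Hm1; lia.
by apply: (@bitsF_fuel f f.+1) => //; lia.
Qed.

Lemma ubitsE m : ubits m = bits m.
Proof. by elim: m => //= m; rewrite /ubits /= -/(ubits m) => ->; rewrite bitsF_incb. Qed.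

Lemma bitsE m : 0 < m -> bits m = odd m :: bits m./2.
Proof.
case: m => // m _; rewrite {1}/bits [bitsF _ _]/=; congr cons; apply: bitsF_fuel => //.
by have := odd_double_half m.+1 => /=; lia.
Qed.

Lemma valb_bits m : valb (bits m) = m.
Proof.
elim/ltn_ind: m => m IH; have [->//|Hm] := posnP m; have Ho := odd_double_half m.
by rewrite bitsE // [LHS]/= IH //; lia.
Qed.

Lemma bits_lt m : m < 2 ^ size (bits m).
Proof. by rewrite -{1}(valb_bits m) valb_lt. Qed.

Lemma bits_ge m : 0 < m -> 2 ^ (size (bits m)).-1 <= m.
Proof.
elim/ltn_ind: m => m IH Hm; rewrite bitsE //=.
have [H|H] := posnP m./2; first by rewrite H.
have Hlt : m./2 < m by have := odd_double_half m; lia.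
have := IH _ Hlt H; have : 0 < size (bits m./2) by rewrite bitsE.
case: (size _) => // s _ /= H1; rewrite expnS.
by have := odd_double_half m; lia.
Qed.

(** * Instances *)

Lemma nth_flatten_const (T U : Type) (f : T -> seq U) k l t0 u0 j i :
  (forall t, size (f t) = k) -> j < size l -> i < k ->
  nth u0 (flatten (map f l)) (j * k + i) = nth u0 (f (nth t0 l j)) i.
Proof.
move=> Hf; elim: l j => [|t l IH] [|j] //= Hj Hi; rewrite nth_cat Hf; first by rewrite Hi.
rewrite ifF; last by rewrite mulSn; lia.
by rewrite -IH //; congr nth; rewrite mulSn; lia.
Qed.

Lemma mem_edges_of n u v : ((u, v) \in edges_of n) = [&& u != v, u < n & v < n].
Proof.
rewrite mem_filter /=; congr andb; apply/allpairsP/andP => [[[a b] /= []]|[Hu Hv]].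
  by rewrite !mem_iota /= => Ha Hb [-> ->].
by exists (u, v); rewrite !mem_iota.
Qed.

Section Instance.
Variables (k : nat) (n : nat) (w : nat -> nat -> 'I_k -> nat).

Definition inst : seq bool * seq (seq bool) :=
  (bits n, map bits (flatten [seq [seq w e.1 e.2 i | i <- enum 'I_k] | e <- edges_of n])).

Lemma encG_inst : encG n w = encode inst.
Proof.
rewrite /encG /inst; set l := flatten _.
have E (s : seq nat) : encL encN s = encode (map bits s).
  by rewrite -[RHS]/(encL _ _) /encL -map_comp.
by rewrite E.
Qed.

Lemma encode_solutions (S : seq (seq nat)) : encode [seq [seq ubits v | v <- s] | s <- S] = encS S.
Proof.
rewrite -[LHS]/(encL _ _) /encS /encL -map_comp; congr (flatten _ ++ _).
apply: eq_map => s /=; congr cons.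
rewrite -[LHS]/(encL _ _) /encL -map_comp; congr (flatten _ ++ _).
by apply: eq_map => v /=; rewrite ubitsE.
Qed.

Variable r : seq bool.
Let x : inp := (r, inst).
Let Z := xZ x.

Lemma size_edges : 1 < n -> n <= size (edges_of n).
Proof.
move=> Hn; rewrite -[X in X <= _](size_iota 0) -(size_map (fun u => (u, u.+1 %% n))).
apply: uniq_leq_size.
  by rewrite map_inj_uniq ?iota_uniq // => u v [].
move=> e /mapP [u]; rewrite mem_iota => /= Hu ->.
rewrite mem_edges_of Hu ltn_mod (ltnW Hn) andbT /=.
have [E|E] := eqVneq u.+1 n; first by rewrite E modnn; lia.
by rewrite modn_small; lia.
Qed.

Lemma xZE : Z = size (edges_of n) * k + size (flatten x.2.2).
Proof.
rewrite /Z /xZ; congr (_ + _); rewrite size_map.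
elim: (edges_of n) => //= e l IH; rewrite size_cat IH size_map size_enum_ord mulSn.
by [].
Qed.

Hypotheses (Hk : 0 < k) (Hn : 1 < n).

Lemma n_le_Z : n <= Z.
Proof. by rewrite xZE; have := size_edges Hn; nia. Qed.

Lemma xnE : xn x = n.
Proof. by rewrite /xn ubinE valb_bits; apply/minn_idPr; exact: n_le_Z. Qed.

Lemma wtE u v (i : 'I_k) : u != v -> u < n -> v < n -> wt k x u v i = bits (w u v i).
Proof.
move=> Huv Hu Hv; rewrite /wt xnE.
have -> : find (fun e => (e.1 == u) && (e.2 == v)) (edges_of n) = index (u, v) (edges_of n).
  by apply: eq_find => -[a b] /=; rewrite xpair_eqE.
have Hidx : index (u, v) (edges_of n) < size (edges_of n) by rewrite index_mem mem_edges_of Huv Hu.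
rewrite [x.2.2]/= (nth_map 0); last first.
  apply: leq_trans (_ : size (edges_of n) * k <= _).
    by have := ltn_ord i; nia.
  by have := xZE; rewrite /Z /xZ size_map; lia.
rewrite (nth_flatten_const (0, 0)) ?size_map ?size_enum_ord //.
  by rewrite (nth_map i) ?size_enum_ord // nth_ord_enum nth_index // mem_edges_of Huv Hu.
by move=> e; rewrite size_map size_enum_ord.
Qed.

Lemma size_bits_Z u v (i : 'I_k) : u != v -> u < n -> v < n -> size (bits (w u v i)) <= Z.
Proof.
move=> Huv Hu Hv; rewrite xZE; apply: leq_trans (leq_addl _ _).
have : bits (w u v i) \in x.2.2.
  apply: map_f; apply/flattenP; exists [seq w u v i | i <- enum 'I_k].
    by apply/mapP; exists (u, v); rewrite // mem_edges_of Huv Hu.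
  by apply: map_f; rewrite mem_enum.
elim: x.2.2 => // b l IH; rewrite inE /= size_cat => /orP [/eqP <-|/IH]; first exact: leq_addr.
by move/leq_trans; apply; exact: leq_addl.
Qed.

Lemma Z_lt_xt : Z < 2 ^ xt x.
Proof. by rewrite /xt ubitsE bits_lt. Qed.

Lemma xt_le_Z : 2 ^ xt x <= 2 * Z.
Proof.
have HZ : 0 < Z by have := n_le_Z; lia.
rewrite /xt ubitsE; have := bits_ge HZ; have : 0 < size (bits Z) by rewrite bitsE.
by rewrite -/Z; case: (size _) => // t _; rewrite expnS leq_mul2l.
Qed.

Lemma qvE s m : size (bits m) <= s -> qv x s (bits m) = m %/ 2 ^ (s - xt x).
Proof.
move=> Hs; rewrite /qv ubinE valb_drop valb_bits; apply/minn_idPr.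
apply: leq_trans xt_le_Z; rewrite -/Z; apply: ltnW; rewrite ltn_divLR ?expn_gt0 // -expnD.
by apply: leq_trans (bits_lt m) _; rewrite leq_exp2l //; lia.
Qed.

Lemma qv_le s b : qv x s b <= 2 * Z.
Proof. by rewrite /qv ubinE geq_minl. Qed.

Lemma qcodeE sv u v j :
  qcode k x sv u v j = \sum_(i < j) qv x (nth 0 sv i) (wt k x u v i) * (4 * Z ^ 2) ^ i.
Proof. by elim: j => [|j IH]; rewrite ?big_ord0 // big_ord_recr /= IH. Qed.

Lemma rndE C a b : rnd C x a b = valb (chunk (C * xt x) (a * Z + b) r).
Proof.
rewrite /rnd ubinE -/Z; apply/minn_idPr.
apply: leq_trans (_ : 2 ^ (C * xt x) <= _); last first.
  rewrite (mulnC C) expnM; have [->|HC] := posnP C; first by rewrite !expn0.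
  rewrite leq_exp2r //; exact: xt_le_Z.
apply: ltnW; apply: leq_trans (valb_lt _) _; rewrite leq_exp2l // size_take_min.
exact: geq_minl.
Qed.
End Instance.

(** The leading part is not a digit but an arbitrary number, since the random weights live there. *)
Lemma digits_inj B k (a b : 'I_k -> nat) c d : (forall i, a i < B) -> (forall i, b i < B) ->
  \sum_(i < k) a i * B ^ i + B ^ k * c = \sum_(i < k) b i * B ^ i + B ^ k * d ->
  (forall i, a i = b i) /\ c = d.
Proof.
elim: k a b => [|k IH] a b Ha Hb; first by rewrite !big_ord0 !mul1n !add0n => ->; split=> // -[].
rewrite !big_ord_recl /= !expn0 !muln1.
have E f m : \sum_(i < k) f (lift ord0 i) * B ^ bump 0 i + B ^ k.+1 * m =
    B * (\sum_(i < k) f (lift ord0 i) * B ^ i + B ^ k * m).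
  by rewrite mulnDr big_distrr expnS /=; congr (_ + _); [apply: eq_bigr => i _; rewrite /bump expnS; lia|lia].
rewrite -!addnA !E => H.
have HB : 0 < B by have := Ha ord0; lia.
have H0 : a ord0 = b ord0.
  by have := congr1 (modn^~ B) H; rewrite !(addnC _ (B * _)) !(mulnC B) !modnMDl !modn_small.
move: H; rewrite H0 => /addnI /eqP; rewrite eqn_pmul2l // => /eqP.
case/IH => [i|i|H1 ->]; [exact: Ha|exact: Hb|split=> // i].
by case: (unliftP ord0 i) => [j ->|->] //; exact: H1.
Qed.

(** * Random weights isolate *)

Lemma chunk_take b g e (r : seq bool) : e.+1 * b <= g -> chunk b e (take g r) = chunk b e r.
Proof.
move=> H; apply: (@eq_from_nth _ false).
  by rewrite !size_take_min !size_drop size_take_min; nia.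
move=> i; rewrite size_take_min => Hi; have Hib : i < b by lia.
by rewrite !nth_take // !nth_drop nth_take //; nia.
Qed.

Lemma union_bound p b (Bad : seq {set p.-tuple bool}) :
  (forall S, S \in Bad -> #|S| * 2 ^ b <= 2 ^ p) -> 2 * size Bad <= 2 ^ b ->
  exists A : {set p.-tuple bool}, 2 ^ p <= 2 * #|A| /\
    forall r S, r \in A -> S \in Bad -> r \notin S.
Proof.
move=> HB Hb; pose U := \bigcup_(S <- Bad) S; exists (~: U); split; last first.
  move=> r S; rewrite inE => HU HS; apply: contra HU => Hr.
  by rewrite /U (big_rem S) //= inE Hr.
have HU : #|U| * 2 ^ b <= size Bad * 2 ^ p.
  rewrite /U; elim: Bad HB {Hb U} => [|S l IH] HB; first by rewrite big_nil cards0.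
  rewrite big_cons /=; have H1 := HB S (mem_head _ _).
  have H2 : _ := IH (fun S' H => HB S' (@mem_behead _ (S :: l) S' H)).
  rewrite mulSn; apply: leq_trans (leq_add H1 H2); rewrite -mulnDl leq_mul2r.
  by rewrite (leq_card_setU _ _) orbT.
have HU2 : 2 * #|U| <= 2 ^ p.
  have [E|Hp] := posnP (size Bad).
    by move: HU; rewrite E mul0n leqn0 muln_eq0 expn_eq0 orbF => /eqP ->; rewrite muln0.
  rewrite -(leq_pmul2l Hp); apply: leq_trans HU.
  by rewrite mulnCA mulnA mulnC leq_mul2l Hb orbT.
by have := cardsC U; rewrite card_tuple card_bool; lia.
Qed.

Section Isolate.
Variables (k L n : nat) (w : nat -> nat -> 'I_k -> nat).
Hypotheses (Hk : 0 < k) (Hn : 1 < n).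
(** With y = 2^t > Z and y >= 4 there are at most y^(2L) path systems, y^k threshold vectors, y^(3k)
    codes and y^2 edges. One more factor y brings the total failure probability to at most one
    half. *)
Let C := 2 * L + 4 * k + 3.
Definition Zi := xZ ([::], inst n w).
Definition ti := xt ([::], inst n w).
Local Notation Z := Zi.

Definition ok (P : seq (seq nat)) (sv : seq nat) (a b : nat) :=
  let u := last 0 (nth [::] P a) in let v := head 0 (nth [::] P b) in
  (a != b) && all (fun i => size (wt k ([::], inst n w) u v i) <= nth 0 sv i) (iota 0 k).
Definition qc (P : seq (seq nat)) sv (a b : nat) :=
  qcode k ([::], inst n w) sv (last 0 (nth [::] P a)) (head 0 (nth [::] P b)) k.
(** The families to be isolated: admissible covers with prescribed rounded sums, packed into [c]. *)
Definition cls m P sv c (s : {perm 'I_m}) :=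
  [forall a : 'I_m, ok P sv a (s a)] && (\sum_(a < m) qc P sv a (s a) == c).
Definition rw C (r : seq bool) (a b : nat) := valb (chunk (C * ti) (a * Z + b) r).

Lemma entE C' r P sv a b : ent k C' (r, inst n w) P sv a b =
  if ok P sv a b then [:: qc P sv a b + (4 * Z ^ 2) ^ k * rw C' r a b] else [::].
Proof.
rewrite /ent -[xZ _]/Z rndE //; rewrite -[all _ _]/(all (fun i => size (wt k ([::], inst n w)
  (last 0 (nth [::] P a)) (head 0 (nth [::] P b)) i) <= nth 0 sv i) (iota 0 k)).
by rewrite /ok /qc !qcodeE.
Qed.

Definition gi := Z ^ 2 * (C * ti).

(** The same coins must serve all guesses, hence a union bound over path systems, thresholds, codes
    and edges. It avoids ties, which by [tie_or_unique] isolates every nonempty family. *)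
Lemma isolation p : gi <= p -> exists A : {set p.-tuple bool}, 2 ^ p <= 2 * #|A| /\
  forall (r : p.-tuple bool) P sv c (a b : 'I_(size P)), r \in A ->
    P \in guesses L n -> sv \in svecs k Z -> c < (4 * Z ^ 2) ^ k ->
    ~~ tie (cls P sv c) (fun a b => rw C (take gi r) a b) a b.
Proof.
move=> Hp.
have HnZ : n <= Z by exact: n_le_Z.
pose Bad P sv (c : nat) (ab : 'I_(size P) * 'I_(size P)) : {set p.-tuple bool} :=
  [set r : p.-tuple bool | tie (cls P sv c) (fun a b => rw C (take gi r) a b) ab.1 ab.2].
pose Bads := flatten [seq flatten [seq flatten [seq [seq Bad P sv c ab | ab <- enum {: 'I_(size P) * 'I_(size P)}]
   | c <- iota 0 ((4 * Z ^ 2) ^ k)] | sv <- svecs k Z] | P <- guesses L n].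
have Hidx a b : a < Z -> b < Z -> (a * Z + b).+1 * (C * ti) <= gi.
  by move=> Ha Hb; rewrite leq_mul2r; apply/orP; right; rewrite -mulnn; nia.
have HBad S : S \in Bads -> #|S| * 2 ^ (C * ti) <= 2 ^ p.
  move=> /flattenP [l1 /mapP [P HP ->]] /flattenP [l2 /mapP [sv Hsv ->]].
  move=> /flattenP [l3 /mapP [c _ ->]] /mapP [[a0 b0] _ ->].
  have HPZ : size P <= Z by apply: leq_trans HnZ; exact: size_guesses HP.
  have Ho (a : 'I_(size P)) : a < Z by apply: leq_trans (ltn_ord a) HPZ.
  have Hp' (a b : 'I_(size P)) := leq_trans (Hidx _ _ (Ho a) (Ho b)) Hp.
  apply: (@chunk_determined_card p _ _ (a0 * Z + b0)); first exact: Hp'.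
  move=> r r'; rewrite !inE /= => H1 H2 Hch _ _.
  have Hoff (a b : 'I_(size P)) : (a != a0) || (b != b0) ->
      rw C (take gi r) a b = rw C (take gi r') a b.
    move=> Hab; rewrite /rw !chunk_take ?Hidx // Hch //.
    apply: contraTneq Hab => E.
    have E1 := congr1 (divn^~ Z) E; have E2 := congr1 (modn^~ Z) E.
    rewrite !divnMDl ?divn_small ?addn0 // in E1; try by apply: leq_ltn_trans (Ho a).
    rewrite !modnMDl !modn_small // in E2.
    by rewrite negb_or !negbK; apply/andP; split; apply/eqP/val_inj.
  have := tie_determined Hoff H1 H2; rewrite /rw !chunk_take ?Hidx //.
  apply: valb_inj; rewrite !size_take_min !size_drop !size_tuple //.
have HN : size Bads <= (n ^ 2 + 1) ^ L * ((Z + 1) ^ k * ((4 * Z ^ 2) ^ k * Z ^ 2)).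
  apply: leq_trans (_ : size (guesses L n) * ((Z + 1) ^ k * ((4 * Z ^ 2) ^ k * Z ^ 2)) <= _); last first.
    by rewrite leq_mul2r card_guesses orbT.
  apply: size_flatten_le => P HP.
  apply: leq_trans (_ : size (svecs k Z) * ((4 * Z ^ 2) ^ k * Z ^ 2) <= _); last first.
    by rewrite leq_mul2r card_svecs orbT.
  apply: size_flatten_le => sv _; rewrite -[X in _ <= X * _](size_iota 0).
  apply: size_flatten_le => c _; rewrite size_map -cardE card_prod card_ord -mulnn.
  have H : size P <= Z by apply: leq_trans HnZ; exact: size_guesses HP.
  exact: leq_mul.
have [|A [HA1 HA2]] := union_bound HBad.
  apply: leq_trans (_ : 2 ^ ti * ((2 ^ ti) ^ (2 * L) * ((2 ^ ti) ^ k * ((2 ^ ti) ^ (3 * k) * (2 ^ ti) ^ 2))) <= _).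
    have Hy : Z < 2 ^ ti by exact: Z_lt_xt.
    have Hy4 : 4 <= 2 ^ ti by move: (leq_ltn_trans (leq_trans Hn HnZ) Hy); case: ti => [|[|t]] //; rewrite !expnS; have := expn_gt0 2 t; lia.
    apply: leq_mul; first by apply: leq_trans Hy4.
    apply: leq_trans HN _; apply: leq_mul.
      by rewrite expnM; have [->//|HL] := posnP L; rewrite leq_exp2r // -!mulnn; nia.
    apply: leq_mul; first by rewrite leq_exp2r //; lia.
    apply: leq_mul; last by rewrite leq_exp2r // ltnW.
    rewrite expnM leq_exp2r // (_ : 3 = 1 + 2) // expnD; apply: leq_mul => //.
    by rewrite leq_exp2r // ltnW.
  rewrite -!expnM -!expnD leq_exp2l //; rewrite /C; nia.
exists A; split=> // r P sv c a b Hr HP Hsv Hc.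
have := HA2 r (Bad P sv c (a, b)) Hr; rewrite inE; apply.
apply/flattenP; eexists; first by apply: map_f; exact: HP.
apply/flattenP; eexists; first by apply: map_f; exact: Hsv.
apply/flattenP; eexists; first by apply: map_f; rewrite mem_iota; exact: Hc.
by apply: map_f; rewrite mem_enum.
Qed.
End Isolate.

(** * The isolated cycle cover is found *)

Lemma digits_lt B k (d : 'I_k -> nat) : (forall i, d i < B) -> \sum_(i < k) d i * B ^ i < B ^ k.
Proof.
elim: k d => [|k IH] d Hd; first by rewrite big_ord0.
rewrite big_ord_recr /= expnS; apply: leq_trans (_ : B ^ k + d ord_max * B ^ k <= _).
  by rewrite ltn_add2r; apply: IH.
by rewrite -mulSn leq_mul2r Hd orbT.
Qed.

Lemma leq_sum_const (T : eqType) (l : seq T) (f : T -> nat) b :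
  (forall a, a \in l -> f a <= b) -> \sum_(a <- l) f a <= size l * b.
Proof.
move=> H; apply: leq_trans (_ : \sum_(a <- l) b <= _).
  by rewrite big_seq [X in _ <= X]big_seq; apply: leq_sum.
by rewrite big_const_seq count_predT iter_addn_0 mulnC.
Qed.

Section Found.
Variables (k n C : nat) (w : nat -> nat -> 'I_k -> nat).
Hypotheses (Hk : 0 < k) (Hn : 1 < n).
Variables (r : seq bool) (P : seq (seq nat)) (sv : seq nat) (m : nat).
Local Notation Z := (Zi n w).
Local Notation B := (4 * Z ^ 2).
Hypotheses (HP : size P = m.+1) (Hm : m.+1 <= n).

Definition qd (P : seq (seq nat)) sv (i a b : nat) :=
  qv ([::], inst n w) (nth 0 sv i) (wt k ([::], inst n w) (last 0 (nth [::] P a)) (head 0 (nth [::] P b)) i).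

Lemma qcE a b : qc n w P sv a b = \sum_(i < k) qd P sv i a b * B ^ i.
Proof. exact: qcodeE. Qed.

Lemma sum_qc (T : eqType) (l : seq T) (f g : T -> nat) :
  \sum_(e <- l) qc n w P sv (f e) (g e) = \sum_(i < k) (\sum_(e <- l) qd P sv i (f e) (g e)) * B ^ i.
Proof.
under eq_bigr do rewrite qcE.
by rewrite exchange_big; apply: eq_bigr => i _; rewrite big_distrl.
Qed.

(** The origin of the base: at most [Z] terms of size at most [2 * Z] sum to less than [4 * Z ^ 2],
    so adding codes never carries. *)
Lemma sum_qd_lt (T : eqType) (l : seq T) (f g : T -> nat) i : size l <= m.+1 ->
  \sum_(e <- l) qd P sv i (f e) (g e) < B.
Proof.
move=> Hl; apply: leq_ltn_trans (_ : size l * (2 * Z) < _).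
  by apply: leq_sum_const => e _; exact: qv_le.
have HZ : n <= Z := n_le_Z w [::] Hk Hn; rewrite -mulnn.
have : size l * (2 * Z) <= Z * (2 * Z) by rewrite leq_mul2r; apply/orP; right; lia.
by nia.
Qed.

Let E := adjm k C (r, inst n w) P sv.

Lemma at_E (a b : 'I_m.+1) : at_ E a b =
  if ok n w P sv a b then [:: qc n w P sv a b + B ^ k * rw n w C r a b] else [::].
Proof. by rewrite /E /adjm HP at_tabulate !ltn_ord entE. Qed.

Lemma allowedE (s : {perm 'I_m.+1}) : allowed E s = [forall a : 'I_m.+1, ok n w P sv a (s a)].
Proof. by apply: eq_forallb => a; rewrite at_E; case: ok. Qed.

Lemma psumE (s : {perm 'I_m.+1}) : allowed E s -> psum E s =
  \sum_(i < k) (\sum_(a <- enum 'I_m.+1) qd P sv i a (s a)) * B ^ i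
    + B ^ k * pwt (fun a b : 'I_m.+1 => rw n w C r a b) s.
Proof.
rewrite allowedE => /forallP H; rewrite -sum_qc big_enum /= big_distrr -big_split.
by apply: eq_bigr => a _; rewrite at_E H.
Qed.

(** The rounded sums of [s] select a family [c], and [s0] is its isolated minimizer. The digits of a
    code determine both the family and the random weight, so [s0] is the only allowed permutation of
    code [W]: the coefficient at [W] is odd and [succW] reads off [s0]. *)
Lemma found (s : {perm 'I_m.+1}) :
  (forall a : 'I_m.+1, ok n w P sv a (s a)) ->
  (forall c (a b : 'I_m.+1), c < B ^ k -> ~~ tie (cls n w P sv c) (fun a b => rw n w C r a b) a b) ->
  exists (s0 : {perm 'I_m.+1}) (sg : seq nat),
  [/\ forall u : 'I_m.+1, nth 0 sg u = s0 u,
      forall a : 'I_m.+1, ok n w P sv a (s0 a),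
      forall i : 'I_k, \sum_(a < m.+1) qd P sv i a (s0 a) = \sum_(a < m.+1) qd P sv i a (s a)
    & forall js, size js = size (cycs sg m.+1) -> exists js',
      [/\ size js' = size (cycs sg m.+1),
        forall i : 'I_k, let V js := \sum_(p <- zip js (cycs sg m.+1))
            qd P sv i (last 0 (rot (nat_of_bool p.1) p.2)) (head 0 (rot (nat_of_bool p.1) p.2)) in
          V js' = V js
      & flatten [seq nth [::] P a | a <- ocat js' (cycs sg m.+1)] \in lift_tours k C (r, inst n w) P sv]].
Proof.
move=> Hs Htie; pose c := \sum_(a < m.+1) qc n w P sv a (s a).
have Ec (t : {perm 'I_m.+1}) : \sum_(a < m.+1) qc n w P sv a (t a) =
    \sum_(i < k) (\sum_(a <- enum 'I_m.+1) qd P sv i a (t a)) * B ^ i.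
  by rewrite -sum_qc big_enum.
have Hlt (t : {perm 'I_m.+1}) i : \sum_(a <- enum 'I_m.+1) qd P sv i a (t a) < B.
  by apply: sum_qd_lt; rewrite size_enum_ord.
have Hc : c < B ^ k by rewrite /c Ec; apply: digits_lt.
have Fs : cls n w P sv c s by rewrite /cls eqxx andbT; apply/forallP.
case: (tie_or_unique (fun a b : 'I_m.+1 => rw n w C r a b) Fs) => [[a [b Hab]]|[s0 F0 Hu]].
  by move: (Htie c a b Hc); rewrite Hab.
have Ha0 : allowed E s0 by rewrite allowedE; case/andP: F0.
have Hok0 : forall a : 'I_m.+1, ok n w P sv a (s0 a) by apply/forallP; rewrite -allowedE.
have Ec0 : \sum_(a < m.+1) qc n w P sv a (s0 a) = c by apply/eqP; case/andP: F0.
have Huniq t : allowed E t -> psum E t = psum E s0 -> t = s0.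
  move=> Ht; rewrite !psumE // => /digits_inj [i|i|H1 H2]; [exact: Hlt|exact: Hlt|].
  apply: Hu H2; rewrite /cls -allowedE Ht /= -Ec0 !Ec; apply/eqP.
  by apply: eq_bigr => i _; rewrite H1.
have Em (i j : 'I_m.+1) : size (at_ E i j) <= 1 by rewrite at_E; case: ok.
have Hsucc := succW_perm Em Ha0 erefl Huniq.
set W := psum E s0 in Hsucc Huniq.
have HW : W < size (bdet E m.+1).
  have E0 : [set t : {perm 'I_m.+1} | allowed E t && (psum E t == W)] = [set s0].
    apply/setP => t; rewrite !inE; apply/andP/eqP => [[H1 /eqP H2]|->]; first exact: Huniq.
    by rewrite Ha0 eqxx.
  have := bdet_parity W Em; rewrite E0 cards1 ltnNge => H.
  by apply/negP => Hle; move: H; rewrite nth_default.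
pose sg := mkseq (succW E m.+1 W) m.+1.
have Hsg (u : 'I_m.+1) : nth 0 sg u = s0 u by rewrite nth_mkseq.
exists s0, sg; split=> //.
  move=> i; have := Ec0; rewrite /c !Ec => H.
  have [] := @digits_inj B k (fun i => \sum_(a <- enum 'I_m.+1) qd P sv i a (s0 a))
    (fun i => \sum_(a <- enum 'I_m.+1) qd P sv i a (s a)) 0 0 (Hlt s0) (Hlt s).
    by rewrite H.
  by move=> /(_ i); rewrite !big_enum.
move=> js Hjs.
have [js' [Hjs' Hsum] Ho] := tours_complete Hsucc erefl Hjs.
exists js'; split=> //; last first.
  apply/flattenP; eexists; first by apply: map_f; rewrite mem_iota HP; exact: HW.
  by apply: map_f; rewrite HP.
have Hsz : size (cycs sg m.+1) <= m.+1.
  rewrite -[X in _ <= X](size_iota 0) -(perm_size (cycs_perm Hsg)) size_flatten sumnE big_map.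
  rewrite -sum1_size big_seq [X in _ <= X]big_seq; apply: leq_sum => cy /(cycs_cyc Hsg) [x ->].
  by rewrite size_map size_orbit order_gt0.
pose cl (p : bool * seq nat) := rot (nat_of_bool p.1) p.2.
have EV js1 : size js1 = size (cycs sg m.+1) -> csum E js1 (cycs sg m.+1) =
    \sum_(i < k) (\sum_(p <- zip js1 (cycs sg m.+1)) qd P sv i (last 0 (cl p)) (head 0 (cl p))) * B ^ i
     + B ^ k * \sum_(p <- zip js1 (cycs sg m.+1)) rw n w C r (last 0 (cl p)) (head 0 (cl p)).
  move=> Hj; rewrite -sum_qc big_distrr -big_split /csum [LHS]big_seq [RHS]big_seq.
  apply: eq_bigr => -[j cy] Hjc; rewrite /rcode -/(cl (j, cy)).
  have Hcy : cy \in cycs sg m.+1 by rewrite -(unzip2_zip (eq_leq (esym Hj))); apply/mapP; exists (j, cy).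
  have [x Ex] := cycs_cyc Hsg Hcy.
  have Hf : fcycle (nth 0 sg) (cl (j, cy)) by rewrite /cl rot_cycle; apply: is_cyc_fcycle Hsg _ (cycs_cyc Hsg Hcy).
  have Hl : forall u, u \in cl (j, cy) -> u < m.+1.
    by move=> u; rewrite /cl mem_rot [X in _ \in X]/= Ex => /mapP [y _ ->]; exact: ltn_ord.
  case El : (cl (j, cy)) Hf Hl => [|y q].
    by have := congr1 size El; rewrite size_rot Ex size_map size_orbit => H0; have := order_gt0 s0 x; rewrite H0.
  rewrite /= rcons_path => /andP [_ /eqP Ey] /(_ _ (mem_last y q)) Hlast.
  have := at_E (Ordinal Hlast) (s0 (Ordinal Hlast)); rewrite Hok0 -Hsg /= Ey => -> //.
have Hlt' js1 i : size js1 = size (cycs sg m.+1) ->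
    \sum_(p <- zip js1 (cycs sg m.+1)) qd P sv i (last 0 (cl p)) (head 0 (cl p)) < B.
  by move=> H; apply: sum_qd_lt; rewrite size_zip H minnn.
move=> i V; move: Hsum; rewrite !EV // => /digits_inj [i'|i'|H _]; [exact: Hlt'|exact: Hlt'|].
exact: H.
Qed.
End Found.

(** * The approximation guarantee *)

Lemma pw_fcycle (T : eqType) (W V : T -> T -> nat) d (f : T -> T) c :
  fcycle f c -> (forall u, u \in c -> d * W u (f u) <= V u (f u)) -> d * pw W c <= pw V c.
Proof.
case: c => [|x p] /=; first by rewrite muln0.
rewrite rcons_path => /andP [Hp _]; elim: p x Hp => [|y p IH] x /=; first by rewrite muln0.
move=> /andP [/eqP Ey Hp] H; rewrite mulnDr leq_add //.
  by rewrite -Ey; apply: H; rewrite mem_head.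
by apply: IH => // u Hu; apply: H; rewrite inE Hu orbT.
Qed.

Lemma ocat_perm js cs : size js = size cs -> perm_eq (ocat js cs) (flatten cs).
Proof.
elim: js cs => [|j js IH] [|c cs] // [/IH H].
by rewrite /ocat /=; apply: perm_cat; rewrite ?perm_rot.
Qed.

Section Cover.
Variables (M : nat) (s0 : {perm 'I_M}) (sg : seq nat).
Hypothesis Hsg : forall u : 'I_M, nth 0 sg u = s0 u.
Let cs := cycs sg M.

Lemma cycs_lt c u : c \in cs -> u \in c -> u < M.
Proof. by move=> /(cycs_cyc Hsg) [x ->] /mapP [y _ ->]; exact: ltn_ord. Qed.

(** Cycle by cycle the rounded weight splits into that of the path left after opening and that of
    the closing edge; the former, scaled back by [d], is paid for by [W]. *)
Lemma kept_bound (q W : nat -> nat -> nat) d js : size js = size cs ->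
  (forall u : 'I_M, d * q u (s0 u) <= W u (s0 u)) ->
  d * \sum_(u < M) q u (s0 u) <= pw W (ocat js cs) +
    d * \sum_(p <- zip js cs) q (last 0 (rot (nat_of_bool p.1) p.2)) (head 0 (rot (nat_of_bool p.1) p.2)).
Proof.
move=> Hjs HW.
have -> : \sum_(u < M) q u (s0 u) = \sum_(p <- zip js cs) \sum_(u <- p.2) q u (nth 0 sg u).
  rewrite -(big_map snd xpredT (fun c => \sum_(u <- c) q u (nth 0 sg u))).
  rewrite -/(unzip2 _) unzip2_zip ?Hjs // (sum_cycs Hsg).
  by apply: eq_bigr => u _; rewrite Hsg.
have HP : \sum_(p <- zip js cs) pw W (rot (nat_of_bool p.1) p.2) <= pw W (ocat js cs).
  by rewrite /ocat -(big_map (fun p => rot (nat_of_bool p.1) p.2) xpredT (pw W)) pw_flatten.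
apply: leq_trans (leq_add HP (leqnn _)).
rewrite !big_distrr -big_split /= big_seq [X in _ <= X]big_seq.
apply: leq_sum => -[j c] Hjc /=.
have Hc : c \in cs by rewrite -(unzip2_zip (eq_leq (esym Hjs))); apply/mapP; exists (j, c).
have Hf := is_cyc_fcycle Hsg (cycs_cyc Hsg Hc).
rewrite -(rot_cyc_cw q j Hf) (cwE _ 0) mulnDr leq_add //; last by case: rot => [|? ?]; rewrite ?muln0.
apply: pw_fcycle; first by rewrite rot_cycle; exact: Hf.
move=> u; rewrite mem_rot => /(cycs_lt Hc) Hu; have := HW (Ordinal Hu); by rewrite -Hsg.
Qed.

(** Without fixed points every cycle has length at least 2, so its two candidate closing edges are
    distinct and together weigh at most the cycle. *)
Lemma pair_bound (q : nat -> nat -> nat) : (forall u, s0 u != u) ->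
  \sum_(c <- cs) (q (last 0 (rot 0 c)) (head 0 (rot 0 c)) + q (last 0 (rot 1 c)) (head 0 (rot 1 c)))
  <= \sum_(u < M) q u (s0 u).
Proof.
move=> Hne; have -> : \sum_(u < M) q u (s0 u) = \sum_(u < M) q u (nth 0 sg u).
  by apply: eq_bigr => u _; rewrite Hsg.
rewrite -(sum_cycs Hsg (fun u => q u (nth 0 sg u))) big_seq [X in _ <= X]big_seq.
apply: leq_sum => c Hc; have H := cycs_cyc Hsg Hc; have := size_cyc Hne H.
rewrite -(rot_cyc_cw q 0 (is_cyc_fcycle Hsg H)) rot0.
case: c {H Hc} => [|x [|y p]] // _; rewrite (cwE q 0) rot1_cons last_rcons /=; lia.
Qed.

Lemma closing_edge j c : c \in cs -> exists2 u : 'I_M, last 0 (rot j c) = u & head 0 (rot j c) = s0 u.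
Proof.
move=> Hc; have Hf : fcycle (nth 0 sg) (rot j c).
  by have Hf0 := is_cyc_fcycle Hsg (cycs_cyc Hsg Hc); rewrite rot_cycle; exact: Hf0.
have Hl u : u \in rot j c -> u < M by rewrite mem_rot; exact: cycs_lt.
case El : (rot j c) Hf Hl => [|y p].
  have [x Ex] := cycs_cyc Hsg Hc; have := congr1 size El.
  by rewrite size_rot Ex size_map size_orbit => H0; have := order_gt0 s0 x; rewrite H0.
rewrite /= rcons_path => /andP [_ /eqP Ey] /(_ _ (mem_last y p)) Hlast.
by exists (Ordinal Hlast); rewrite -?Hsg /= ?Ey.
Qed.
End Cover.

Lemma uniq_flatten (P : seq (seq nat)) : all nonempty P -> uniq (flatten P) -> uniq P.
Proof.
elim: P => //= b P IH /andP [Hb HP]; rewrite cat_uniq => /and3P [_ Hd /(IH HP) ->]; rewrite andbT.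
apply: contra Hd; case: b Hb => // x b _ H; apply/hasP; exists x; last exact: mem_head.
by apply/flattenP; exists (x :: b); rewrite ?mem_head.
Qed.

Lemma flatten_disjoint (P : seq (seq nat)) a b x : uniq (flatten P) ->
  a < size P -> b < size P -> x \in nth [::] P a -> x \in nth [::] P b -> a = b.
Proof.
elim: P a b => // c P IH a b; rewrite /= cat_uniq => /and3P [_ Hd HU].
have H : forall a, a < size P -> x \in c -> x \in nth [::] P a -> False.
  move=> a' Ha Hc Hx; case/negP: Hd; apply/hasP; exists x => //.
  by apply/flattenP; exists (nth [::] P a') => //; exact: mem_nth.
case: a b => [|a] [|b] //=; rewrite ?ltnS => Ha Hb Hxa Hxb.
- by case: (H b).
- by case: (H a).
- by rewrite (IH a b).
Qed.

Lemma sum_subset (h l : seq nat) (F : pred nat) (f : nat -> nat) : uniq h -> uniq l ->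
  {subset h <= l} -> (forall u, u \in h -> F u) -> \sum_(u <- h) f u <= \sum_(u <- l | F u) f u.
Proof.
move=> Hh Hl Hs HF; have Hp : perm_eq h [seq u <- l | u \in h].
  apply: uniq_perm => // [|u]; first exact: filter_uniq.
  by rewrite mem_filter; case: (boolP (u \in h)) => // /Hs ->.
rewrite (perm_big _ Hp) /= big_filter [X in _ <= X](bigID (fun u => u \in h)) /=.
apply: leq_trans (leq_addr _ _); rewrite big_mkcond [X in _ <= X]big_mkcond /=.
by apply: leq_sum => u _; case: (boolP (u \in h)) => [/HF ->|].
Qed.

Section Approx.
Variables (k n : nat) (w : nat -> nat -> 'I_k -> nat).
Hypotheses (Hk : 0 < k) (Hn : 1 < n).
Let K := 4 * k + 2.
Let L := k * K.
Local Notation Z := (Zi n w).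
Local Notation t := (ti n w).
Local Notation wi i := (fun u v => w u v i).

Lemma ham_orderE s : ham_order n s = perm_eq s (iota 0 n).
Proof.
rewrite /ham_order Hn /=; apply/and3P/idP => [[/eqP Hsz Hu /allP Hlt]|H].
  have Hsub : {subset s <= iota 0 n} by move=> u /Hlt; rewrite mem_iota.
  have [_ H] := uniq_min_size Hu Hsub (eq_leq (etrans (size_iota 0 n) (esym Hsz))).
  by apply: uniq_perm => //; exact: iota_uniq.
rewrite (perm_size H) size_iota (perm_uniq H) iota_uniq eqxx; split=> //.
by rewrite (perm_all _ H); apply/allP => u; rewrite mem_iota.
Qed.

Lemma path_ends P a : perm_eq (flatten P) (iota 0 n) -> all nonempty P -> a < size P ->
  [/\ last 0 (nth [::] P a) \in nth [::] P a, head 0 (nth [::] P a) \in nth [::] P a,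
   last 0 (nth [::] P a) < n & head 0 (nth [::] P a) < n].
Proof.
move=> HP Hne Ha; have Hb := mem_nth [::] Ha.
have Hlt u : u \in nth [::] P a -> u < n.
  move=> Hu; have : u \in iota 0 n by rewrite -(perm_mem HP); apply/flattenP; eexists; eauto.
  by rewrite mem_iota.
have := allP Hne _ Hb; case E : (nth [::] P a) Hlt => [|x b] // Hlt _ /=.
by split; rewrite ?mem_last ?mem_head // Hlt ?mem_last ?mem_head.
Qed.

Lemma path_ends_neq P a b : perm_eq (flatten P) (iota 0 n) -> all nonempty P ->
  a < size P -> b < size P -> a != b -> last 0 (nth [::] P a) != head 0 (nth [::] P b).
Proof.
move=> HP Hne Ha Hb; apply: contraNneq => E.
have [H1 _ _ _] := path_ends HP Hne Ha; have [_ H2 _ _] := path_ends HP Hne Hb.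
apply/eqP; apply: flatten_disjoint Ha Hb H1 _; last by rewrite E.
by rewrite (perm_uniq HP) iota_uniq.
Qed.

Lemma ok_edge P sv a b (i : 'I_k) : perm_eq (flatten P) (iota 0 n) -> all nonempty P ->
  a < size P -> b < size P -> ok n w P sv a b ->
  qd n w P sv i a b = jw (wi i) (nth [::] P a) (nth [::] P b) %/ 2 ^ (nth 0 sv i - t) /\
  jw (wi i) (nth [::] P a) (nth [::] P b) < 2 ^ nth 0 sv i.
Proof.
move=> HP Hne Ha Hb /andP [Hab /allP /(_ (i : nat))]; rewrite mem_iota ltn_ord => /(_ isT).
have [_ _ H1 _] := path_ends HP Hne Ha; have [_ _ _ H2] := path_ends HP Hne Hb.
have H3 := path_ends_neq HP Hne Ha Hb Hab.
rewrite /qd wtE // => H; split; first exact: qvE.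
by apply: leq_trans (bits_lt _) _; rewrite leq_exp2l.
Qed.

Lemma tour_blocks s : ham_order n s -> L + 1 < n -> exists P sv m,
  [/\ size P = m.+1 /\ m < n, P \in guesses L n /\ sv \in svecs k Z,
   perm_eq (flatten P) (iota 0 n) /\ all nonempty P,
   exists2 sg : {perm 'I_m.+1}, forall a : 'I_m.+1, ok n w P sv a (sg a) &
     forall i, cw (wi i) s = \sum_(b <- P) pw (wi i) b
       + \sum_(a < m.+1) jw (wi i) (nth [::] P a) (nth [::] P (sg a)) &
   forall i : 'I_k, 0 < nth 0 sv i -> K * 2 ^ (nth 0 sv i).-1 <= \sum_(b <- P) pw (wi i) b].
Proof.
move=> Hs HLn; have /and4P [_ /eqP Hsz Hu Hlt] := Hs.
have Hperm : perm_eq s (iota 0 n) by rewrite -ham_orderE.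
pose g := next s.
have Hg u : u \in s -> [/\ u != g u, u < n & g u < n].
  move=> Hus; split; [|exact: (allP Hlt)|by apply: (allP Hlt); rewrite mem_next].
  by rewrite eq_sym next_neq // Hsz.
(* A vertex stands for the tour edge that leaves it. *)
have [|F [sv [HF Hlow Hh]]] := @heavy s k K (fun i u => size (bits (w u (g u) i))) Hu.
  by rewrite Hsz; move: HLn; rewrite /L; nia.
(* An unmarked edge at which the tour is cut open: [s'] is rotated to end in [u0], so that no path
   of marked edges wraps around. *)
have [u0 Hu0 HFu0] : exists2 u, u \in s & ~~ F u.
  apply/hasP; rewrite has_predC all_count Hsz; apply: contraTN HF => /eqP ->.
  by rewrite -ltnNge; move: HLn; rewrite /L; lia.
pose s' := rot 1 (rot (index u0 s) s).
have Hu' : uniq s' by rewrite !rot_uniq.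
have Hp' : perm_eq s' s by rewrite /s' !perm_rot.
have Hc' : fcycle g s'.
  have -> : fcycle g s' = fcycle g s by rewrite /s' !rot_cycle.
  exact: cycle_next.
have [x0 [p [Es' El]]] : exists x0 p, s' = x0 :: p /\ last x0 p = u0.
  have := erefl (size s'); rewrite {2}/s' rot_index // rot1_cons.
  case Es : (_ ++ _) (perm_size Hp') => [|x q] H1 H2; last by exists x, (rcons q u0); rewrite last_rcons; split=> //; rewrite /s' rot_index // Es rot1_cons.
  by move: H1; rewrite H2 Hsz /=; lia.
pose P' := blocks F x0 p.
have Ef : flatten P' = s' by rewrite flatten_blocks Es'.
have HneP' : all nonempty P' by exact: blocks_nonempty.
have [HszP' HlastP'] : size P' = count (predC F) (x0 :: p) /\ all (fun b => ~~ F (last 0 b)) P'.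
  by apply: blocks_last; rewrite El.
have Hcount : count F (x0 :: p) + size P' = n.
  by rewrite HszP' count_predC -Es' (perm_size Hp').
have HFs : count F (x0 :: p) = count F s by rewrite -Es'; exact: (seq.permP Hp').
have HPn : perm_eq (flatten P') (iota 0 n) by rewrite Ef; exact: perm_trans Hperm.
have [|P HP HPP'] := @guesses_complete L n P' HPn HneP'.
  by rewrite -Hcount addnK HFs.
have HPn2 : perm_eq (flatten P) (iota 0 n) by exact: perm_trans (perm_flatten HPP') HPn.
have HneP : all nonempty P by rewrite (perm_all _ HPP').
have HPu : uniq P by apply: uniq_flatten => //; rewrite (perm_uniq HPn2) iota_uniq.
(* At most [L] edges are marked and [n > L + 1], so two paths remain and the contracted tour has no
   fixed point. *)
have HP2 : 1 < size P.
  rewrite (perm_size HPP'); apply: contraTT HLn; rewrite -!leqNgt -Hcount HFs => H.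
  exact: leq_add HF H.
pose svl := [seq sv i | i <- enum 'I_k].
have Hsv (i : 'I_k) : nth 0 svl i = sv i by rewrite (nth_map i) ?size_enum_ord // nth_ord_enum.
have HsvZ i : sv i <= Z.
  have [h [_ Hhs Hsub HhF]] := Hh i; case: h Hhs Hsub HhF => [|u h] Hhs Hsub HhF.
    by exfalso; move: Hhs; rewrite /K addn2.
  have [_ H] := HhF u (mem_head _ _); apply: leq_trans H _.
  have [H1 H2 H3] := Hg u (Hsub u (mem_head _ _)).
  exact: (size_bits_Z w [::]).
have Hsg : forall M, size P = M -> exists2 sg : {perm 'I_M}, forall a : 'I_M, ok n w P svl a (sg a) &
    forall V, \sum_(a < M) V (nth [::] P a) (nth [::] P (sg a)) = cw V P'.
  move=> M <-; exists (cperm HPP' HPu); last by move=> V; exact: sum_cperm.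
  move=> a; set sg := cperm _ _.
  have Hne : (a : nat) != sg a by rewrite eq_sym; exact: cperm_neq.
  have Hedge : head 0 (nth [::] P (sg a)) = g (last 0 (nth [::] P a)).
    apply/eqP; apply: (@cperm_rel _ _ HPP' HPu (fun b c => head 0 c == g (last 0 b))).
    by apply: fcycle_flatten => //; rewrite Ef.
  have [H1 _ H3 _] := path_ends HPn2 HneP (ltn_ord a).
  have Hus : last 0 (nth [::] P a) \in s.
    by rewrite (perm_mem Hperm) mem_iota.
  have [G1 G2 G3] := Hg _ Hus.
  rewrite /ok Hne /=; apply/allP => i; rewrite mem_iota add0n => /= Hi.
  rewrite Hedge (Hsv (Ordinal Hi)) -[i]/(nat_of_ord (Ordinal Hi)) wtE //; apply: Hlow => //.
  by apply: (allP HlastP'); rewrite -(perm_mem HPP') mem_nth.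
have Hpath : fpath g x0 p by move: Hc'; rewrite Es' /= rcons_path => /andP [].
case EP : (size P) => [|m]; first by rewrite EP in HP2.
have [sg Hok HV] := Hsg _ EP.
exists P, svl, m; split.
- by split=> //; rewrite -ltnS -EP ltnS; exact: size_guesses HP.
- split=> //; apply: svecs_complete; first by rewrite size_map size_enum_ord.
  by apply/allP => v /mapP [i _ ->].
- by [].
- exists sg => // i.
  rewrite (HV (jw (wi i))) (perm_big _ HPP') /= -cw_flattenE // Ef (fcycle_cw _ Hc').
  by rewrite (fcycle_cw _ (cycle_next Hu)) (perm_big _ Hp').
move=> i; rewrite Hsv => Hi; rewrite (perm_big _ HPP') /= (blocks_pw _ (wi i) Hpath).
have [h [Hhu Hhs Hsub HhF]] := Hh i.
apply: leq_trans (_ : \sum_(u <- h) w u (g u) i <= _); last first.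
  apply: sum_subset => //.
  - by move: Hu'; rewrite Es' lastI rcons_uniq => /andP [].
  - move=> u Huh; have : u \in s' by rewrite (perm_mem Hp') Hsub.
    rewrite Es' lastI mem_rcons inE El => /orP [/eqP Eu|//].
    by have [] := HhF u Huh; rewrite Eu (negbTE HFu0).
  - by move=> u /HhF [].
have -> : K * 2 ^ (sv i).-1 = \sum_(u <- h) 2 ^ (sv i).-1.
  by rewrite big_const_seq count_predT iter_addn_0 Hhs mulnC.
rewrite big_seq [X in _ <= X]big_seq.
apply: leq_sum => u Huh; have [_ Hsz'] := HhF u Huh.
apply: leq_trans (_ : 2 ^ (size (bits (w u (g u) i))).-1 <= _).
  by rewrite leq_exp2l // -!subn1 leq_sub2r.
apply: bits_ge; rewrite lt0n; apply: contraTneq Hsz' => ->.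
by rewrite -ltnNge.
Qed.
End Approx.

Section Final.
Variables (k n : nat) (w : nat -> nat -> 'I_k -> nat).
Hypotheses (Hk : 0 < k) (Hn : 1 < n).
Let K := 4 * k + 2.
Let L := k * K.
Let C := 2 * L + 4 * k + 3.
Local Notation Z := (Zi n w).
Local Notation t := (ti n w).
Local Notation wi i := (fun u v => w u v i).

(* For one component, [I] is the weight inside the paths, [T] that of the edges joining
   them, [V] what is kept of [T]; [tq] and [lost] are counted in multiples of [d]. *)
Lemma account s d Q m I T V tq lost : d = 2 ^ (s - t) -> Q = 2 ^ minn s t -> m < n ->
  (0 < s -> K * 2 ^ s.-1 <= I) -> (s = 0 -> T = 0) ->
  T <= d * tq + m.+1 * d.-1 -> d * tq <= V + d * lost -> 2 * lost <= tq + 2 * k * Q ->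
  I + T <= 2 * (I + V).
Proof.
move=> Ed EQ Hm HI HT HTq HV Hl.
have [s0|spos] := posnP s; first by rewrite HT //; lia.
have EdQ : d * Q = 2 ^ s by rewrite Ed EQ -expnD; congr (2 ^ _); lia.
have E2 : 2 ^ s = 2 * 2 ^ s.-1 by rewrite -expnS prednK.
(* The total rounding error. If [s <= t] nothing is rounded; otherwise there are
   [m.+1 <= n <= Z < 2 ^ t] edges, each losing at most [d - 1]. *)
have Hmd : m.+1 * d.-1 <= 2 ^ s.
  have [Hst|Hst] := leqP s t.
    have -> : d = 1 by rewrite Ed (_ : s - t = 0) //; lia.
    by rewrite muln0.
  apply: leq_trans (_ : Q * d <= _); last by rewrite mulnC EdQ.
  apply: leq_mul; last exact: leq_pred.
  rewrite EQ (minn_idPr (ltnW Hst)).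
  have H1 : n <= Z := n_le_Z w [::] Hk Hn; have H2 : Z < 2 ^ t := Z_lt_xt _ _ _.
  by apply: leq_trans Hm _; apply: leq_trans H1 (ltnW H2).
have := HI spos; rewrite /K => HIs.
have HdQ : d * (2 * lost) <= d * tq + 2 * k * (d * Q).
  by apply: leq_trans (_ : d * (tq + 2 * k * Q) <= _); [rewrite leq_mul2l Hl orbT|rewrite mulnDr; lia].
move: HdQ; rewrite EdQ E2 => HdQ; rewrite E2 in Hmd.
set p := 2 ^ s.-1 in HIs HdQ Hmd *.
have Ek : 2 * k * (2 * p) = 4 * (k * p) by lia.
have Ek' : (4 * k + 2) * p = 4 * (k * p) + 2 * p by rewrite mulnDl; lia.
rewrite Ek in HdQ; rewrite Ek' in HIs.
have El : d * (2 * lost) = 2 * (d * lost) by lia.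
rewrite El in HdQ; lia.
Qed.

Lemma approx (r : seq bool) :
  (forall P sv c (a b : 'I_(size P)), P \in guesses L n -> sv \in svecs k Z -> c < (4 * Z ^ 2) ^ k ->
     ~~ tie (cls n w P sv c) (fun a b => rw n w C r a b) a b) ->
  forall s, ham_order n s ->
  exists2 o, o \in sols k L C (r, inst n w) & forall i, cw (wi i) s <= 2 * cw (wi i) o.
Proof.
move=> Hgood s Hs.
have Hsol o : ham_order n o -> o \in cands k L C (r, inst n w) -> o \in sols k L C (r, inst n w).
  by move=> H1 H2; rewrite mem_filter xnE // H1.
have [Hsmall|Hbig] := leqP n (L + 1).
  exists s; last by move=> i; rewrite leq_pmull.
  have Hp : perm_eq (flatten [:: s]) (iota 0 n) by rewrite /= cats0 -ham_orderE.
  have [||P HP1 HP2] := @guesses_complete L n [:: s] Hp.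
  - by have /and4P [_ /eqP Hz _ _] := Hs; rewrite /= andbT /nonempty -size_eq0 Hz; lia.
  - by rewrite /=; lia.
  apply: Hsol => //; apply/flattenP; eexists; first by apply: map_f; rewrite xnE //; exact: HP1.
  by rewrite (perm_small_eq (isT : size [:: s] <= 1) HP2) /= cats0 mem_head.
have [P [sv [m [[EP Hm] [HPg Hsv] [HP Hne] [sg Hok Hcw] HI]]]] := tour_blocks w Hk Hn Hs Hbig.
have Htie c (a b : 'I_m.+1) : c < (4 * Z ^ 2) ^ k ->
    ~~ tie (cls n w P sv c) (fun a b => rw n w C r a b) a b.
  move=> Hc; have H := fun a b => Hgood P sv c a b HPg Hsv Hc.
  by move: a b; rewrite -EP.
have [s0 [sq [Hsq Hok0 Hq Htours]]] := found Hk Hn EP Hm Hok Htie.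
set cs := cycs sq m.+1 in Htours.
pose J i a b := jw (wi i) (nth [::] P a) (nth [::] P b).
have Hedge (i : 'I_k) (a b : 'I_m.+1) : ok n w P sv a b ->
    qd n w P sv i a b = J i a b %/ 2 ^ (nth 0 sv i - t) /\ J i a b < 2 ^ nth 0 sv i.
  by move=> H; apply: ok_edge => //; rewrite EP.
pose Q (i : 'I_k) := 2 ^ minn (nth 0 sv i) t.
have HQ (i : 'I_k) (a b : 'I_m.+1) : ok n w P sv a b -> qd n w P sv i a b <= Q i.
  move=> H; have [-> H2] := Hedge i a b H; apply: ltnW; rewrite ltn_divLR ?expn_gt0 // -expnD.
  by apply: leq_trans H2 _; rewrite leq_exp2l //; lia.
pose cl j (c : seq nat) (i : 'I_k) := qd n w P sv i (last 0 (rot j c)) (head 0 (rot j c)).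
have Hcl c i : c \in cs -> cl 0 c i <= Q i /\ cl 1 c i <= Q i.
  move=> Hc; have [u Eu Ev] := closing_edge Hsq 0 Hc; have [u' Eu' Ev'] := closing_edge Hsq 1 Hc.
  by rewrite /cl Eu Ev Eu' Ev'; split; apply: HQ.
have [js Hjs Hbal] := balanced_choice Hcl.
(* The tour in the output comes from [js']; [Hlost] transfers the balance of [js] to it. *)
have [js' [Hjs' Hlost Ho]] := Htours js Hjs.
set o := ocat js' cs in Ho.
have Hoc : perm_eq o (iota 0 m.+1).
  by apply: perm_trans (ocat_perm Hjs') (cycs_perm Hsq).
have HoP : perm_eq [seq nth [::] P a | a <- o] P.
  have E : [seq nth [::] P a | a <- iota 0 m.+1] = P by rewrite -EP; exact: mkseq_nth.
  by have := perm_map (nth [::] P) Hoc; rewrite E.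
exists (flatten [seq nth [::] P a | a <- o]).
  apply: Hsol; first by rewrite ham_orderE //; exact: perm_trans (perm_flatten HoP) HP.
  apply/flattenP; eexists; first by apply: map_f; rewrite xnE //; exact: HPg.
  rewrite inE; apply/orP; right; apply/flattenP; eexists; first by apply: map_f; exact: Hsv.
  exact: Ho.
move=> i; rewrite Hcw cw_flattenE ?(perm_all _ HoP) // (perm_big _ HoP) /=.
set I := \sum_(b <- P) _; set T := \sum_(a < m.+1) _.
have Hok_s0 : forall u, s0 u != u.
  by move=> u; have /andP [H _] := Hok0 u; rewrite eq_sym.
apply: leq_trans (_ : I + T <= 2 * (I + pw (J i) o)) _; last first.
  by rewrite leq_mul2l leq_add2l /= (cwE _ [::]) pw_map leq_addr.
have Hdiv (u v : 'I_m.+1) : ok n w P sv u v -> 2 ^ (nth 0 sv i - t) * qd n w P sv i u v <= J i u v.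
  by move=> H; have [-> _] := Hedge i u v H; rewrite mulnC leq_trunc_div.
have HV := kept_bound Hsq Hjs' (fun u => Hdiv u (s0 u) (Hok0 u)).
apply: (account (erefl _) (erefl (Q i)) Hm (HI i) _ _ HV).
- move=> Es; rewrite /T big1 // => a _.
  by have [_] := Hedge i a (sg a) (Hok a); rewrite Es ltnS leqn0 => /eqP.
- set e := (2 ^ _).-1; have -> : m.+1 * e = \sum_(a < m.+1) e by rewrite sum_nat_const card_ord.
  rewrite Hq big_distrr -big_split /= /e.
  apply: leq_sum => a _; have [-> _] := Hedge i a (sg a) (Hok a).
  rewrite -[X in X <= _]/(J i a (sg a)) {1}(divn_eq (J i a (sg a)) (2 ^ (nth 0 sv i - t))) mulnC leq_add2l.
  by rewrite -ltnS prednK ?expn_gt0 // ltn_mod expn_gt0.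
have := Hlost i; rewrite /= => ->.
have -> : \sum_(p <- zip js cs) qd n w P sv i (last 0 (rot (nat_of_bool p.1) p.2))
    (head 0 (rot (nat_of_bool p.1) p.2)) = \sum_(p <- zip js cs) (if p.1 then cl 1 p.2 i else cl 0 p.2 i).
  by apply: eq_bigr => -[[] c] _.
apply: leq_trans (Hbal i) _; rewrite leq_add2r.
exact: (pair_bound Hsq).
Qed.
End Final.

(* There is a randomized Turing machine M and a polynomial p(N) = c*N^c + c such that on
   every instance G (of encoding length N) and every coin string of length p(N), M halts
   within p(N) steps outputting (the encoding of) a set of Hamiltonian cycles, and for a
   set of coin strings of probability >= 1/2 this set 1/2-approximates every Hamiltonian cycle. *)
Theorem theorem14 (k : nat) (hk : 1 <= k) :
  exists (M : TM) (c : nat),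
    forall (n : nat) (w : nat -> nat -> 'I_k -> nat),
      let x := encG n w in
      let p := c * size x ^ c + c in
      (forall r : p.-tuple bool,
         exists S, runs_to M p x r (encS S) /\ all (ham_order n) S) /\
      (exists A : {set p.-tuple bool},
         2 ^ p <= 2 * #|A| /\
         forall r, r \in A ->
           exists S, runs_to M p x r (encS S) /\ half_approx_set n w S).
Proof.
pose L := k * (4 * k + 2); pose C := 2 * L + 4 * k + 3.
pose X := (seq bool * seq (seq bool))%type.
(* One block of coins for each of the at most [Z ^ 2] edges; on an instance this is the [gi] of
   [isolation]. *)
pose g (a : X) := xZ ([::], a) ^ 2 * (C * xt ([::], a)).
have Hg : FP g.
  have Hx : FP (fun a : X => ([::], a) : inp) by fps.
  have HZ := FP_xZ Hx; have Ht := FP_xt Hx.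
  by rewrite /g; apply: FP_muln; [fps|apply: FP_muln; fp].
have H2 (a : X) : 1 < size (encode a).
  case: a => [u v]; rewrite size_encode_pair.
  have Hpos T (ET : encodable T) (l : seq T) : 0 < size (encode l) by rewrite size_encode_seq.
  exact: (leq_add (Hpos _ _ u) (Hpos _ _ v)).
have [M [c HM]] := randomized (FP_alg k L C) Hg H2.
exists M, c => n w x p.
have Erun (r : p.-tuple bool) : g (inst n w) <= p /\
    runs_to M p x r (encS (sols k L C (take (g (inst n w)) r, inst n w))).
  have := HM (inst n w) r; rewrite -encG_inst -/x size_tuple => /(_ erefl) [H1 H3].
  by split=> //; rewrite -encode_solutions.
have Hall r : all (ham_order n) (sols k L C (r, inst n w)).
  have [Hn|Hn] := leqP n 1; last by rewrite /sols xnE // filter_all.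
  suff -> : sols k L C (r, inst n w) = [::] by [].
  have Ex : xn (r, inst n w) <= 1.
    by rewrite /xn ubinE valb_bits geq_min Hn orbT.
  rewrite /sols -(filter_pred0 (cands k L C (r, inst n w))); apply: eq_filter => o.
  by rewrite /ham_order ltnNge Ex.
split=> [r|]; first by eexists; split; [exact: (Erun r).2|].
(* Fewer than two vertices admit no Hamiltonian cycle, so every coin string is good. *)
have [Hn|Hn] := leqP n 1.
  exists setT; rewrite cardsT card_tuple card_bool leq_pmull //; split=> // r _.
  exists (sols k L C (take (g (inst n w)) r, inst n w)); split; first exact: (Erun r).2.
  by move=> T [s /andP [Hn' _]]; lia.
have Hgp : g (inst n w) <= p by have [] := Erun [tuple of nseq p true].
have [A [HA1 HA2]] := @isolation k L n w hk Hn p Hgp.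
exists A; split=> // r Hr; eexists; split; first exact: (Erun r).2.
move=> T [s Hs HT].
have [|o Ho Hw] := @approx k n w hk Hn (take (g (inst n w)) r) _ s Hs.
  by move=> P sv c0 a b HP Hsv Hc; exact: HA2 HP Hsv Hc.
exists o => // i; rewrite /cweight (perm_big _ HT) /=.
by rewrite (cyc_edges_cw (fun u v => w u v i)) (cyc_edges_cw (fun u v => w u v i)).
Qed.
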